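(* Let $f\colon\mathbb{R}^n\to\mathbb{R}^n$ be a proper, continuous and definable mapping. Assume the following two conditions hold: (i) $\det df(x)$ is nonnegative for all $x\in\mathbb{R}^n\setminus B_f$, or $\det df(x)$ is nonpositive for all $x\in\mathbb{R}^n\setminus B_f$; and (ii) the set of critical points of $f$ has measure zero. Then $f$ is surjective and quasi-interior.
   Context: Fix an o-minimal structure on $(\mathbb{R},+,\cdot)$, i.e. a sequence $(\mathcal{D}_n)_{n\in\mathbb{N}}$ such that: (a) $\mathcal{D}_n$ is a Boolean algebra of subsets of $\mathbb{R}^n$; (b) $X\in\mathcal{D}_m$, $Y\in\mathcal{D}_n$ imply $X\times Y\in\mathcal{D}_{m+n}$; (c) if $X\in\mathcal{D}_{n+1}$ then $\pi(X)\in\mathcal{D}_n$, where $\pi\colon\mathbb{R}^{n+1}\to\mathbb{R}^n$ is the projection on the first $n$ coordinates; (d) $\mathcal{D}_n$ contains all algebraic subsets of $\mathbb{R}^n$; (e) each set in $\mathcal{D}_1$ is a finite union of points and intervals. A set is definable if it belongs to some $\mathcal{D}_n$; a mapping is definable if its graph is definable. $\mathbb{B}_r(x)$ is the open Euclidean ball of center $x$ and radius $r$; $\mathrm{co}$ denotes convex hull. For $A\in\mathbb{R}^{n\times n}$, $\sigma(A):=\inf_{\|v\|=1}\|Av\|$. $B_f$ is the set of points of $\mathbb{R}^n$ at which $f$ is not of class $C^1$ (i.e. $f$ is not $C^1$ on any neighbourhood of the point); it is a definable nowhere dense set. For $x\in\mathbb{R}^n\setminus B_f$, $df(x)$ is the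 derivative of $f$ at $x$; for $U\subset\mathbb{R}^n$, $df(U):=\{df(x): x\in U\setminus B_f\}$. For $x\in\mathbb{R}^n$, $$\nu_f(x):=\lim_{r\to0^+}\ \inf_{A\in\mathrm{co}(df(\mathbb{B}_r(x)))}\sigma(A)\in[0,+\infty].$$ A point $x$ is a critical point of $f$ if $\nu_f(x)=0$. A continuous mapping $f\colon\mathbb{R}^n\to\mathbb{R}^n$ is proper if the preimage of every compact set is compact. It is quasi-interior if $y$ lies in the interior of $f(U)$ for every $y$ and every open set $U$ that contains a compact (connected) component of $f^{-1}(y)$. *)

(* Defs.v *)
From HB Require Import structures.
From mathcomp Require Import all_boot all_order all_algebra.
From mathcomp Require Import all_classical all_reals all_analysis.
From mathcomp Require mpoly.

Set Implicit Arguments.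
Unset Strict Implicit.
Unset Printing Implicit Defensive.

Import Order.TTheory GRing.Theory Num.Theory.
Import numFieldNormedType.Exports.

Local Open Scope classical_set_scope.
Local Open Scope ring_scope.

(* R^n is the type 'rV[R]_n, for every n including 0. Its library topology
   comes from the sup norm, hence coincides with the Euclidean one; the
   Euclidean norm itself is [enorm] below. *)

Definition algebraic_set (R : realType) (n : nat) (X : set 'rV[R]_n) : Prop :=
  exists (k : nat) (p : 'I_k -> mpoly.mpoly n R),
    X = [set x | forall j, mpoly.meval (fun i => x 0 i) (p j) = 0].

Record ominimal (R : realType) (D : forall n : nat, set (set 'rV[R]_n)) :
    Prop := {
  ominimal0 : forall n, D n set0 ;
  ominimalC : forall n (X : set 'rV[R]_n), D n X -> D n (~` X) ;
  ominimalU : forall n (X Y : set 'rV[R]_n), D n X -> D n Y -> D n (X `|` Y) ;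
  ominimalX : forall m n (X : set 'rV[R]_m) (Y : set 'rV[R]_n),
    D m X -> D n Y -> D (m + n)%N [set z | X (lsubmx z) /\ Y (rsubmx z)] ;
  ominimal_proj : forall n (X : set 'rV[R]_(n + 1)),
    D (n + 1)%N X -> D n (lsubmx @` X) ;
  ominimal_algebraic : forall n (X : set 'rV[R]_n), algebraic_set X -> D n X ;
  ominimal_tame : forall X : set 'rV[R]_1, D 1%N X ->
    exists (p : seq R) (s : seq (interval R)),
      X = [set x | x 0 0 \in p \/ exists2 i, i \in s & x 0 0 \in i] }.

Definition definable_map (R : realType) (D : forall n : nat, set (set 'rV[R]_n))
    (m n : nat) (f : 'rV[R]_m -> 'rV[R]_n) : Prop :=
  D (m + n)%N [set row_mx x (f x) | x in [set: 'rV[R]_m]].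

Definition enorm (R : realType) (m n : nat) (v : 'M[R]_(m, n)) : R :=
  Num.sqrt (\sum_i \sum_j v i j ^+ 2).

Definition eball (R : realType) (n : nat) (x : 'rV[R]_n) (r : R) :
    set 'rV[R]_n :=
  [set y | enorm (y - x) < r].

Section regularity.
Variables (R : realType) (n : nat) (f : 'rV[R]_n -> 'rV[R]_n).

(* [jacobian f x] is the matrix J with 'd f x v = v *m J; its transpose is the
   usual derivative matrix, which acts on column vectors. *)
Definition dmx (x : 'rV[R]_n) : 'M[R]_n := (jacobian f x)^T.

Definition C1_at (x : 'rV[R]_n) : Prop :=
  \forall y \near x, differentiable f y /\ {for y, continuous dmx}.

Definition nonC1 : set 'rV[R]_n := [set x | ~ C1_at x].

Definition dmx_image (U : set 'rV[R]_n) : set 'M[R]_n := dmx @` (U `\` nonC1).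

End regularity.

Definition convex_hull (R : realType) (M : lmodType R) (S : set M) : set M :=
  smallest (@convex_set R M) S.

(* The infimum is taken in \bar R so that it is +oo, not a junk value, over the
   empty unit sphere of R^0. *)
Definition sigma (R : realType) (n : nat) (A : 'M[R]_n) : \bar R :=
  ereal_inf [set (enorm (A *m v))%:E | v in [set v : 'cV[R]_n | enorm v = 1]].

(* The infimum is monotone in r, so the limit always exists in \bar R. *)
Definition nu (R : realType) (n : nat) (f : 'rV[R]_n -> 'rV[R]_n)
    (x : 'rV[R]_n) : \bar R :=
  lim (ereal_inf [set sigma A | A in convex_hull (dmx_image f (eball x r))]
         @[r --> 0^'+]).

Definition critical (R : realType) (n : nat) (f : 'rV[R]_n -> 'rV[R]_n) :
    set 'rV[R]_n :=
  [set x | nu f x = 0%E].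

(* Covers are indexed by an arbitrary K : set nat, so that finite (and empty)
   covers are allowed even when n = 0, where every box has volume 1. *)
Definition lebesgue_outer (R : realType) (n : nat) (E : set 'rV[R]_n) :
    \bar R :=
  ereal_inf [set v | exists (K : set nat) (a b : nat -> 'rV[R]_n),
    [/\ forall k i, a k 0 i <= b k 0 i,
        E `<=` \bigcup_(k in K) [set x | forall i, a k 0 i <= x 0 i <= b k 0 i]
      & v = \esum_(k in K) (\prod_i (b k 0 i - a k 0 i))%:E ]].

Definition measure_zero (R : realType) (n : nat) (E : set 'rV[R]_n) : Prop :=
  lebesgue_outer E = 0%E.

Definition proper_map (T U : topologicalType) (f : T -> U) : Prop :=
  forall K : set U, compact K -> compact (f @^-1` K).

Definition quasi_interior (T U : topologicalType) (f : T -> U) : Prop :=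
  forall (y : U) (x : T) (O : set T), f x = y ->
    compact (connected_component (f @^-1` [set y]) x) ->
    open O -> connected_component (f @^-1` [set y]) x `<=` O ->
    interior (f @` O) y.

(* Main.v *)
(* By Baire's theorem every definable set contains, or is disjoint from, some
   ball inside any given ball. Hence f is strictly differentiable with
   continuous derivative off a definable set S without interior, and S, being a
   countable union of definable images of R^(n-1), has an image f(S) that is a
   countable union of sets of box dimension < n. As critical points form a null
   set and det df = 0 forces a point to be critical, every ball around a point
   of a compact fibre component C contains x1 with f x1 outside of f(S) and
   det df(x1) <> 0. A compact neighbourhood V of C, whose boundary avoids the
   fibre, is triangulated by Kuhn's simplices; the degree of f over V at y is the
   sum of the determinants of the values on the simplices of (1, phi(f - y)) for
   a step function phi. It does not depend on y near f(C), because the sum over a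
   whole torus vanishes; it would be zero at a missed value, but it is nonzero at
   f x1 because det df has constant sign and f x1 is a regular value. So f(V)
   contains a ball. Surjectivity follows: a point of the range closest to a
   missed value exists by properness and cannot be interior to the range. *)

From HB Require Import structures.
From mathcomp Require Import all_boot all_order all_algebra fingroup perm.
From mathcomp Require Import all_classical all_reals all_analysis.
From mathcomp Require Import measurable_realfun ring lra.
From mathcomp Require mpoly.
Require Import Defs.

Set Implicit Arguments.
Unset Strict Implicit.
Unset Printing Implicit Defensive.

Import Order.TTheory GRing.Theory Num.Theory.
Import numFieldNormedType.Exports.

Local Open Scope classical_set_scope.
Local Open Scope ring_scope.

Import (canonicals) mpoly.

(** * Definable sets and maps *)

(** The derivative used throughout is the strict one, where both endpoints of the increment vary. It
    controls small simplices that lie near a point without having it as a vertex, gives local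
    Lipschitz bounds and local expansion, and makes the derivative continuous. It exists generically
    because tameness provides one-sided derivatives in the coordinate directions, which countably
    many definable comparisons with rational slopes bracket on whole balls. The degree is therefore
    computed at a nearby value outside f(S), which has positive distance to the compact image of the
    part of S in V. Such a value is found by counting: at scale 1/K the pieces of f(S) need only
    about K^(n-1) balls, while the image of a ball under an expanding map needs about K^n. No
    homology is involved. With mesh h, each determinant has the right sign up to an error e h^n, and
    a proportion of the simplices fixed before e and h, those close to x1, contributes at least a
    fixed multiple of h^n. *)

(** The free variables of a formula form a nested product of reals and rows; the coding turns such a
    product into the single row over which [D] is stated. *)
Class coordinatized (R : realType) (T : Type) := Coordinatized {
  cdim : nat ;
  cenc : T -> 'rV[R]_cdim ;
  cdec : 'rV[R]_cdim -> T ;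
  cencK : cancel cenc cdec ;
  cdecK : cancel cdec cenc }.

Arguments cdim {R} T {_}.

#[export] Instance coordinatized_scalar (R : realType) : coordinatized R R.
Proof.
apply: (@Coordinatized R R 1%N (fun t => const_mx t) (fun v => v 0 0)).
- by move=> t; rewrite mxE.
- by move=> v; apply/rowP => i; rewrite mxE ord1.
Defined.

#[export] Instance coordinatized_row (R : realType) n : coordinatized R 'rV[R]_n.
Proof. exact: (@Coordinatized R _ n id id). Defined.

#[export] Instance coordinatized_prod (R : realType) T U
  {cT : coordinatized R T} {cU : coordinatized R U} : coordinatized R (T * U).
Proof.
apply: (@Coordinatized R _ (cdim T + cdim U)%N
  (fun p => row_mx (cenc p.1) (cenc p.2))
  (fun v => (cdec (lsubmx v), cdec (rsubmx v)))).
- by case=> t u /=; rewrite row_mxKl row_mxKr !cencK.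
- by move=> v /=; rewrite !cdecK hsubmxK.
Defined.

Definition poly_fun (R : realType) n (g : 'rV[R]_n -> R) :=
  exists p : mpoly.mpoly n R, forall x, g x = mpoly.meval (fun i => x 0 i) p.

Section poly_fun.
Variable R : realType.
Implicit Types n : nat.

Lemma poly_fun_coord n (i : 'I_n) : poly_fun (fun x : 'rV[R]_n => x 0 i).
Proof. by exists (mpoly.mpolyX R (mpoly.mnm1 i)) => x; rewrite mpoly.mevalXU. Qed.

Lemma poly_fun_cst n (c : R) : poly_fun (fun _ : 'rV[R]_n => c).
Proof. by exists (mpoly.mpolyC n c) => x; rewrite mpoly.mevalC. Qed.

Lemma poly_funD n (g h : 'rV[R]_n -> R) :
  poly_fun g -> poly_fun h -> poly_fun (fun x => g x + h x).
Proof. by move=> [p gp] [q hq]; exists (p + q) => x; rewrite mpoly.mevalD gp hq. Qed.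

Lemma poly_funN n (g : 'rV[R]_n -> R) : poly_fun g -> poly_fun (fun x => - g x).
Proof. by move=> [p gp]; exists (- p) => x; rewrite mpoly.mevalN gp. Qed.

Lemma poly_funM n (g h : 'rV[R]_n -> R) :
  poly_fun g -> poly_fun h -> poly_fun (fun x => g x * h x).
Proof. by move=> [p gp] [q hq]; exists (p * q) => x; rewrite mpoly.mevalM gp hq. Qed.

Lemma poly_fun_comp m n (g : 'rV[R]_n -> R) (h : 'rV[R]_m -> 'rV[R]_n) :
  poly_fun g -> (forall j, poly_fun (fun x => h x 0 j)) ->
  poly_fun (fun x => g (h x)).
Proof.
move=> [p gp] /choice[q hq].
exists (mpoly.comp_mpoly [tuple q j | j < n] p) => x.
rewrite mpoly.comp_mpoly_meval gp; apply: mpoly.meval_eq => j.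
by rewrite tnth_mktuple hq.
Qed.

End poly_fun.

Definition poly_map (R : realType) (T U : Type) {cT : coordinatized R T}
    {cU : coordinatized R U} (h : T -> U) :=
  forall j, poly_fun (fun v => cenc (h (cdec v)) 0 j).

Section poly_map.
Variable R : realType.
Context {T U V : Type} {cT : coordinatized R T} {cU : coordinatized R U}
  {cV : coordinatized R V}.

Lemma poly_map_id : poly_map (fun x : T => x).
Proof.
move=> j; have [p pE] := @poly_fun_coord R _ j.
by exists p => x; rewrite cdecK pE.
Qed.

Lemma poly_map_cst (c : U) : poly_map (fun _ : T => c).
Proof. by move=> j; exact: poly_fun_cst. Qed.

Lemma poly_map_comp (h : T -> U) (k : U -> V) :
  poly_map h -> poly_map k -> poly_map (fun x => k (h x)).
Proof.
move=> hp kp j; have := poly_fun_comp (kp j) hp.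
by under [X in poly_fun X]eq_fun do rewrite cencK.
Qed.

Lemma poly_map_fst (h : T -> U * V) : poly_map h -> poly_map (fun x => (h x).1).
Proof.
move=> hp j; have [p pE] := hp (lshift _ j).
by exists p => x; rewrite -pE /= row_mxEl.
Qed.

Lemma poly_map_snd (h : T -> U * V) : poly_map h -> poly_map (fun x => (h x).2).
Proof.
move=> hp j; have [p pE] := hp (rshift _ j).
by exists p => x; rewrite -pE /= row_mxEr.
Qed.

Lemma poly_map_pair (h : T -> U) (k : T -> V) :
  poly_map h -> poly_map k -> poly_map (fun x => (h x, k x)).
Proof.
move=> hp kp j; case: (split_ordP (j : 'I_(cdim U + cdim V))) => i ->.
- by have [p pE] := hp i; exists p => x; rewrite /= row_mxEl.
- by have [p pE] := kp i; exists p => x; rewrite /= row_mxEr.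
Qed.

End poly_map.

Section definable.
Variables (R : realType) (D : forall n : nat, set (set 'rV[R]_n)).
Arguments D : clear implicits.
Hypothesis D_ominimal : ominimal D.

Lemma ominimalI n (X Y : set 'rV[R]_n) : D n X -> D n Y -> D n (X `&` Y).
Proof.
move=> DX DY; rewrite -[_ `&` _]setCK setCI; apply: (ominimalC D_ominimal).
by apply: (ominimalU D_ominimal); exact: (ominimalC D_ominimal).
Qed.

Lemma ominimalT n : D n setT.
Proof. by rewrite -setC0; apply: (ominimalC D_ominimal); exact: (ominimal0 D_ominimal). Qed.

Lemma ominimal_cast a b (e : b = a) (X : set 'rV[R]_a) :
  D a X -> D b [set v | X (castmx (erefl, e) v)].
Proof.
by case: a / e X.
Qed.

(** Iterates the projection axiom, which drops one coordinate at a time; the casts only reassociate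
    the dimension. *)
Lemma ominimal_lsubmx a b (Z : set 'rV[R]_(a + b)) :
  D (a + b)%N Z -> D a (lsubmx @` Z).
Proof.
elim: b Z => [|b IH] Z DZ.
  have := ominimal_cast (esym (addn0 a)) DZ; congr (D _ _).
  apply/seteqP; split => [v /= Zv|v /= [z Zz <-]].
    exists (castmx (erefl, esym (addn0 a)) v) => //.
    by apply/rowP => i; rewrite mxE castmxE; congr (v _ _); exact/val_inj.
  congr Z: Zz; apply/rowP => i; rewrite castmxE mxE; congr (z _ _).
    by rewrite ord1.
  exact/val_inj.
have e : (a + b + 1)%N = (a + b.+1)%N by rewrite -addnA addn1.
have := IH _ (ominimal_proj D_ominimal (ominimal_cast e DZ)); congr (D _ _).
have lsubE (z : 'rV[R]_(a + b + 1)) :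
    lsubmx (lsubmx z) = lsubmx (castmx (erefl, e) z).
  apply/rowP => i; rewrite !mxE castmxE; congr (z _ _); first by rewrite ord1.
  exact/val_inj.
apply/seteqP; split => [v /= [w [z Zz <-] <-]|v /= [z Zz <-]].
  by exists (castmx (erefl, e) z).
exists (lsubmx (castmx (erefl, esym e) z)); last by rewrite lsubE castmxKV.
by exists (castmx (erefl, esym e) z) => //=; rewrite castmxKV.
Qed.

Lemma ominimal_graph_poly a b (h : 'rV[R]_a -> 'rV[R]_b) :
  (forall j, poly_fun (fun x => h x 0 j)) ->
  D (a + b)%N [set z | rsubmx z = h (lsubmx z)].
Proof.
move=> hp; apply: (ominimal_algebraic D_ominimal).
have /choice[q qE] : forall j : 'I_b, poly_fun (fun z : 'rV[R]_(a + b) =>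
    rsubmx z 0 j - h (lsubmx z) 0 j).
  move=> j; apply: poly_funD.
    by have [p pE] := @poly_fun_coord R _ (rshift a j); exists p => x; rewrite mxE pE.
  apply: poly_funN; apply: (poly_fun_comp (hp j)) => i.
  by have [p pE] := @poly_fun_coord R _ (lshift b i); exists p => x; rewrite mxE pE.
exists b, q; apply/seteqP; split => z /=.
  by move=> zE j; rewrite -qE zE subrr.
by move=> zE; apply/rowP => j; apply/eqP; rewrite -subr_eq0 qE zE.
Qed.

(** The preimage is the projection of the algebraic graph of [h] cut with the product of R^a and
    [X]. *)
Lemma ominimal_preimage_poly a b (h : 'rV[R]_a -> 'rV[R]_b) (X : set 'rV[R]_b) :
  (forall j, poly_fun (fun x => h x 0 j)) -> D b X -> D a (h @^-1` X).
Proof.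
move=> hp DX; have := ominimal_lsubmx (ominimalI (ominimal_graph_poly hp)
  (ominimalX D_ominimal (ominimalT a) DX)); congr (D _ _).
apply/seteqP; split => [v /= [z [/= zE [_ Xz]] <-]|v /= Xv]; first by rewrite -zE.
by exists (row_mx v (h v)); rewrite /= ?row_mxKl ?row_mxKr.
Qed.

Definition dset (T : Type) {cT : coordinatized R T} (X : set T) :=
  D (cdim T) [set v | X (cdec v)].

Definition dfun (T U : Type) {cT : coordinatized R T} {cU : coordinatized R U}
    (h : T -> U) := dset [set p : T * U | p.2 = h p.1].

(** * Definability of first-order formulas *)

Section calculus.
Context {T : Type} {cT : coordinatized R T}.
Implicit Types P Q : T -> Prop.

Lemma dset_ext P Q : (forall x, P x <-> Q x) -> dset P -> dset Q.
Proof. by move=> PQ; rewrite (_ : P = Q)//; apply/funext => x; exact/propext. Qed.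

Lemma dset_and P Q : dset P -> dset Q -> dset (fun x => P x /\ Q x).
Proof. exact: ominimalI. Qed.

Lemma dset_or P Q : dset P -> dset Q -> dset (fun x => P x \/ Q x).
Proof. exact: (ominimalU D_ominimal). Qed.

Lemma dset_not P : dset P -> dset (fun x => ~ P x).
Proof. exact: (ominimalC D_ominimal). Qed.

Lemma dset_imp P Q : dset P -> dset Q -> dset (fun x => P x -> Q x).
Proof.
move=> dP dQ; apply: (dset_ext _ (dset_or (dset_not dP) dQ)) => x.
by split=> [[]//|PQ]; have [/PQ|] := pselect (P x); [right|left].
Qed.

Lemma dset_true : dset (fun _ : T => True).
Proof. exact: ominimalT. Qed.

Lemma dset_false : dset (fun _ : T => False).
Proof. exact: (ominimal0 D_ominimal). Qed.

Lemma dset_cst (P : Prop) : dset (fun _ : T => P).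
Proof.
have [Pt|Pf] := pselect P.
  by apply: (dset_ext _ dset_true).
by apply: (dset_ext _ dset_false).
Qed.

Lemma dset_ex {U : Type} {cU : coordinatized R U} (P : T -> U -> Prop) :
  dset (fun p : T * U => P p.1 p.2) -> dset (fun x => exists u, P x u).
Proof.
move=> /ominimal_lsubmx; congr (D _ _).
apply/seteqP; split => [v /= [z Pz <-]|v /= [u Pu]]; first by eexists; exact: Pz.
by exists (row_mx v (cenc u)); rewrite /= row_mxKl ?row_mxKr ?cencK.
Qed.

Lemma dset_all {U : Type} {cU : coordinatized R U} (P : T -> U -> Prop) :
  dset (fun p : T * U => P p.1 p.2) -> dset (fun x => forall u, P x u).
Proof.
move=> dP; have := dset_not (@dset_ex _ _ (fun x u => ~ P x u) (ominimalC D_ominimal dP)).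
apply: dset_ext => x; split; last by move=> Px [u]; exact.
by move=> nP u; apply: contrapT => nPu; apply: nP; exists u.
Qed.

Lemma dset_all_seq (I : eqType) (s : seq I) (P : I -> T -> Prop) :
  (forall i, dset (P i)) -> dset (fun x => forall i, i \in s -> P i x).
Proof.
move=> dP; elim: s => [|i s IH].
  by apply: (dset_ext _ dset_true) => x; split.
apply: (dset_ext _ (dset_and (dP i) IH)) => x; split.
  by move=> [Pi Ps] j; rewrite inE => /orP[/eqP->//|]; exact: Ps.
move=> Ps; split; first by apply: Ps; rewrite mem_head.
by move=> j js; apply: Ps; rewrite inE js orbT.
Qed.

Lemma dset_all_fin (I : finType) (P : I -> T -> Prop) :
  (forall i, dset (P i)) -> dset (fun x => forall i, P i x).
Proof.
move=> /(dset_all_seq (enum I)); apply: dset_ext => x; split=> Px i => //.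
by apply: Px; rewrite mem_enum.
Qed.

Lemma dset_poly {U : Type} {cU : coordinatized R U} (h : T -> U) (X : set U) :
  poly_map h -> dset X -> dset (fun x => X (h x)).
Proof.
move=> hp dX; have := ominimal_preimage_poly hp dX; congr (D _ _).
by apply/seteqP; split=> v /=; rewrite cencK.
Qed.

Lemma dfun_poly {U : Type} {cU : coordinatized R U} (h : T -> U) :
  poly_map h -> dfun h.
Proof.
move=> hp; have := ominimal_graph_poly hp; congr (D _ _).
apply/seteqP; split=> v /=; first by move=> ->; rewrite cencK.
by move=> <-; rewrite cdecK.
Qed.

End calculus.

Section calculus2.
Context {T : Type} {cT : coordinatized R T}.

Lemma dset_comp {U : Type} {cU : coordinatized R U} (h : T -> U) (X : set U) :
  dfun h -> dset X -> dset (fun x => X (h x)).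
Proof.
move=> dh dX.
have dS : dset (fun p : T * U => X p.2).
  by apply: dset_poly dX; apply: poly_map_snd; exact: poly_map_id.
have := @dset_ex _ _ _ _ (fun x u => u = h x /\ X u) (ominimalI dh dS).
by apply: dset_ext => x; split=> [[u [->]]//|Xh]; exists (h x).
Qed.

Lemma dfun_id : dfun (fun x : T => x).
Proof. by apply: dfun_poly; exact: poly_map_id. Qed.

Lemma dfun_cst {U : Type} {cU : coordinatized R U} (c : U) : dfun (fun _ : T => c).
Proof. by apply: dfun_poly; exact: poly_map_cst. Qed.

Lemma dfun_comp {U V : Type} {cU : coordinatized R U} {cV : coordinatized R V}
    (h : T -> U) (k : U -> V) : dfun h -> dfun k -> dfun (fun x => k (h x)).
Proof.
move=> dh dk.
have d1 : dset (fun q : T * V * U => q.2 = h q.1.1).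
  apply: (@dset_poly _ _ _ _ (fun q : T * V * U => (q.1.1, q.2))
    [set p : T * U | p.2 = h p.1]) => //.
  by apply: poly_map_pair; [do 2!apply: poly_map_fst|apply: poly_map_snd];
    exact: poly_map_id.
have d2 : dset (fun q : T * V * U => q.1.2 = k q.2).
  apply: (@dset_poly _ _ _ _ (fun q : T * V * U => (q.2, q.1.2))
    [set p : U * V | p.2 = k p.1]) => //.
  by apply: poly_map_pair; [|apply: poly_map_snd; apply: poly_map_fst];
    rewrite -?/(poly_map snd); try apply: poly_map_snd; exact: poly_map_id.
have := @dset_ex _ _ _ _ (fun p u => u = h p.1 /\ p.2 = k u) (ominimalI d1 d2).
by apply: dset_ext => -[x z] /=; split=> [[u [-> ->]]//|->]; exists (h x).
Qed.

Lemma dfun_pair {U V : Type} {cU : coordinatized R U} {cV : coordinatized R V}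
    (h : T -> U) (k : T -> V) : dfun h -> dfun k -> dfun (fun x => (h x, k x)).
Proof.
move=> dh dk.
have d1 : dset (fun q : T * (U * V) => q.2.1 = h q.1).
  apply: (@dset_poly _ _ _ _ (fun q : T * (U * V) => (q.1, q.2.1))
    [set p : T * U | p.2 = h p.1]) => //.
  by apply: poly_map_pair; [|apply: poly_map_fst; apply: poly_map_snd];
    try apply: poly_map_fst; exact: poly_map_id.
have d2 : dset (fun q : T * (U * V) => q.2.2 = k q.1).
  apply: (@dset_poly _ _ _ _ (fun q : T * (U * V) => (q.1, q.2.2))
    [set p : T * V | p.2 = k p.1]) => //.
  by apply: poly_map_pair; [apply: poly_map_fst|do 2!apply: poly_map_snd];
    exact: poly_map_id.
apply: (dset_ext _ (dset_and d1 d2)) => -[x [u v]] /=.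
by split=> [[-> ->]//|[-> ->]].
Qed.

Lemma dfun_fst {U V : Type} {cU : coordinatized R U} {cV : coordinatized R V}
  (h : T -> U * V) : dfun h -> dfun (fun x => (h x).1).
Proof.
move=> dh; apply: (dfun_comp dh); apply: dfun_poly.
by apply: poly_map_fst; exact: poly_map_id.
Qed.

Lemma dfun_snd {U V : Type} {cU : coordinatized R U} {cV : coordinatized R V}
  (h : T -> U * V) : dfun h -> dfun (fun x => (h x).2).
Proof.
move=> dh; apply: (dfun_comp dh); apply: dfun_poly.
by apply: poly_map_snd; exact: poly_map_id.
Qed.

Lemma dset_eq {U : Type} {cU : coordinatized R U} (h k : T -> U) :
  dfun h -> dfun k -> dset (fun x => h x = k x).
Proof.
move=> dh dk; apply: (@dset_comp _ _ (fun x => (k x, h x))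
  [set p : U * U | p.2 = p.1]); first exact: dfun_pair.
exact: (dfun_poly (@poly_map_id R U cU)).
Qed.

Lemma dfun_coord n (h : T -> 'rV[R]_n) i : dfun h -> dfun (fun x => h x 0 i).
Proof.
move=> dh; apply: (dfun_comp dh (k := fun v : 'rV[R]_n => v 0 i)).
apply: dfun_poly => j /=.
by have [p pE] := @poly_fun_coord R _ i; exists p => x; rewrite mxE pE.
Qed.

Lemma dfun_row n (h : T -> 'rV[R]_n) :
  (forall i, dfun (fun x => h x 0 i)) -> dfun h.
Proof.
move=> dh; have : dset (fun p : T * 'rV[R]_n => forall i, p.2 0 i = h p.1 0 i).
  apply: dset_all_fin => i.
  apply: (@dset_poly _ _ _ _ (fun q : T * 'rV[R]_n => (q.1, q.2 0 i))
    [set p : T * R | p.2 = h p.1 0 i]); last exact: dh.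
  apply: poly_map_pair; first by apply: poly_map_fst; exact: poly_map_id.
  apply: (poly_map_comp (h := snd) (k := fun v : 'rV[R]_n => v 0 i)).
    by apply: poly_map_snd; exact: poly_map_id.
  move=> j /=; have [p pE] := @poly_fun_coord R _ i.
  by exists p => x; rewrite mxE pE.
by apply: dset_ext => -[x v] /=; split=> [/rowP//|->].
Qed.

Lemma dfunD (g h : T -> R) : dfun g -> dfun h -> dfun (fun x => g x + h x).
Proof.
move=> dg dh; apply: (dfun_comp (dfun_pair dg dh) (k := fun p => p.1 + p.2)).
apply: dfun_poly => j /=.
have [p pE] := poly_funD (@poly_fun_coord R _ (lshift 1 0)) (@poly_fun_coord R _ (rshift 1 0)).
by exists p => x; rewrite !mxE pE.
Qed.

Lemma dfunM (g h : T -> R) : dfun g -> dfun h -> dfun (fun x => g x * h x).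
Proof.
move=> dg dh; apply: (dfun_comp (dfun_pair dg dh) (k := fun p => p.1 * p.2)).
apply: dfun_poly => j /=.
have [p pE] := poly_funM (@poly_fun_coord R _ (lshift 1 0)) (@poly_fun_coord R _ (rshift 1 0)).
by exists p => x; rewrite !mxE pE.
Qed.

Lemma dfunN (g : T -> R) : dfun g -> dfun (fun x => - g x).
Proof.
move=> dg; have := dfunM (dfun_cst (-1 : R)) dg.
by rewrite (_ : (fun x => -1 * g x) = (fun x => - g x))//; apply/funext => x; rewrite mulN1r.
Qed.

Lemma dfunB (g h : T -> R) : dfun g -> dfun h -> dfun (fun x => g x - h x).
Proof. by move=> dg dh; apply: dfunD => //; exact: dfunN. Qed.

End calculus2.

Section calculus3.
Context {T : Type} {cT : coordinatized R T}.

(** The order comes from the ring operations: a real is positive exactly when its product with some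
    square is 1. *)
Lemma dset_lt (g h : T -> R) : dfun g -> dfun h -> dset (fun x => g x < h x).
Proof.
move=> dg dh.
have : dset (fun x : T => exists c : R, (h x - g x) * (c * c) = 1).
  apply: (@dset_ex _ _ R _ (fun x c => (h x - g x) * (c * c) = 1)).
  have d1 k : dfun k -> dfun (fun p : T * R => (k : T -> R) p.1).
    by move=> dk; apply: (dfun_comp _ dk); apply: dfun_fst; exact: dfun_id.
  have d2 : dfun (fun p : T * R => p.2) by apply: dfun_snd; exact: dfun_id.
  apply: dset_eq; last exact: dfun_cst.
  by apply: dfunM; [apply: dfunB; exact: d1|exact: dfunM].
apply: dset_ext => x; split=> [[c gh]|gh].
  rewrite -subr_gt0 ltNge; apply/negP => hg.
  have : (h x - g x) * (c * c) <= 0.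
    by apply: mulr_le0_ge0 => //; rewrite -expr2 sqr_ge0.
  by rewrite gh ler10.
have s0 : 0 < h x - g x by rewrite subr_gt0.
exists (Num.sqrt (h x - g x))^-1.
by rewrite -expr2 exprVn sqr_sqrtr ?ltW// mulfV// gt_eqF.
Qed.

Lemma dset_le (g h : T -> R) : dfun g -> dfun h -> dset (fun x => g x <= h x).
Proof.
move=> dg dh; apply: (dset_ext _ (dset_not (dset_lt dh dg))) => x.
by rewrite leNgt; split=> /negP.
Qed.

End calculus3.

End definable.

(** Recursion on the syntax of a formula: a bound variable becomes the second component of a
    product, and a universal quantifier over a finite type becomes a finite conjunction. *)
Ltac dset_rec om :=
  cbv beta delta [mkset];
  lazymatch goal with
  | |- dset _ (fun x => _ /\ _) => apply: (dset_and om); dset_rec om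
  | |- dset _ (fun x => _ \/ _) => apply: (dset_or om); dset_rec om
  | |- dset _ (fun x => ~ _) => apply: (dset_not om); dset_rec om
  | |- dset _ (fun x => exists u, _) => apply: (dset_ex om); dset_rec om
  | |- dset _ (fun x => is_true (@Order.lt _ _ _ _)) => apply: (dset_lt om); dset_rec om
  | |- dset _ (fun x => is_true (@Order.le _ _ _ _)) => apply: (dset_le om); dset_rec om
  | |- dset _ (fun x => @?P x -> @?Q x) =>
      first [ apply: (@dset_imp _ _ om _ _ P Q)
            | apply: (dset_all_fin om) => ? | apply: (dset_all om) ]; dset_rec om
  | |- dset _ (fun x => forall u, _) =>
      first [ apply: (dset_all_fin om) => ? | apply: (dset_all om) ]; dset_rec om
  | |- dset _ (fun x => _ = _) => apply: (dset_eq om); dset_rec om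
  | |- dfun _ (fun x => x) => exact: (dfun_id om)
  | |- dfun _ (fun _ => ?c) => exact: (dfun_cst om)
  | H : dfun _ ?g |- dfun _ ?g => exact: H
  | H : dset _ ?X |- dset _ ?X => exact: H
  | |- dfun _ (@GRing.mul _ _) => apply: (@dfunM _ _ om _ _ (fun=> _) id); dset_rec om
  | |- dfun _ (@GRing.add _ _) => apply: (@dfunD _ _ om _ _ (fun=> _) id); dset_rec om
  | |- dfun _ (@GRing.opp _) => exact: (dfunN om (dfun_id om))
  | |- dfun _ id => exact: (dfun_id om)
  | |- dfun _ fst => exact: (dfun_fst om (dfun_id om))
  | |- dfun _ snd => exact: (dfun_snd om (dfun_id om))
  | |- dfun _ (fun x => (@?h x).1) => apply: (dfun_fst om (h := h)); dset_rec om
  | |- dfun _ (fun x => (@?h x).2) => apply: (dfun_snd om (h := h)); dset_rec om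
  | |- dfun _ (fun x => @GRing.add _ _ (- _)) => apply: (dfunB om); dset_rec om
  | |- dfun _ (fun x => @GRing.add _ _ _) => apply: (dfunD om); dset_rec om
  | |- dfun _ (fun x => @GRing.mul _ _ _) => apply: (dfunM om); dset_rec om
  | |- dfun _ (fun x => @GRing.opp _ _) => apply: (dfunN om); dset_rec om
  | |- dfun _ (fun x => fun_of_matrix _ 0 _) => apply: (dfun_coord om); dset_rec om
  | |- dfun _ (fun x => (_, _)) => apply: (dfun_pair om); dset_rec om
  | H : dset _ ?X |- dset _ (fun x => ?X (@?h x)) =>
      apply: (@dset_comp _ _ om _ _ _ _ h X _ H); dset_rec om
  | H : dfun _ ?g |- dfun _ (fun x => ?g (@?h x)) =>
      apply: (@dfun_comp _ _ om _ _ _ _ _ _ h g _ H); dset_rec om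
  | |- _ => idtac
  end.

Ltac dset_tac := match goal with om : ominimal _ |- _ => dset_rec om end.

(** * Baire category and definable sets *)

HB.instance Definition _ (R : realType) (n : nat) := Complete.on 'rV[R]_n.

Section rV_ball.
Variable R : realType.
Implicit Types n : nat.

Lemma rV_ballE n (x y : 'rV[R]_n) r :
  0 < r -> ball x r y <-> forall i, `|x 0 i - y 0 i| < r.
Proof.
move=> r0; split=> [[_ xy] i|xy]; first exact: xy.
by split=> // i j; rewrite ord1; exact: xy.
Qed.

Lemma rV_norm_le n (x : 'rV[R]_n) r :
  0 <= r -> (forall i, `|x 0 i| <= r) -> `|x| <= r.
Proof.
move=> r0 xr; rewrite -[leLHS]/(mx_norm x) mx_normrE.
by apply/bigmax_leP; split=> // -[i j] _ /=; rewrite ord1.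
Qed.

Lemma rV_norm_coord n (x : 'rV[R]_n) i : `|x 0 i| <= `|x|.
Proof.
rewrite -[leRHS]/(mx_norm x) mx_normrE.
exact: (le_bigmax _ (fun ij : 'I_1 * 'I_n => `|x ij.1 ij.2|) (0, i)).
Qed.

Lemma rV_norm_lt n (x : 'rV[R]_n) r :
  0 < r -> (forall i, `|x 0 i| < r) -> `|x| < r.
Proof.
move=> r0 xr; have /rV_ballE : forall i, `|(0 : 'rV[R]_n) 0 i - x 0 i| < r.
  by move=> i; rewrite mxE sub0r normrN.
by move=> /(_ r0); rewrite -ball_normE /ball_/= sub0r normrN.
Qed.

Lemma sub_ball n (x y : 'rV[R]_n) r : ball x r y ->
  exists2 s, 0 < s & ball y s `<=` ball x r.
Proof.
rewrite -ball_normE /ball_/= => xy; exists (r - `|x - y|); first by rewrite subr_gt0.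
move=> z /= yz.
by rewrite -(subrKA y) (le_lt_trans (ler_normD _ _))// -ltrBrDl.
Qed.

(** Otherwise the complements of the closures are dense open sets, and a common point of them in the
    ball is left uncovered. *)
Lemma Baire_cover n (J : countType) (A : J -> set 'rV[R]_n) x r : 0 < r ->
  ball x r `<=` \bigcup_i A i ->
  exists i y s, [/\ 0 < s, ball y s `<=` ball x r & ball y s `<=` closure (A i)].
Proof.
move=> r0 xA; apply: contrapT => nA.
pose B k := if unpickle k is Some i then A i else set0.
(* Cutting with the ball makes [F k] dense in the whole space, although nothing is assumed outside
   of the ball. *)
pose F k := ~` closure (B k `&` ball x r).
have /(@Baire R 'rV[R]_n F) FD : forall k, open (F k) /\ dense (F k).
  move=> k; split; first by apply: closed_openC; exact: closed_closure.
  move=> O [y Oy] oO; apply: contrapT => OF.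
  have OB : O `<=` closure (B k `&` ball x r).
    by move=> z Oz; apply: contrapT => zB; apply: OF; exists z.
  have [z [[Bz xz] Oz]] := OB _ Oy _ (open_nbhs_nbhs (conj oO Oy)).
  move: Bz OB; rewrite /B; case: (unpickle k) => // i Aiz OB.
  have /nbhs_ballP[s/= s0 zs] : nbhs z (O `&` ball x r).
    apply: filterI; first exact: open_nbhs_nbhs.
    by have [t t0 tx] := sub_ball xz; apply/nbhs_ballP; exists t.
  apply: nA; exists i, z, s; split=> // w /zs[Ow]//.
  by move=> _; apply: (closureS _ (OB _ Ow)); exact: subIsetl.
have [|y [xy FB]] := FD _ _ (ball_open x r); first by exists x; exact: ballxx.
have [i _ Aiy] := xA _ xy.
suff : closure (B (pickle i) `&` ball x r) y by have := FB (pickle i) I.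
by apply: subset_closure; rewrite /B pickleK.
Qed.

End rV_ball.

(** Equivalently, the boundary of [X] has empty interior. *)
Definition decidable_set (R : realType) n (X : set 'rV[R]_n) :=
  forall x r, 0 < r -> exists y s, [/\ 0 < s, ball y s `<=` ball x r &
    ball y s `<=` X \/ ball y s `<=` ~` X].

Section tame.
Variables (R : realType) (D : forall n : nat, set (set 'rV[R]_n)).
Hypothesis D_ominimal : ominimal D.

(** Sets that are constant just to the right of [a] are closed under finite unions and include all
    intervals, in particular points. *)
Lemma tame_right (X : set R) a : dset D X -> exists2 d, 0 < d &
  (forall t, a < t < a + d -> X t) \/ (forall t, a < t < a + d -> ~ X t).
Proof.
pose germ (Y : set R) := exists2 d, 0 < d &
  (forall t, a < t < a + d -> Y t) \/ (forall t, a < t < a + d -> ~ Y t).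
have germU (Y Z : set R) : germ Y -> germ Z -> germ (Y `|` Z).
  move=> [d d0 Yd] [e e0 Ze]; exists (Num.min d e); first by rewrite lt_min d0.
  have dt t : a < t < a + Num.min d e -> (a < t < a + d) && (a < t < a + e).
    by rewrite -!andbA; case: (ltP d e) => de /andP[-> ?] /=; lra.
  case: Yd => Yd; first by left => t /dt/andP[/Yd]; left.
  case: Ze => Ze; first by left => t /dt/andP[_ /Ze]; right.
  by right => t /dt/andP[/Yd ? /Ze ?] [].
have germ_itv (Y : set R) : is_interval Y -> germ Y.
  move=> Yi; have [[d d0 Yd]|nY] :=
      pselect (exists2 d, 0 < d & forall t, a < t < a + d -> ~ Y t).
    by exists d => //; right.
  have {}nY d : 0 < d -> exists2 t, a < t < a + d & Y t.
    move=> d0; apply: contrapT => nt; apply: nY; exists d => // t atd Yt.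
    by apply: nt; exists t.
  have [t0 /andP[at0 _] Yt0] := nY 1 ltr01.
  exists (t0 - a); first by rewrite subr_gt0.
  left=> t /andP[at_ tt0]; have [|t1 /andP[_ t1t] Yt1] := nY (t - a).
    by rewrite subr_gt0.
  by apply: (Yi _ _ Yt1 Yt0); lra.
move=> /(ominimal_tame D_ominimal) [p [s Xps]].
rewrite -/(germ X) (_ : X = [set t | t \in p] `|` [set t | exists2 i, i \in s & t \in i]).
  apply: (germU).
    elim: p {Xps} => [|b p IH]; first by exists 1 => //; right.
    rewrite (_ : mkset _ = [set b] `|` [set t | t \in p]).
      apply: (germU) => //; apply: (germ_itv) => c d /= -> -> t tb.
      by apply/eqP; rewrite eq_le andbC.
    apply/seteqP; split => t /=; rewrite inE; first by case/predU1P => [->|]; [left|right].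
    by case=> [->|->]; rewrite ?eqxx ?orbT.
  elim: s {Xps} => [|b s IH]; first by exists 1 => //; right => t _ [].
  rewrite (_ : mkset _ = [set` b] `|` [set t | exists2 i, i \in s & t \in i]).
    by apply: (germU) => //; apply: (germ_itv); exact: interval_is_interval.
  apply/seteqP; split => t /=.
    by case=> i; rewrite inE => /predU1P[->|is_ ti]; [left|right; exists i].
  by case=> [tb|[i is_ ti]]; [exists b => //|exists i => //]; rewrite inE ?eqxx ?is_ ?orbT.
apply/funext => t; have /= := congr1 (fun Y => Y (const_mx t)) Xps.
by rewrite !mxE.
Qed.

(** Rational endpoints leave countably many cases, as the use of Baire's theorem requires. *)
Lemma tame_rat (X : set R) (a b : R) : a < b -> dset D X -> exists c d : rat,
  [/\ a < ratr c, (ratr c : R) < ratr d, ratr d < b &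
    (forall t : R, ratr c < t < ratr d -> X t) \/
    (forall t : R, ratr c < t < ratr d -> ~ X t)].
Proof.
move=> ab /(tame_right a)[d d0 Xd].
have ad : a < Num.min (a + d) b by rewrite lt_min ab ltrDl d0.
have [c /andP[ac cd]] := rat_in_itvoo ad.
have [e /andP[ce ed]] := rat_in_itvoo cd.
exists c, e; split => //; first by apply: lt_le_trans ed _; rewrite ge_min lexx orbT.
have ed' : ratr e < a + d by apply: lt_le_trans ed _; rewrite ge_min lexx.
by case: Xd => Xd; [left|right] => t /andP[ct te]; apply: Xd; rewrite (lt_trans ac ct) (lt_trans te).
Qed.

Lemma dset_fiber n (X : set 'rV[R]_(n + 1)) v : dset D X ->
  dset D (fun t : R => X (row_mx v (const_mx t))).
Proof.
move=> dX; apply: (@dset_comp _ _ D_ominimal _ _ _ _ _ X _ dX) => //.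
apply: (dfun_row D_ominimal) => j; case: (split_ordP j) => i ->.
  by under [X in dfun D X]eq_fun do rewrite row_mxEl; exact: dfun_cst.
under [X in dfun D X]eq_fun do rewrite row_mxEr mxE; exact: dfun_id.
Qed.

Lemma dfun_row_mx (T : Type) (cT : coordinatized R T) m n
    (g : T -> 'rV[R]_m) (h : T -> 'rV[R]_n) :
  dfun D g -> dfun D h -> dfun D (fun x => row_mx (g x) (h x)).
Proof.
move=> dg dh; apply: (dfun_row D_ominimal) => j; case: (split_ordP j) => i ->.
  by under [X in dfun D X]eq_fun do rewrite row_mxEl; exact: dfun_coord.
by under [X in dfun D X]eq_fun do rewrite row_mxEr; exact: dfun_coord.
Qed.

Lemma dfun_const_mx (T : Type) (cT : coordinatized R T) n (g : T -> R) :
  dfun D g -> dfun D (fun x => const_mx (g x) : 'rV[R]_n).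
Proof.
move=> dg; apply: (dfun_row D_ominimal) => j.
by under [X in dfun D X]eq_fun do rewrite mxE.
Qed.

Lemma decidable_somewhere_dense n (X : set 'rV[R]_n) y s : decidable_set X ->
  0 < s -> ball y s `<=` closure X ->
  exists z r, [/\ 0 < r, ball z r `<=` ball y s & ball z r `<=` X].
Proof.
move=> dX s0 yX; have [z [r [r0 zr zX]]] := dX y s s0.
exists z, r; split=> //; case: zX => // zX.
have [w [Xw zw]] := yX _ (zr _ (ballxx _ r0)) _ (nbhsx_ballx _ _ r0).
by have := zX _ zw.
Qed.

Lemma rV_split n (z : 'rV[R]_(n + 1)) :
  z = row_mx (lsubmx z) (const_mx (rsubmx z 0 0)).
Proof.
rewrite -[LHS]hsubmxK; congr row_mx.
by apply/rowP => i; rewrite !mxE ord1.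
Qed.

Lemma ball_row_mx n (v w : 'rV[R]_n) (t u : R) r : 0 < r ->
  ball (row_mx v (const_mx t : 'rV_1)) r (row_mx w (const_mx u : 'rV_1)) <->
  ball v r w /\ `|t - u| < r.
Proof.
move=> r0; rewrite !rV_ballE//; split=> [H|[H tu] i].
  split=> [i|]; first by have := H (lshift 1 i); rewrite !row_mxEl.
  by have := H (rshift n 0); rewrite !row_mxEr !mxE.
by case: (split_ordP i) => j ->; rewrite ?row_mxEl ?row_mxEr ?mxE.
Qed.

(** Induction on the dimension by slices. On each vertical line [X] is constant over some rational
    interval. By Baire one interval and one truth value serve for a dense set of base points of some
    ball; this set is definable, so by induction they serve for all base points of a smaller ball,
    and a box results. *)
Theorem dset_decidable n (X : set 'rV[R]_n) : dset D X -> decidable_set X.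
Proof.
elim: n X => [|n IH] X.
  move=> _ x r r0; exists x, r; split=> //.
  have [Xx|nXx] := pselect (X x); [left|right] => z _;
    by rewrite /setC/= (_ : z = x)//; apply/rowP => -[].
move: X; rewrite -[n.+1]addn1 => X dX x r r0.
pose v := lsubmx x; pose t := rsubmx x 0 0.
pose A (i : rat * rat * bool) : set 'rV[R]_n := [set w |
  (t - r < ratr i.1.1 /\ (ratr i.1.1 : R) < ratr i.1.2) /\ (ratr i.1.2 < t + r /\
   if i.2 then forall u : R, (ratr i.1.1 < u /\ u < ratr i.1.2) -> X (row_mx w (const_mx u))
   else forall u : R, (ratr i.1.1 < u /\ u < ratr i.1.2) -> ~ X (row_mx w (const_mx u)))].
have dA i : dset D (A i).
  have dr : dfun D (fun p : 'rV[R]_n * R => row_mx p.1 (const_mx p.2) : 'rV_(n + 1)).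
    by apply: dfun_row_mx; [dset_tac|apply: dfun_const_mx; dset_tac].
  have dXr := dset_comp D_ominimal dr dX.
  rewrite /A; do 2!apply: dset_and => //; try exact: dset_cst.
  case: i => -[c d] [] /=; apply: (dset_all D_ominimal);
  apply: dset_imp => //; try (dset_tac; fail).
have [|i [y [s [s0 ys yA]]]] := @Baire_cover R n _ A v r r0.
  move=> w vw; have tr : t - r < t + r by lra.
  have [c [d [tc cd dt cdX]]] := tame_rat tr (dset_fiber w dX).
  by case: cdX => cdX; [exists (c, d, true)|exists (c, d, false)] => //; split => //=; split => // u [cu ud]; apply: cdX; rewrite cu.
have [z [q [q0 zq zA]]] := decidable_somewhere_dense (IH _ (dA i)) s0 yA.
case: i {dA yA} zA => [[c d] b] zA.
have [[tc cd] [dt _]] := zA _ (ballxx _ q0); rewrite /= in tc cd dt.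
pose m : R := (ratr c + ratr d) / 2; pose e := Num.min q ((ratr d - ratr c) / 2).
have e0 : 0 < e by rewrite lt_min q0/=; lra.
have eq_ : e <= q by rewrite ge_min lexx.
have ecd : e <= (ratr d - ratr c) / 2 by rewrite ge_min lexx orbT.
exists (row_mx z (const_mx m)), e; split=> //.
  move=> w; rewrite (rV_split x) (rV_split w) !ball_row_mx// => -[zw mw]; split.
    by apply: ys; apply: zq; exact: le_ball zw.
  by move: mw; rewrite -/t /m !ltr_norml => /andP[? ?]; apply/andP; split; lra.
case: b zA => zA; [left|right] => w; rewrite (rV_split w) ball_row_mx// => -[zw mw];
  have [_ [_ /= ]] := zA _ (le_ball eq_ zw); apply; move: mw; rewrite /m ltr_norml => /andP[? ?]; split; lra.
Qed.

End tame.

(** * Generic regularity of definable functions *)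

Lemma fin_min_pos (R : realType) (I : finType) (Q : I -> R -> Prop) :
  (forall i d e, 0 < e <= d -> Q i d -> Q i e) ->
  (forall i, exists2 d, 0 < d & Q i d) -> exists2 d, 0 < d & forall i, Q i d.
Proof.
move=> Qmono Qd.
have /choice[d dP] : forall i, exists d, 0 < d /\ Q i d.
  by move=> i; have [d ? ?] := Qd i; exists d.
have m0 : 0 < \big[Num.min/1]_i d i.
  by apply/bigmin_gtP; split=> // i _; have [] := dP i.
exists (\big[Num.min/1]_i d i) => // i.
by apply: Qmono (dP i).2; rewrite m0 bigmin_le_cond.
Qed.

(* Continuity at the points of [a, b] propagates the inequality [h a <= h x]
   to the supremum of the x up to which it holds. *)
Lemma le_of_right_le (R : realType) (h : R -> R) a b : a <= b ->
  (forall x, a <= x <= b -> forall e, 0 < e -> exists2 d, 0 < d &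
    forall y, a <= y <= b -> `|y - x| < d -> `|h y - h x| < e) ->
  (forall x, a <= x < b -> exists2 d, 0 < d &
    forall t, x < t < x + d -> h x <= h t) -> h a <= h b.
Proof.
move=> ab hc hr.
pose E := [set x | a <= x <= b /\ forall y, a <= y <= x -> h a <= h y].
have Ea : E a by split; rewrite ?lexx// => y; rewrite -eq_le => /eqP ->.
have Eb x : E x -> x <= b by case=> /andP[].
have Esup : has_sup E by split; [exists a|exists b => x /Eb].
pose s := sup E.
have as_ : a <= s by apply: ub_le_sup => //; exists b => x /Eb.
have sb : s <= b by apply: ge_sup => [|x /Eb//]; exists a.
have lts y : a <= y < s -> h a <= h y.
  move=> /andP[ay ys]; have sy0 : 0 < s - y by rewrite subr_gt0.
  have [x [_ Ex] sx] := sup_adherent sy0 Esup.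
  by apply: Ex; rewrite ay /=; move: sx; rewrite -/s; lra.
have hs : h a <= h s.
  have [->//|as'] := eqVneq a s.
  rewrite leNgt; apply/negP => hsa.
  have sab : a <= s <= b by rewrite as_.
  have [|d d0 hd] := hc s sab (h a - h s); first by rewrite subr_gt0.
  pose y := Num.max a (s - d / 2).
  have lt_as : a < s by rewrite lt_neqAle as'.
  have ay : a <= y by rewrite le_max lexx.
  have ys : y < s by rewrite gt_max lt_as/=; lra.
  have yd : s - d / 2 <= y by rewrite le_max lexx orbT.
  have yb : y <= b by lra.
  have := lts y; rewrite ay ys => /(_ isT).
  have := hd y; rewrite ay yb => /(_ isT); rewrite !ltr_norml => H1 H2.
  have /andP[] : - (h a - h s) < h y - h s < h a - h s.
    by apply: H1; apply/andP; split; lra.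
  lra.
have Es : E s.
  split; first by rewrite as_.
  move=> y /andP[ay]; rewrite le_eqVlt => /predU1P[->//|ys].
  by apply: lts; rewrite ay.
have [<-//|sb'] := eqVneq s b.
have lt_sb : s < b by rewrite lt_neqAle sb'.
have [|d d0 hd] := hr s; first by rewrite as_.
pose t := Num.min b (s + d / 2).
have st : s < t by rewrite lt_min lt_sb/=; lra.
have tb : t <= b by rewrite ge_min lexx.
have td : t <= s + d / 2 by rewrite ge_min lexx orbT.
suff /(ub_le_sup (proj2 Esup)) : E t by rewrite -/s; lra.
split; first by apply/andP; split; lra.
move=> y /andP[ay yt]; have [ys|sy] := leP y s; first by apply: Es.2; rewrite ay.
by apply: (le_trans hs); apply: hd; rewrite sy/=; lra.
Qed.

(** Strict differentiability: the estimate is for any two points near [x], not only for increments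
    that start at [x]. *)
Definition strict_grad (R : realType) n (g : 'rV[R]_n -> R) x (L : 'rV[R]_n) :=
  forall e, 0 < e -> exists2 d, 0 < d & forall y z, ball x d y -> ball x d z ->
    `|g y - g z - \sum_i L 0 i * (y 0 i - z 0 i)| <= e * `|y - z|.

Section generic.
Variables (R : realType) (D : forall n : nat, set (set 'rV[R]_n)).
Hypothesis D_ominimal : ominimal D.

Lemma dset_Baire n (J : countType) (A : J -> set 'rV[R]_n) x r : 0 < r ->
  (forall j, dset D (A j)) -> ball x r `<=` \bigcup_j A j ->
  exists j y s, [/\ 0 < s, ball y s `<=` ball x r & ball y s `<=` A j].
Proof.
move=> r0 dA /(Baire_cover r0)[j [y [s [s0 ys yA]]]].
have [z [q [q0 zq zA]]] :=
  decidable_somewhere_dense (dset_decidable D_ominimal (dA j)) s0 yA.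
by exists j, z, q; split=> //; exact: subset_trans zq ys.
Qed.

(** For each [j] the points near which membership in [A j] is not constant form a nowhere dense set,
    and countably many of these do not fill a ball. The radius [s] depends on [j]. *)
Lemma dset_generic n (J : countType) (A : J -> set 'rV[R]_n) x r : 0 < r ->
  (forall j, dset D (A j)) ->
  exists2 y, ball x r y & forall j, exists2 s, 0 < s &
    ball y s `<=` A j \/ ball y s `<=` ~` A j.
Proof.
move=> r0 dA; apply: contrapT => ngen.
pose B j := [set y | ~ exists2 s, 0 < s & ball y s `<=` A j \/ ball y s `<=` ~` A j].
have [y xy|j [y [s [s0 ys yB]]]] := @Baire_cover R n J B x r r0.
  apply: contrapT => yB; apply: ngen; exists y => // j.
  by apply: contrapT => nA; apply: yB; exists j.
have [z [q [q0 zq zA]]] := dset_decidable D_ominimal (dA j) y s0.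
have [w [Bw zw]] := yB z (zq _ (ballxx z q0)) _ (nbhsx_ballx _ _ q0).
apply: Bw; have [t t0 wt] := sub_ball zw; exists t => //.
by case: zA => zA; [left|right]; exact: subset_trans wt zA.
Qed.

Lemma dset_dense n (A : set 'rV[R]_n) x r : 0 < r -> dset D A ->
  (forall y s, 0 < s -> exists2 z, ball y s z & A z) ->
  exists y s, [/\ 0 < s, ball y s `<=` ball x r & ball y s `<=` A].
Proof.
move=> r0 dA Ad; have [y [s [s0 ys yA]]] := dset_decidable D_ominimal dA x r0.
exists y, s; split=> //; case: yA => // yA.
by have [z /yA] := Ad y s s0.
Qed.

Lemma dfun_sum (T : Type) (cT : coordinatized R T) n (g : 'I_n -> T -> R) :
  (forall i, dfun D (g i)) -> dfun D (fun x => \sum_i g i x).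
Proof.
move=> dg; elim: n g dg => [|n IH] g dg.
  by under [X in dfun D X]eq_fun do rewrite big_ord0; exact: dfun_cst.
under [X in dfun D X]eq_fun do rewrite big_ord_recl.
by apply: dfunD => //; exact: IH.
Qed.

(** At a point generic for the sets of [g z < q] with [q] rational, the value of [g] stays between
    two nearby rationals on a ball. So the points of continuity are dense, and being definable they
    fill a ball. *)
Lemma dfun_generic_continuous n (g : 'rV[R]_n -> R) x r : 0 < r -> dfun D g ->
  exists y s, [/\ 0 < s, ball y s `<=` ball x r &
    forall z, ball y s z -> forall e, 0 < e -> exists2 d, 0 < d &
      forall w, ball z d w -> `|g w - g z| < e].
Proof.
move=> r0 dg.
(* Continuity is spelled with coordinatewise inequalities, so that it is visibly a first-order
   formula. *)
pose C := [set z : 'rV[R]_n | forall e : R, 0 < e -> exists d : R, 0 < d /\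
  forall w : 'rV[R]_n, (forall i, - d < z 0 i - w 0 i /\ z 0 i - w 0 i < d) ->
  - e < g w - g z /\ g w - g z < e].
have CE z : C z <-> forall e, 0 < e -> exists2 d, 0 < d &
      forall w, ball z d w -> `|g w - g z| < e.
  split=> Cz e /Cz => -[d].
    move=> [d0 zw]; exists d => // w zw'; have [|] := zw w.
      move=> i; move/(rV_ballE _ _ d0)/(_ i): zw'; rewrite ltr_norml => /andP.
      by [].
    by rewrite ltr_norml => -> ->.
  move=> d0 zw; exists d; split=> // w zw'.
  apply/andP; rewrite -ltr_norml; apply: zw; apply/rV_ballE => // i.
  by rewrite ltr_norml; apply/andP.
have dC : dset D C by rewrite /C; dset_tac.
have [|y [s [s0 ys yC]]] := @dset_dense n C x r r0 dC.
  move=> y s s0.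
  have dA : forall q : rat, dset D [set z | g z < ratr q].
    by move=> q; dset_tac.
  have [z yz zA] := dset_generic y s0 dA; exists z => //; apply/CE => e e0.
  have [|p /andP[ep pg]] := @rat_in_itvoo R (g z - e) (g z); first by lra.
  have [|q /andP[gq qe]] := @rat_in_itvoo R (g z) (g z + e); first by lra.
  have [t t0 zt] := zA p; have [u u0 zu] := zA q.
  exists (Num.min t u) => [|w zw]; first by rewrite lt_min t0.
  have {}zu : g w < ratr q.
    case: zu => zu; last by have := zu _ (ballxx z u0).
    by apply: zu; apply: le_ball zw; rewrite ge_min lexx orbT.
  have {}zt : ratr p <= g w.
    rewrite leNgt; apply/negP => wp; case: zt => zt.
      by have /= := zt _ (ballxx z t0); rewrite ltNge (ltW pg).
    by apply: (zt w) => //; apply: le_ball zw; rewrite ge_min lexx.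
  rewrite ltr_norml; apply/andP; split.
    by rewrite ltrBrDl (lt_le_trans ep zt).
  by rewrite ltrBlDl (lt_trans zu qe).
by exists y, s; split=> // z zy; exact/CE/yC.
Qed.


(* Sum the increments of [g] along the path from [z] to [y] that changes one
   coordinate at a time and stays in the ball, a cube. *)
Lemma strict_grad_dir n (g : 'rV[R]_n -> R) x (L : 'rV[R]_n) :
  (forall i e, 0 < e -> exists2 d, 0 < d & forall p t, ball x d p ->
    ball x d (p + t *: delta_mx 0 i) ->
    `|g (p + t *: delta_mx 0 i) - g p - L 0 i * t| <= e * `|t|) ->
  strict_grad g x L.
Proof.
move=> gL e e0; pose e' := e / n.+1%:R.
have e'0 : 0 < e' by rewrite divr_gt0// ltr0n.
have [|i|d d0 gd] := @fin_min_pos R 'I_n (fun i d => forall p t, ball x d p ->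
    ball x d (p + t *: delta_mx 0 i) ->
    `|g (p + t *: delta_mx 0 i) - g p - L 0 i * t| <= e' * `|t|).
- move=> i d d' /andP[d'0 d'd] H p t xp xpt.
  by apply: H; [exact: le_ball xp|exact: le_ball xpt].
- exact: gL.
exists d => // y z xy xz.
pose w k : 'rV[R]_n := \row_i if (i < k)%N then y 0 i else z 0 i.
have xw k : ball x d (w k).
  apply/rV_ballE => // i; rewrite mxE; case: ifP => _.
    exact: (rV_ballE _ _ d0).1 xy i.
  exact: (rV_ballE _ _ d0).1 xz i.
have w0 : w 0%N = z by apply/rowP => i; rewrite mxE.
have wn : w n = y by apply/rowP => i; rewrite mxE ltn_ord.
have wS (k : 'I_n) : w k.+1 = w k + (y 0 k - z 0 k) *: delta_mx 0 k.
  apply/rowP => i; rewrite !mxE eqxx/= ltnS leq_eqVlt.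
  have [->|ik] := eqVneq i k; first by rewrite eqxx ltnn mulr1 subrKC.
  by rewrite -val_eqE in ik; rewrite (negbTE ik) mulr0 addr0.
rewrite -{1}w0 -{1}wn -(telescope_sumr (fun k => g (w k)) (leq0n n)) big_mkord -sumrB.
apply: (le_trans (ler_norm_sum _ _ _)).
apply: (@le_trans _ _ (\sum_(i < n) e' * `|y - z|)).
  apply: ler_sum => i _.
  have := gd i (w i) (y 0 i - z 0 i) (xw i); rewrite -wS => /(_ (xw _)) gi.
  apply: (le_trans gi).
  apply: ler_wpM2l; first exact: ltW.
  by have := rV_norm_coord (y - z) i; rewrite !mxE.
rewrite sumr_const card_ord -mulr_natl mulrA; apply: ler_wpM2r => //.
rewrite /e' mulrCA; apply: ler_piMr; first exact: ltW.
by rewrite ler_pdivrMr ?ltr0n// mul1r ler_nat.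
Qed.

(** For fixed [x], the slopes [c] form a lower cut whose supremum, when finite, is the right
    derivative of [g] at [x] in direction [i]. *)
Definition above n (g : 'rV[R]_n -> R) (i : 'I_n) (c : R) : set 'rV[R]_n :=
  [set x : 'rV[R]_n | exists d : R, 0 < d /\ forall t : R, (0 < t /\ t < d) ->
    c * t < g (\row_j (x 0 j + t * (j == i)%:R)) - g x].

Lemma dfun_shift n (T : Type) (cT : coordinatized R T) (h : T -> 'rV[R]_n)
    (t : T -> R) (i : 'I_n) : dfun D h -> dfun D t ->
  dfun D (fun x => \row_j (h x 0 j + t x * (j == i)%:R) : 'rV[R]_n).
Proof.
move=> dh dt; apply: (dfun_row D_ominimal) => j.
under [X in dfun D X]eq_fun do rewrite mxE.
by dset_tac.
Qed.

Lemma shiftE n (x : 'rV[R]_n) t i :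
  \row_j (x 0 j + t * (j == i)%:R) = x + t *: delta_mx 0 i.
Proof. by apply/rowP => j; rewrite !mxE eqxx. Qed.

Lemma dset_above_all n (g : 'rV[R]_n -> R) i : dfun D g ->
  dset D [set p : 'rV[R]_n * R | above g i p.2 p.1].
Proof.
move=> dg; rewrite /above.
have ds : dfun D (fun p : 'rV[R]_n * R * R * R =>
    \row_j (p.1.1.1 0 j + p.2 * (j == i)%:R) : 'rV[R]_n).
  by apply: dfun_shift; dset_tac.
have dgs := dfun_comp D_ominimal ds dg.
by dset_tac.
Qed.

Lemma dset_above n (g : 'rV[R]_n -> R) i c : dfun D g -> dset D (above g i c).
Proof.
move=> dg; apply: (@dset_comp _ _ D_ominimal _ _ _ _ (fun x => (x, c)) _ _ (dset_above_all i dg)).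
by dset_tac.
Qed.

(** By tameness the comparison of the increment with [c * t] has a constant outcome for all small t
    > 0, so its failure is the reverse inequality on an interval. *)
Lemma not_above n (g : 'rV[R]_n -> R) i c x : dfun D g -> ~ above g i c x ->
  exists2 d, 0 < d & forall t, 0 < t < d -> g (x + t *: delta_mx 0 i) - g x <= c * t.
Proof.
move=> dg nA.
have dX : dset D (fun t => c * t < g (\row_j (x 0 j + t * (j == i)%:R) : 'rV[R]_n) - g x).
  have ds : dfun D (fun t : R => \row_j (x 0 j + t * (j == i)%:R) : 'rV[R]_n).
    by apply: (dfun_shift (h := fun=> x)); dset_tac.
  have dgs := dfun_comp D_ominimal ds dg.
  by dset_tac.
have [d d0] := tame_right D_ominimal 0 dX; rewrite add0r => -[Xd|Xd].
  by exfalso; apply: nA; exists d; split=> // t [t0 td]; apply: Xd; rewrite t0.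
by exists d => // t /Xd /negP; rewrite shiftE -leNgt.
Qed.


End generic.

Section generic_strict.
Variables (R : realType) (D : forall n : nat, set (set 'rV[R]_n)).
Hypothesis D_ominimal : ominimal D.

(** A mean value inequality from one-sided slopes: [le_of_right_le] is applied to g(p + s e_i) - c s
    along the segment, which stays in the ball because a cube is convex. *)
Lemma le_dir n (g : 'rV[R]_n -> R) i c x r :
  (forall z, ball x r z -> forall e, 0 < e -> exists2 d, 0 < d &
      forall w, ball z d w -> `|g w - g z| < e) ->
  (forall z, ball x r z -> exists2 d, 0 < d & forall t, 0 < t < d ->
      c * t <= g (z + t *: delta_mx 0 i) - g z) ->
  forall p t, 0 <= t -> ball x r p -> ball x r (p + t *: delta_mx 0 i) ->
  c * t <= g (p + t *: delta_mx 0 i) - g p.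
Proof.
move=> gc gr p t t0 xp xpt; have r0 : 0 < r by case: xp.
pose q s := p + s *: delta_mx 0 i : 'rV[R]_n.
have xq s : 0 <= s <= t -> ball x r (q s).
  move=> /andP[s0 st]; apply/rV_ballE => // j.
  have := (rV_ballE _ _ r0).1 xpt j; have := (rV_ballE _ _ r0).1 xp j.
  rewrite !mxE eqxx/=; case: (j == i); rewrite ?mulr1 ?mulr0 ?addr0//.
  by rewrite !ltr_norml => /andP[? ?] /andP[? ?]; apply/andP; split; lra.
suff : g (q 0) - c * 0 <= g (q t) - c * t by rewrite /q scale0r addr0; lra.
apply: (@le_of_right_le R (fun s => g (q s) - c * s)) => //.
  move=> s st e e0; have e20 : 0 < e / 2 by rewrite divr_gt0.
  have [d d0 gd] := gc _ (xq _ st) _ e20.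
  (* Within distance [k] the linear term [c * s] varies by at most [e / 2], also when [c] is 0. *)
  pose k : R := (e / 2) / (`|c| + 1).
  have k0 : 0 < k by rewrite divr_gt0// ltr_wpDl.
  exists (Num.min d k) => [|u ut]; first by rewrite lt_min d0.
  rewrite lt_min => /andP[ud uk].
  have /gd H : ball (q s) d (q u).
    apply/rV_ballE => // j; rewrite !mxE eqxx/= opprD addrACA subrr add0r.
    case: (j == i); rewrite ?mulr1 ?mulr0; first by rewrite distrC.
    by rewrite subrr normr0.
  have : `|c * (u - s)| <= e / 2.
    rewrite normrM; apply: (@le_trans _ _ (`|c| * k)); first by apply: ler_wpM2l => //; exact: ltW.
    by rewrite /k mulrA ler_pdivrMr ?ltr_wpDl// mulrDr mulr1 mulrC lerDl ltW.
  move: H; rewrite !ltr_norml ler_norml => /andP[? ?] /andP[? ?].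
  by apply/andP; split; lra.
move=> s /andP[s0 st]; have [|d d0 gd] := gr (q s); first by apply: xq; rewrite s0 ltW.
exists d => // u /andP[su ud].
have := gd (u - s); rewrite -addrA -scalerDl subrKC => /(_ _).
have -> : 0 < u - s < d by rewrite subr_gt0 su/= ltrBlDl.
by rewrite -/(q u) => /(_ isT); lra.
Qed.

(** At a generic point [y] of a ball of continuity the right derivative in each direction is finite,
    and any rational slopes just below and above it remain bounds on a whole ball around [y]. By
    [le_dir] they then bound all increments in that ball, which is strictness. *)
Theorem dfun_generic_strict n (g : 'rV[R]_n -> R) x r : 0 < r -> dfun D g ->
  exists2 y, ball x r y & exists L, strict_grad g y L.
Proof.
move=> r0 dg; have [x1 [r1 [r10 x1r gc]]] := dfun_generic_continuous D_ominimal x r0 dg.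
have dgN : dfun D (fun x => - g x) by dset_tac.
(* The rational members bracket a finite slope; the two Boolean members are the loci where the slope
   is plus or minus infinity. *)
pose A (j : 'I_n * (rat + bool)) : set 'rV[R]_n := match j.2 with
  | inl q => above g j.1 (ratr q)
  | inr true => [set z : 'rV[R]_n | forall c : R, above g j.1 c z]
  | inr false => [set z : 'rV[R]_n | forall c : R, above (fun x => - g x) j.1 c z]
  end.
have dA j : dset D (A j).
  case: j => i [q|[]] /=; rewrite /A /=; first exact: (dset_above D_ominimal).
    by apply: dset_all => //; exact: (dset_above_all D_ominimal).
  by apply: dset_all => //; exact: (dset_above_all D_ominimal i dgN).
have [y xy yA] := dset_generic D_ominimal x1 r10 dA; exists y; first exact: x1r.
have [r2 r20 yr2] := sub_ball xy.
have gcN z : ball x1 r1 z -> forall e, 0 < e -> exists2 d, 0 < d &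
    forall w, ball z d w -> `|(- g w) - (- g z)| < e.
  move=> /gc H e /H[d d0 gd]; exists d => // w /gd.
  by rewrite -opprD normrN.
(* An infinite one-sided derivative on a whole ball contradicts [le_dir]. *)
have unbounded i (h : 'rV[R]_n -> R) s : 0 < s -> ball y s `<=` ball x1 r1 ->
    (forall z, ball x1 r1 z -> forall e, 0 < e -> exists2 d, 0 < d &
      forall w, ball z d w -> `|h w - h z| < e) ->
    ball y s `<=` [set z | forall c : R, above h i c z] -> False.
  move=> s0 ys hc hA; pose t := s / 2; have t0 : 0 < t by rewrite divr_gt0.
  pose q := y + t *: delta_mx 0 i : 'rV[R]_n.
  have yq : ball y s q.
    apply/rV_ballE => // j; rewrite !mxE eqxx/= opprD addrA subrr sub0r normrN.
    case: (j == i); rewrite ?mulr1 ?mulr0 ?normr0// gtr0_norm// /t; lra.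
  pose c := (h q - h y + 1) / t.
  have : c * t <= h q - h y.
    apply: (@le_dir n h i c y s _ _ y t (ltW t0) (ballxx _ s0) yq).
    - by move=> z /ys/hc.
    - move=> z /hA/(_ c)[d [d0 hd]]; exists d => // u /andP[u0 ud].
      by rewrite -shiftE ltW// hd.
  by rewrite /c divfK ?gt_eqF//; lra.
have /choice[L LP] : forall i : 'I_n, exists L : R, forall e, 0 < e ->
    exists2 d, 0 < d & forall p t, ball y d p -> ball y d (p + t *: delta_mx 0 i) ->
    `|g (p + t *: delta_mx 0 i) - g p - L * t| <= e * `|t|.
  move=> i.
  have [c1 nc1] : exists c, ~ above g i c y.
    apply/existsNP => yi; have [s s0] := yA (i, inr true).
    case=> ys; last exact: (ys y (ballxx _ s0)).
    pose s' := Num.min s r2; have s'0 : 0 < s' by rewrite lt_min s0.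
    apply: (unbounded i g s' s'0) => //.
      by move=> z zs; apply: yr2; apply: le_ball zs; rewrite ge_min lexx orbT.
    by move=> z zs; apply: ys; apply: le_ball zs; rewrite ge_min lexx.
  have [c2 nc2] : exists c, ~ above (fun x => - g x) i c y.
    apply/existsNP => yi; have [s s0] := yA (i, inr false).
    case=> ys; last exact: (ys y (ballxx _ s0)).
    pose s' := Num.min s r2; have s'0 : 0 < s' by rewrite lt_min s0.
    apply: (unbounded i (fun x => - g x) s' s'0) => //.
      by move=> z zs; apply: yr2; apply: le_ball zs; rewrite ge_min lexx orbT.
    by move=> z zs; apply: ys; apply: le_ball zs; rewrite ge_min lexx.
  pose S := [set c | above g i c y].
  have Sdown c c' : c' <= c -> S c -> S c'.
    move=> c'c [d [d0 cd]]; exists d; split=> // t /[dup] td /cd.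
    by apply: le_lt_trans; apply: ler_wpM2r => //; apply: ltW; case: td.
  have Sub c : S c -> c <= c1.
    by move=> Sc; rewrite leNgt; apply/negP => /ltW /Sdown /(_ Sc).
  (* The 1 that is given away makes the inequality strict, as [above] demands. *)
  have S0 : S (- c2 - 1).
    have [d d0 cd] := not_above D_ominimal dgN nc2; exists d; split=> // t [t0 td].
    have := cd t; rewrite t0 td => /(_ isT); rewrite shiftE mulrBl mul1r; lra.
  have Ssup : has_sup S by split; [exists (- c2 - 1)|exists c1].
  exists (sup S) => e e0.
  have [c Sc ec] := sup_adherent e0 Ssup.
  have [q /andP[Lq qc]] := rat_in_itvoo ec.
  have [|q' /andP[Lq' qe]] := @rat_in_itvoo R (sup S) (sup S + e); first by lra.
  have Sq : S (ratr q) by apply: Sdown Sc; exact: ltW.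
  have Sq' : ~ S (ratr q') by move=> /(ub_le_sup Ssup.2) /(lt_le_trans Lq'); rewrite ltxx.
  have [s s0 ys] : exists2 s, 0 < s & ball y s `<=` above g i (ratr q).
    have [s s0 ys] := yA (i, inl q); exists s => //.
    by case: ys => // /(_ y (ballxx _ s0)).
  have [s' s'0 ys'] : exists2 s, 0 < s & ball y s `<=` ~` above g i (ratr q').
    have [s' s'0 ys'] := yA (i, inl q'); exists s' => //.
    by case: ys' => // /(_ y (ballxx _ s'0)).
  pose d := Num.min r2 (Num.min s s').
  have d0 : 0 < d by rewrite !lt_min r20 s0.
  have dr2 : d <= r2 by rewrite ge_min lexx.
  have ds : d <= s by rewrite !ge_min lexx orbT.
  have ds' : d <= s' by rewrite !ge_min lexx !orbT.
  exists d => //.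
  have pos p t : 0 <= t -> ball y d p -> ball y d (p + t *: delta_mx 0 i) ->
      `|g (p + t *: delta_mx 0 i) - g p - sup S * t| <= e * t.
    move=> t0 yp ypt.
    have H1 : ratr q * t <= g (p + t *: delta_mx 0 i) - g p.
      apply: (le_dir (x := y) (r := d)) => // z /(le_ball _) yz.
        by apply: gc; apply: yr2; exact: yz.
      have [k [k0 gk]] := ys _ (yz _ ds); exists k => // u /andP[u0 uk].
      by rewrite -shiftE ltW// gk.
    have H2 : - ratr q' * t <= - g (p + t *: delta_mx 0 i) - - g p.
      apply: (le_dir (g := fun x => - g x) (x := y) (r := d)) => // z /(le_ball _) yz.
        by apply: gcN; apply: yr2; exact: yz.
      have [k k0 gk] := not_above D_ominimal dg (ys' _ (yz _ ds')); exists k => // u /gk.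
      by rewrite mulNr; lra.
    have H3 : (sup S - e) * t <= ratr q * t by apply: ler_wpM2r => //; exact: ltW.
    have H4 : ratr q' * t <= (sup S + e) * t by apply: ler_wpM2r => //; exact: ltW.
    move: H1 H2 H3 H4; rewrite mulNr mulrBl mulrDl => H1 H2 H3 H4.
    by rewrite ler_norml; apply/andP; split; lra.
  move=> p t yp ypt; have [t0|t0] := leP 0 t.
    by rewrite (ger0_norm t0); exact: pos.
  (* A negative increment is the positive one read from its other endpoint. *)
  have pE : p = p + t *: delta_mx 0 i + (- t) *: delta_mx 0 i.
    by rewrite scaleNr addrK.
  have := pos (p + t *: delta_mx 0 i) (- t); rewrite -pE oppr_ge0 (ltW t0).
  move=> /(_ isT ypt yp); rewrite (ltr0_norm t0) -normrN; congr (_ <= _).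
  by congr `| _ |; ring.
exists (\row_i L i); apply: strict_grad_dir => i e e0.
by rewrite mxE; exact: LP.
Qed.

End generic_strict.

(** * Strictly differentiable maps and the definability of their locus *)

Section strict_diff.
Variable R : realType.

Definition strict_diff m n (f : 'rV[R]_m -> 'rV[R]_n) x (A : 'M[R]_(m, n)) :=
  forall e, 0 < e -> exists2 d, 0 < d & forall y z, ball x d y -> ball x d z ->
    `|f y - f z - (y - z) *m A| <= e * `|y - z|.

Lemma rV_mulmx_bound m n (A : 'M[R]_(m, n)) :
  exists2 C, 0 < C & forall v : 'rV[R]_m, `|v *m A| <= C * `|v|.
Proof.
exists (1 + \sum_i \sum_j `|A i j|) => [|v].
  by rewrite ltr_pwDl// sumr_ge0// => i _; rewrite sumr_ge0.
apply: rV_norm_le => [|j].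
  rewrite mulr_ge0// addr_ge0// sumr_ge0// => i _.
  by rewrite sumr_ge0.
rewrite mxE (le_trans (ler_norm_sum _ _ _))// mulrDl mul1r ler_wpDl//.
rewrite mulr_suml; apply: ler_sum => i _; rewrite normrM mulrC.
apply: ler_pM => //; last exact: rV_norm_coord.
by rewrite (bigD1 j)//= lerDl sumr_ge0.
Qed.

Lemma strict_diff_grad m n (f : 'rV[R]_m -> 'rV[R]_n) x :
  (forall j, exists L, strict_grad (fun y => f y 0 j) x L) ->
  exists A, strict_diff f x A.
Proof.
move=> /choice[L fL]; exists (\matrix_(i, j) L j 0 i) => e e0.
have [|j|d d0 fd] := @fin_min_pos R 'I_n (fun j d => forall y z, ball x d y -> ball x d z ->
    `|f y 0 j - f z 0 j - \sum_i L j 0 i * (y 0 i - z 0 i)| <= e * `|y - z|).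
- move=> j d d' /andP[d'0 d'd] H y z xy xz.
  by apply: H; [exact: le_ball xy|exact: le_ball xz].
- exact: fL.
exists d => // y z xy xz; apply: rV_norm_le => [|j].
  by rewrite mulr_ge0// ltW.
have := fd j y z xy xz; rewrite !mxE; congr (`| _ - _ | <= _).
by apply: eq_bigr => i _; rewrite !mxE mulrC.
Qed.

Lemma strict_diff_lipschitz m n (f : 'rV[R]_m -> 'rV[R]_n) x A :
  strict_diff f x A -> exists d C, [/\ 0 < d, 0 < C & forall y z,
    ball x d y -> ball x d z -> `|f y - f z| <= C * `|y - z|].
Proof.
move=> /(_ _ ltr01)[d d0 fd]; have [C C0 AC] := rV_mulmx_bound A.
exists d, (1 + C); split=> // [|y z xy xz]; first by rewrite addr_gt0.
rewrite -[f y - f z](subrK ((y - z) *m A)) (le_trans (ler_normD _ _))// mulrDl.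
by rewrite lerD// fd.
Qed.

End strict_diff.

Section strict_definable.
Variables (R : realType) (D : forall n : nat, set (set 'rV[R]_n)).
Hypothesis D_ominimal : ominimal D.

(** The sup norm is eliminated from the formula by a variable [h] that ranges over its upper bounds,
    compared with each coordinate of y - z. *)
Lemma dset_strict_grad n (g : 'rV[R]_n -> R) : dfun D g ->
  dset D [set x | exists L, strict_grad g x L].
Proof.
move=> dg; pose near (d : R) (x y : 'rV[R]_n) :=
  forall i, - d < x 0 i - y 0 i /\ x 0 i - y 0 i < d.
have nearE d x y : 0 < d -> near d x y <-> ball x d y.
  move=> d0; rewrite rV_ballE//; split=> xy i; last by apply/andP; rewrite -ltr_norml.
  by rewrite ltr_norml; apply/andP.
have dS : dfun D (fun p : 'rV[R]_n * 'rV[R]_n * 'rV[R]_n =>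
    \sum_i p.1.1 0 i * (p.1.2 0 i - p.2 0 i)).
  by apply: dfun_sum => // i; dset_tac.
pose S (L y z : 'rV[R]_n) := \sum_i L 0 i * (y 0 i - z 0 i).
have dS' : dfun D (fun p => S p.1.1 p.1.2 p.2) by exact: dS.
apply: (@dset_ext _ _ _ _ (fun x : 'rV[R]_n => exists L, forall e : R, 0 < e -> exists d : R,
  0 < d /\ forall y z h, near d x y -> near d x z -> (0 <= h /\ forall i,
    - h <= y 0 i - z 0 i /\ y 0 i - z 0 i <= h) ->
    - (e * h) <= g y - g z - S L y z /\ g y - g z - S L y z <= e * h)).
  move=> x; split=> -[L Lx]; exists L => e /[dup] e0 /Lx.
    move=> [d [d0 gd]]; exists d => // y z /nearE xy /nearE xz.
    rewrite ler_norml; apply/andP; apply: gd; [exact: xy|exact: xz|split=> // i].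
    by apply/andP; rewrite -ler_norml; have := rV_norm_coord (y - z) i; rewrite !mxE.
  move=> [d d0 gd]; exists d; split=> // y z h /(nearE _ _ _ d0) xy /(nearE _ _ _ d0) xz [h0 yz].
  apply/andP; rewrite -ler_norml (le_trans (gd _ _ xy xz))//.
  apply: ler_wpM2l; first exact: ltW.
  by apply: rV_norm_le => // i; rewrite !mxE ler_norml; exact/andP.
have dS2 : dfun D (fun p : 'rV[R]_n * 'rV[R]_n * 'rV[R]_n => g p.1.2 - g p.2 - S p.1.1 p.1.2 p.2).
  by apply: dfunB => //; dset_tac.
have dS3 : dfun D (fun p : 'rV[R]_n * 'rV[R]_n * R * R * 'rV[R]_n * 'rV[R]_n * R =>
    (p.1.1.1.1.1.2, p.1.1.2, p.1.2)) by dset_tac.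
have dS4 := dfun_comp D_ominimal dS3 dS2.
rewrite /near; dset_tac.
Qed.

Lemma dset_strict_grad_near n N (f : 'rV[R]_n -> 'rV[R]_N) : dfun D f ->
  dset D [set x | exists2 s, 0 < s & forall y, ball x s y ->
    forall j, exists L, strict_grad (fun z => f z 0 j) y L].
Proof.
move=> df.
have dA (j : 'I_N) : dset D [set x | exists L, strict_grad (fun z => f z 0 j) x L].
  by apply: dset_strict_grad; dset_tac.
pose A j : set 'rV[R]_n := [set x | exists L, strict_grad (fun z => f z 0 j) x L].
apply: (@dset_ext _ _ _ _ (fun x : 'rV[R]_n => exists s : R, 0 < s /\ forall y : 'rV[R]_n,
  (forall i, - s < x 0 i - y 0 i /\ x 0 i - y 0 i < s) -> forall j, A j y)).
  move=> x; split=> [[s [s0 xs]]|[s s0 xs]]; exists s => //.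
    move=> y /(rV_ballE _ _ s0) xy; apply: xs => i.
    by apply/andP; rewrite -ltr_norml; exact: xy.
  split=> // y xy; apply: xs; apply/rV_ballE => // i.
  by rewrite ltr_norml; apply/andP; exact: xy.
have dA' j : dset D (A j) by exact: dA.
clearbody A.
apply: dset_ex => //; apply: dset_and => //; first by dset_tac.
apply: dset_all => //; apply: dset_imp => //; first by dset_tac.
apply: dset_all_fin => // j; apply: (@dset_comp _ _ D_ominimal _ _ _ _ snd) => //.
dset_tac.
Qed.

(** Near a generic point strict differentiability of a coordinate holds everywhere or nowhere, and
    [dfun_generic_strict] excludes the latter. *)
Lemma dfun_generic_strict_near n N (f : 'rV[R]_n -> 'rV[R]_N) x r : 0 < r -> dfun D f ->
  exists2 y, ball x r y & exists2 s, 0 < s & forall z, ball y s z ->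
    forall j, exists L, strict_grad (fun z => f z 0 j) z L.
Proof.
move=> r0 df.
have dfj (j : 'I_N) : dfun D (fun z => f z 0 j) by dset_tac.
have [y xy yA] := dset_generic D_ominimal x r0 (fun j => dset_strict_grad (dfj j)).
exists y => //.
have [|j|s s0 ys] := @fin_min_pos R 'I_N (fun j s => forall z, ball y s z ->
    exists L, strict_grad (fun z => f z 0 j) z L).
- by move=> j d e /andP[e0 ed] yd z /(le_ball ed) /yd.
- have [s s0 ys] := yA j; exists s => //; case: ys => // ys.
  have [z /ys nz [L zL]] := dfun_generic_strict D_ominimal y s0 (dfj j).
  by exfalso; apply: nz; exists L.
by exists s => // z yz j; exact: ys.
Qed.

End strict_definable.

(** * Sets of small dimension *)

Section thin.
Variable R : realType.
Implicit Types n N d : nat.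

(** A bound on covering numbers with one constant for all scales 1/(K+1), hence a uniform form of
    upper box dimension at most [d]. *)
Definition box_dim_le N d (Z : set 'rV[R]_N) := exists C : nat, forall K : nat,
  exists2 s : seq 'rV[R]_N, (size s <= C * K.+1 ^ d)%N &
    forall z, Z z -> exists2 c, c \in s & `|z - c| <= K.+1%:R^-1.

(** Countable unions are allowed because images of definable maps may be unbounded and are
    controlled only on countably many Lipschitz pieces. *)
Definition thin N d (Z : set 'rV[R]_N) := exists2 W : nat -> set 'rV[R]_N,
  forall k, box_dim_le d (W k) & Z `<=` \bigcup_k W k.

Lemma box_dim_leW N d e (Z : set 'rV[R]_N) :
  (d <= e)%N -> box_dim_le d Z -> box_dim_le e Z.
Proof.
move=> de [C ZC]; exists C => K; have [s sC Zs] := ZC K; exists s => //.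
by rewrite (leq_trans sC)// leq_mul2l leq_pexp2l ?orbT.
Qed.

Lemma box_dim_le0 N d : box_dim_le d (set0 : set 'rV[R]_N).
Proof. by exists 0%N => K; exists [::]. Qed.

Lemma box_dim_le_set1 N d (z : 'rV[R]_N) : box_dim_le d [set z].
Proof.
exists 1%N => K; exists [:: z]; first by rewrite mul1n expn_gt0.
by move=> _ ->; exists z; rewrite ?mem_head// subrr normr0 invr_ge0.
Qed.

Lemma thinW N d e (Z : set 'rV[R]_N) : (d <= e)%N -> thin d Z -> thin e Z.
Proof. by move=> de [W Wd ZW]; exists W => // k; exact: box_dim_leW (Wd k). Qed.

Lemma sub_thin N d (Y Z : set 'rV[R]_N) : Y `<=` Z -> thin d Z -> thin d Y.
Proof. by move=> YZ [W Wd ZW]; exists W => //; exact: subset_trans YZ ZW. Qed.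

Lemma thin_bigcup N d (J : countType) (Z : J -> set 'rV[R]_N) :
  (forall j, thin d (Z j)) -> thin d (\bigcup_j Z j).
Proof.
move=> /(_ _)/cid2-/all_sig2[W Wd ZW].
exists (fun k => if unpickle k is Some (j, i) then W j i else set0) => [k|z [j _ /ZW[i _ Wz]]].
  by case: unpickle => [[j i]|]; [exact: Wd|exact: box_dim_le0].
by exists (pickle (j, i)) => //; rewrite pickleK.
Qed.

Lemma thin_box_dim N d (Z : set 'rV[R]_N) : box_dim_le d Z -> thin d Z.
Proof. by move=> Zd; exists (fun=> Z) => // z Zz; exists 0%N. Qed.

Lemma thinU N d (Y Z : set 'rV[R]_N) : thin d Y -> thin d Z -> thin d (Y `|` Z).
Proof.
move=> Yd Zd; rewrite (_ : Y `|` Z = \bigcup_(b : bool) if b then Y else Z).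
  by apply: thin_bigcup => -[].
apply/seteqP; split=> z; first by case=> ?; [exists true|exists false].
by case=> -[] _ ?; [left|right].
Qed.

Lemma box_dim_lipschitz m N (F : 'rV[R]_m -> 'rV[R]_N) x r C : 0 < r -> 0 < C ->
  (forall y z, ball x r y -> ball x r z -> `|F y - F z| <= C * `|y - z|) ->
  box_dim_le m (F @` ball x r).
Proof.
move=> r0 C0 FC; pose Q := (Num.truncn (C * r)).+1.
have QC : C * r < Q%:R by exact: truncnS_gt.
exists (Q ^ m)%N => K; pose M := (Q * K.+1)%N; have M0 : (0 < M)%N by rewrite muln_gt0.
have MR0 : 0 < M%:R :> R by rewrite ltr0n.
(* The centres of the M^m equal cells of the cube; every point is within r/M of one of them, and C r
   / M < 1/(K+1) by the choice of [Q]. *)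
pose c (a : {ffun 'I_m -> 'I_M}) : 'rV[R]_m :=
  \row_i (x 0 i - r + (2 * (a i)%:R + 1) * (r / M%:R)).
have xc a : ball x r (c a).
  apply/rV_ballE => // i; rewrite mxE.
  have aM : (a i)%:R + 1 <= M%:R :> R by rewrite natr1 ler_nat.
  have a0 : 0 <= (a i)%:R :> R by [].
  have rM0 : 0 < r / M%:R by rewrite divr_gt0.
  have rM : M%:R * (r / M%:R) = r by rewrite mulrC divfK ?gt_eqF.
  rewrite ltr_norml; apply/andP; split; nra.
exists [seq F (c a) | a <- enum {ffun 'I_m -> 'I_M}].
  by rewrite size_map -cardE card_ffun !card_ord /M expnMn.
move=> _ [z xz <-].
pose u i := (z 0 i - x 0 i + r) / (2 * r) * M%:R.
have u0 i : 0 <= u i.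
  have /(_ i) := (rV_ballE _ _ r0).1 xz; rewrite ltr_norml => /andP[H1 H2].
  by rewrite mulr_ge0// divr_ge0//; lra.
have uM i : (Num.truncn (u i) < M)%N.
  rewrite truncn_lt_nat// /u gtr_pMl// ltr_pdivrMr ?mulr_gt0// mul1r.
  have /(_ i) := (rV_ballE _ _ r0).1 xz; rewrite ltr_norml => /andP[H1 H2]; lra.
pose a := [ffun i => Ordinal (uM i)] : {ffun 'I_m -> 'I_M}.
exists (F (c a)); first by apply: map_f; rewrite mem_enum.
apply: (le_trans (FC _ _ xz (xc a))).
have zca : `|z - c a| <= r / M%:R.
  apply: rV_norm_le => [|i]; first by rewrite divr_ge0// ltW.
  rewrite !mxE ffunE /=; have /andP[] := truncn_itv (u0 i).
  have rM0 : 0 < r / M%:R by rewrite divr_gt0.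
  have -> : z 0 i = x 0 i - r + 2 * u i * (r / M%:R).
    by rewrite /u; field; rewrite !gt_eqF.
  rewrite -natr1 => H1 H2; rewrite ler_norml; apply/andP; split; nra.
apply: (@le_trans _ _ (C * (r / M%:R))); first by apply: ler_wpM2l => //; exact: ltW.
rewrite mulrA ler_pdivrMr// [leRHS]mulrC /M natrM -mulrA divff ?pnatr_eq0// mulr1.
exact: ltW.
Qed.

(* A grid of M^n points of the ball has images at mutual distance of order
   1/M, which a set of dimension d < n cannot separate for large M. *)
Lemma expanding_not_thin n N d (f : 'rV[R]_n -> 'rV[R]_N) x r c (Z : set 'rV[R]_N) :
  (d < n)%N -> 0 < r -> 0 < c -> continuous f ->
  (forall y z, ball x r y -> ball x r z -> c * `|y - z| <= `|f y - f z|) ->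
  thin d Z -> exists2 y, ball x r y & ~ Z (f y).
Proof.
move=> dn r0 c0 fc fexp [W Wd ZW]; apply: contrapT => nZ.
have [y xy|k [y [s [s0 ys yW]]]] := @Baire_cover R n nat (fun k => f @^-1` W k) x r r0.
  have [|k _ Wk] := ZW (f y); last by exists k.
  by apply: contrapT => nZf; apply: nZ; exists y.
have [C WC] := Wd k.
(* Images of distinct grid points are at least c s / M apart; [Q] makes this exceed 4/(M Q), the
   bound for two images that share a covering point. *)
pose Q := (Num.truncn (4 / (c * s))).+1.
have QC : 4 / (c * s) < Q%:R by exact: truncnS_gt.
(* Gives M^n > C (M Q)^d for every n > d, so there are more grid points than covering points. *)
pose M := (C * Q ^ d).+1.
have MR0 : 0 < M%:R :> R by rewrite ltr0n.
have [sK sKC WsK] := WC (M * Q).-1.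
have MQ : (M * Q).-1.+1 = (M * Q)%N by rewrite prednK// muln_gt0.
rewrite MQ in sKC WsK.
pose p (a : {ffun 'I_n -> 'I_M}) : 'rV[R]_n := \row_i (y 0 i + (a i)%:R * (s / M%:R)).
have sM0 : 0 < s / M%:R by rewrite divr_gt0.
have yp a : ball y s (p a).
  apply/rV_ballE => // i; rewrite mxE opprD addrA subrr sub0r normrN.
  rewrite ger0_norm ?mulr_ge0// ?ltW// mulrCA gtr_pMr// ltr_pdivrMr// mul1r.
  by rewrite ltr_nat.
(* Half of the bound pays for the covering, the other half for approximating [p a], which lies only
   in the closure of the preimage of [W k]. *)
have /choice[g gP] : forall a, exists i : 'I_(size sK), `|f (p a) - nth 0 sK i| <= 2 * (M * Q)%:R^-1.
  move=> a; have e0 : 0 < (M * Q)%:R^-1 :> R by rewrite invr_gt0 ltr0n muln_gt0.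
  have /cvgrPdist_lt/(_ _ e0) fpa := fc (p a).
  have [w [Ww wp]] := yW _ (yp a) _ fpa.
  have [z zs wz] := WsK _ Ww.
  rewrite -index_mem in zs; exists (Ordinal zs); rewrite /= nth_index -?index_mem//.
  rewrite -(subrKA (f w)) (le_trans (ler_normD _ _))//; move: wp wz => /=; lra.
have gI : injective g.
  move=> a b gab; apply/ffunP => i; apply/eqP; apply: contrapT => /negP ab.
  have H1 := gP a; have H2 := gP b; rewrite -gab in H2.
  have H3 : `|f (p a) - f (p b)| <= 4 * (M * Q)%:R^-1.
    rewrite -(subrKA (nth 0 sK (g a))) (le_trans (ler_normD _ _))//.
    by rewrite [X in _ + X]distrC; lra.
  have H4 : s / M%:R <= `|p a - p b|.
    apply: le_trans (rV_norm_coord _ i); rewrite !mxE opprD addrACA subrr add0r.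
    rewrite -mulrBl normrM (gtr0_norm sM0); apply: ler_peMl; first exact: ltW.
    rewrite ler_normr opprB; have [lt_ab|lt_ba|/val_inj abi] := ltngtP (a i) (b i); last by rewrite abi eqxx in ab.
      by rewrite orbC lerBrDl natr1 ler_nat lt_ab.
    by rewrite lerBrDl natr1 ler_nat lt_ba.
  have := fexp _ _ (ys _ (yp a)) (ys _ (yp b)).
  have H5 : c * (s / M%:R) <= c * `|p a - p b| by exact: (ler_wpM2l (ltW c0) H4).
  have : 4 * (M * Q)%:R^-1 < c * (s / M%:R).
    have Q0 : 0 < Q%:R :> R by rewrite ltr0n.
    have H6 : 4 / Q%:R < c * s by rewrite ltr_pdivrMr// mulrC -ltr_pdivrMr ?mulr_gt0.
    rewrite natrM invfM [M%:R^-1 * _]mulrC !mulrA.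
    by rewrite ltr_pM2r ?invr_gt0.
  lra.
have := leq_card g gI; rewrite card_ffun !card_ord => /leq_trans/(_ sKC).
move=> /(leq_trans (leq_pexp2l (ltn0Sn _ : (0 < M)%N) dn)).
rewrite expnS expnMn [(M ^ d * _)%N]mulnC mulnA leq_pmul2r ?expn_gt0//.
by rewrite /M ltnn.
Qed.

End thin.

(** * Definable sets without interior and their images *)

Section dimension.
Variables (R : realType) (D : forall n : nat, set (set 'rV[R]_n)).
Hypothesis D_ominimal : ominimal D.

Definition no_ball n (S : set 'rV[R]_n) := forall x r, 0 < r -> ~ ball x r `<=` S.

Definition parametrized m n (S : set 'rV[R]_n) :=
  exists2 F : nat -> 'rV[R]_m -> 'rV[R]_n, forall k, dfun D (F k) &
    S `<=` \bigcup_k range (F k).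

Lemma parametrized_count m n (J : countType) (F : J -> 'rV[R]_m -> 'rV[R]_n)
    (S : set 'rV[R]_n) : (forall j, dfun D (F j)) -> S `<=` \bigcup_j range (F j) ->
  parametrized m S.
Proof.
move=> dF SF; exists (fun k => if unpickle k is Some j then F j else fun=> 0) => [k|x Sx].
  by case: unpickle => [j|] //; exact: dfun_cst.
by have [j _ Fjx] := SF x Sx; exists (pickle j) => //; rewrite pickleK.
Qed.

Definition fat_fiber m (S : set 'rV[R]_(m + 1)) : set 'rV[R]_m :=
  [set v : 'rV[R]_m | exists a b : R, a < b /\
    forall t : R, (a < t /\ t < b) -> S (row_mx v (const_mx t))].

Local Ltac row_tac := dset_tac;
  (apply: (dfun_row_mx D_ominimal); [|apply: (dfun_const_mx D_ominimal)]); dset_tac.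

Lemma dset_fat_fiber m (S : set 'rV[R]_(m + 1)) : dset D S -> dset D (fat_fiber S).
Proof.
move=> dS; by rewrite /fat_fiber; row_tac.
Qed.

(** If all fibres over a ball contained intervals, Baire would give one rational interval common to
    the fibres over a smaller ball, hence a box inside [S]. *)
Lemma no_ball_fat_fiber m (S : set 'rV[R]_(m + 1)) :
  dset D S -> no_ball S -> no_ball (fat_fiber S).
Proof.
move=> dS nS x r r0 xE.
pose A (q : rat * rat) : set 'rV[R]_m := [set v : 'rV[R]_m | (ratr q.1 : R) < ratr q.2 /\
  forall t : R, (ratr q.1 < t /\ t < ratr q.2) -> S (row_mx v (const_mx t))].
have dA q : dset D (A q).
  by rewrite /A; row_tac.
have [v /xE [a [b [ab vab]]]|[c d] [y [s [s0 ys yA]]]] :=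
    @dset_Baire R D D_ominimal m _ A x r r0 dA.
  have [c /andP[ac cb]] := rat_in_itvoo ab.
  have [d /andP[cd db]] := rat_in_itvoo cb.
  exists (c, d) => //; split=> // t [/= ct td]; apply: vab.
  by split; [exact: lt_trans ct|exact: lt_trans td _].
have [/= cd _] := yA _ (ballxx _ s0).
pose u : R := (ratr c + ratr d) / 2; pose e := Num.min s ((ratr d - ratr c) / 2).
have e0 : 0 < e by rewrite lt_min s0/=; lra.
have es : e <= s by rewrite ge_min lexx.
have ecd : e <= (ratr d - ratr c) / 2 by rewrite ge_min lexx orbT.
apply: (nS (row_mx y (const_mx u)) e e0) => w.
rewrite (rV_split w) ball_row_mx// => -[yw uw].
have [_] := yA _ (le_ball es yw); apply; rewrite /=.
by move: uw; rewrite /u ltr_norml => /andP[? ?]; split; lra.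
Qed.

(** By tameness on both sides, a point of a fibre that contains no interval is isolated in it. It is
    thus the only point of its fibre in some rational interval, and for each such interval this
    point is a definable function of the base. *)
Lemma parametrized_thin_fiber m (S : set 'rV[R]_(m + 1)) : dset D S ->
  parametrized m (S `&` [set z | ~ fat_fiber S (lsubmx z)]).
Proof.
move=> dS.
pose U (q : rat * rat) (v : 'rV[R]_m) (t : R) :=
  (((ratr q.1 < t /\ t < ratr q.2) /\ S (row_mx v (const_mx t))) /\
  forall u : R, ((ratr q.1 < u /\ u < ratr q.2) /\ S (row_mx v (const_mx u))) -> u = t).
have dU q : dset D (fun p : 'rV[R]_m * R => U q p.1 p.2).
  by rewrite /U; row_tac.
(* Where the interval does not isolate a point the value is 0, which the definition of the graph has
   to treat as a second case. *)
pose s q v : R := xget 0 [set t | U q v t].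
have ds q : dfun D (s q).
  apply: (@dset_ext _ _ _ _ (fun p : 'rV[R]_m * R =>
    U q p.1 p.2 \/ (~ (exists t, U q p.1 t) /\ p.2 = 0))).
    move=> [v t] /=; split.
      case=> [Uvt|[nU ->]]; last by rewrite /s xgetPN// => u Uu; apply: nU; exists u.
      by rewrite /s; case: xgetP => [u -> [_ uU]|/(_ t)//]; apply: uU; case: Uvt.
    move=> ->; rewrite /s; case: xgetP => [u ->|nU]; first by left.
    by right; split=> // -[u /nU].
  apply: dset_or => //; apply: dset_and => //; last by dset_tac.
  apply: dset_not => //; apply: dset_ex => //.
  exact: (@dset_comp _ _ D_ominimal _ _ _ _ (fun p : 'rV[R]_m * R * R => (p.1.1, p.2))
    _ ltac:(dset_tac) (dU q)).
apply: (@parametrized_count _ _ _ (fun q v => row_mx v (const_mx (s q v)))).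
  move=> q; apply: (dfun_row_mx D_ominimal); first by dset_tac.
  exact: (dfun_const_mx D_ominimal).
move=> z [Sz nE]; pose v := lsubmx z; pose t := rsubmx z 0 0.
rewrite (rV_split z) in Sz *; rewrite -/v -/t in Sz nE *.
have dX : dset D (fun u : R => S (row_mx v (const_mx u))).
  by row_tac.
(* Reflection turns the statement about right neighbourhoods into one about left neighbourhoods. *)
have dXN : dset D (fun u : R => S (row_mx v (const_mx (- u)))).
  by row_tac.
have [d d0 Xd] : exists2 d, 0 < d & forall u, t < u < t + d -> ~ S (row_mx v (const_mx u)).
  have [d d0 [Xd|Xd]] := tame_right D_ominimal t dX; last by exists d.
  exfalso; apply: nE; exists t, (t + d); rewrite ltrDl; split=> // u [tu ud].
  by apply: Xd; rewrite tu.
have [e e0 Xe] : exists2 e, 0 < e & forall u, t - e < u < t -> ~ S (row_mx v (const_mx u)).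
  have [e e0 Xe] := tame_right D_ominimal (- t) dXN; exists e => //.
  case: Xe => Xe.
    exfalso; apply: nE; exists (t - e), t; split; first by lra.
    by move=> u [eu ut]; rewrite -[u]opprK; apply: Xe; apply/andP; split; lra.
  by move=> u /andP[eu ut]; rewrite -[u]opprK; apply: Xe; apply/andP; split; lra.
have [|a /andP[ea at_]] := @rat_in_itvoo R (t - e) t; first by lra.
have [|b /andP[tb bd]] := @rat_in_itvoo R t (t + d); first by lra.
exists (a, b) => //; exists v => //; congr row_mx; congr const_mx.
have uniq u : (ratr a < u /\ u < ratr b) /\ S (row_mx v (const_mx u)) -> u = t.
  case=> -[au ub] Su; have [ut|tu|//] := ltgtP u t.
    by exfalso; apply: (Xe u) => //; rewrite (lt_trans ea au).
  by exfalso; apply: (Xd u) => //; rewrite tu (lt_trans ub bd).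
rewrite /s; case: xgetP => [u _ [/uniq]//|/(_ t)nU].
by exfalso; apply: nU; split=> // u /uniq.
Qed.

(** Over bases with thin fibres the functions above suffice. The remaining bases form a set without
    interior, which by induction needs one parameter less, and the coordinate along the fibre
    supplies the missing one. *)
Lemma no_ball_parametrized m (S : set 'rV[R]_(m + 1)) : dset D S -> no_ball S ->
  parametrized m S.
Proof.
elim: m S => [|m IH] S dS nS.
  have [F dF SF] := parametrized_thin_fiber dS; exists F => // z Sz.
  (* In R^0 a set that contains no ball is empty, so no fibre is fat. *)
  apply: SF; split=> // Ez; apply: (no_ball_fat_fiber dS nS ltr01 (x := lsubmx z)).
  by move=> w _; rewrite (_ : w = lsubmx z)//; apply/rowP => -[].
move: S dS nS; rewrite -[m.+1]addn1 => S dS nS.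
have [F dF EF] := IH _ (dset_fat_fiber dS) (no_ball_fat_fiber dS nS).
have [G dG SG] := parametrized_thin_fiber dS.
pose H (j : nat + nat) : 'rV[R]_(m + 1) -> 'rV[R]_(m + 1 + 1) :=
  match j with
  | inl k => fun w => row_mx (F k (lsubmx w)) (const_mx (w 0 (rshift m 0)))
  | inr k => G k
  end.
apply: (@parametrized_count _ _ _ H) => [[k|k]|z Sz]; rewrite ?/H//=.
  apply: (dfun_row_mx D_ominimal); last by apply: (dfun_const_mx D_ominimal); dset_tac.
  apply: (dfun_comp D_ominimal _ (dF k)); apply: (dfun_row D_ominimal) => j.
  under [X in dfun D X]eq_fun do rewrite mxE; dset_tac.
have [Ez|nEz] := pselect (fat_fiber S (lsubmx z)); last first.
  by have [|k _ Gz] := SG z; [split|exists (inr k)].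
have [k _ [v _ Fv]] := EF _ Ez; exists (inl k) => //.
exists (row_mx v (const_mx (rsubmx z 0 0))) => //=.
by rewrite row_mxKl row_mxEr mxE Fv -rV_split.
Qed.

(** Countably many balls with rational centre and radius on which [F] is Lipschitz cover [G]. *)
Lemma thin_lipschitz_locus m N (F : 'rV[R]_m -> 'rV[R]_N) (G : set 'rV[R]_m) :
  (forall x, G x -> exists d C, [/\ 0 < d, 0 < C & forall y z,
    ball x d y -> ball x d z -> `|F y - F z| <= C * `|y - z|]) -> thin m (F @` G).
Proof.
move=> GF.
pose lip (x : 'rV[R]_m) d := exists2 C, 0 < C & forall y z,
    ball x d y -> ball x d z -> `|F y - F z| <= C * `|y - z|.
pose c (j : {ffun 'I_m -> rat} * rat) : 'rV[R]_m := \row_i ratr (j.1 i).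
pose Z j := if `[< 0 < (ratr j.2 : R) /\ lip (c j) (ratr j.2) >]
  then F @` ball (c j) (ratr j.2) else set0.
apply: (@sub_thin _ _ _ _ (\bigcup_j Z j)); last first.
  apply: thin_bigcup => j; apply: thin_box_dim; rewrite /Z; case: asboolP; last first.
    by move=> _; exact: box_dim_le0.
  by move=> [q0 [C C0 FC]]; exact: box_dim_lipschitz FC.
move=> _ [x Gx <-]; have [d [C [d0 C0 FC]]] := GF x Gx.
have [|q /andP[dq qd]] := @rat_in_itvoo R 0 (d / 2); first by rewrite divr_gt0.
have /choice[p pP] : forall i, exists p : rat, `|x 0 i - ratr p| < ratr q.
  move=> i; have [|p /andP[xp px]] := @rat_in_itvoo R (x 0 i - ratr q) (x 0 i + ratr q).
    by rewrite ltrD2l gtrN.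
  by exists p; rewrite ltr_distlC; apply/andP.
pose j := (finfun p, q); have xj : ball x (ratr q) (c j).
  by apply/rV_ballE => // i; rewrite mxE ffunE.
have jx y : ball (c j) (ratr q) y -> ball x d y.
  move=> cy; apply: (@le_ball _ _ x (ratr q + ratr q)); first by rewrite [leRHS]splitr; exact: lerD (ltW qd) (ltW qd).
  exact: ball_triangle xj cy.
exists j => //; rewrite /Z; case: asboolP => [_|[]].
  by exists x => //; exact: ball_sym.
by split=> //; exists C => // y z /jx xy /jx xz; exact: FC.
Qed.

(** Where [F] is strictly differentiable it is locally Lipschitz. The other points form a set
    without interior, parametrized with one variable less, so the induction hypothesis applies to
    [F] composed with the parametrizations. *)
Theorem thin_dfun_range m N (F : 'rV[R]_m -> 'rV[R]_N) : dfun D F -> thin m (range F).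
Proof.
elim: m F => [|m IH].
  move=> F _; apply: (@sub_thin _ _ _ _ [set F 0]); last exact/thin_box_dim/box_dim_le_set1.
  by move=> _ [x _ <-] /=; congr F; apply/rowP => -[].
rewrite -[m.+1]addn1 => F dF.
pose G : set 'rV[R]_(m + 1) := [set x | exists2 s, 0 < s & forall y, ball x s y ->
    forall j, exists L, strict_grad (fun z => F z 0 j) y L].
have dG : dset D G by exact: dset_strict_grad_near.
have nG : no_ball (~` G).
  move=> x r r0 xG; have [y xy Gy] := dfun_generic_strict_near D_ominimal x r0 dF.
  exact: (xG y xy).
have [H dH GH] := no_ball_parametrized (dset_not D_ominimal dG) nG.
apply: (@sub_thin _ _ _ _ (F @` G `|` \bigcup_k range (fun x => F (H k x)))).
  move=> _ [x _ <-]; have [Gx|nGx] := pselect (G x); first by left; exists x.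
  by have [k _ [y _ <-]] := GH x nGx; right; exists k => //; exists y.
apply: thinU; last first.
  apply: (thinW (leq_addr 1 m)); apply: thin_bigcup => k.
  by apply: IH; exact: (dfun_comp D_ominimal (dH k) dF).
apply: thin_lipschitz_locus => x [s s0 xs].
have [A FA] := strict_diff_grad (xs x (ballxx _ s0)).
exact: strict_diff_lipschitz FA.
Qed.

Corollary thin_dfun_no_ball m N (F : 'rV[R]_(m + 1) -> 'rV[R]_N) S :
  dfun D F -> dset D S -> no_ball S -> thin m (F @` S).
Proof.
move=> dF dS nS; have [H dH SH] := no_ball_parametrized dS nS.
apply: (@sub_thin _ _ _ _ (\bigcup_k range (fun x => F (H k x)))).
  by move=> _ [x /SH [k _ [y _ <-]] <-]; exists k => //; exists y.
apply: thin_bigcup => k; apply: thin_dfun_range.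
exact: (dfun_comp D_ominimal (dH k) dF).
Qed.

End dimension.

(** * Continuous differentiability and critical points *)

Section C1.
Variable R : realType.

Lemma strict_diff_differential m n (f : 'rV[R]_m -> 'rV[R]_n) x (A : 'M[R]_(m, n)) :
  strict_diff f x A -> differentiable f x /\ jacobian f x = A.
Proof.
move=> fA; have [C C0 AC] := rV_mulmx_bound A.
have cA : continuous (mulmxr A : 'rV[R]_m -> 'rV[R]_n).
  move=> y; apply/(@cvgrPdist_lt _ _ _ (nbhs y)) => e e0; apply/nbhs_ballP.
  exists (e / C) => /=; first by rewrite divr_gt0.
  move=> z; rewrite -ball_normE /ball_/= => yz.
  by rewrite -mulmxBl (le_lt_trans (AC _))// mulrC -ltr_pdivlMr.
have fo : f \o shift x = cst (f x) + mulmxr A +o_ 0 id.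
  apply/eqaddoP => e e0; have [d d0 fd] := fA e e0.
  apply/nbhs_ballP; exists d => //= h.
  rewrite -ball_normE /ball_/= sub0r normrN => hd.
  have xh : ball x d (h + x).
    by rewrite -ball_normE /ball_/= opprD addrCA subrr addr0 normrN.
  have := fd _ _ xh (ballxx x d0); rewrite addrK.
  by rewrite !fctE /= opprD addrA.
have dE := diff_unique cA fo.
split; first by apply/diff_locallyP; rewrite dE.
by apply/row_matrixP => i; rewrite /jacobian !rowE mul_rV_lin1 dE.
Qed.

(** The derivatives [A] at [y] and [B] at a nearby [z] both approximate the same small increment of
    [f] at [z], by strictness at [y] and at [z]; comparing them along each axis bounds A - B. *)
Lemma strict_diff_C1 n (f : 'rV[R]_n -> 'rV[R]_n) x s : 0 < s ->
  (forall y, ball x s y -> exists A, strict_diff f y A) -> C1_at f x.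
Proof.
move=> s0 xs; apply/nbhs_ballP; exists s; first exact: s0.
move=> y xy.
have [A yA] := xs y xy; have [dfy jA] := strict_diff_differential yA.
split; first exact: dfy.
apply/(@cvgrPdist_le _ _ _ (nbhs y)) => e e0.
have e20 : 0 < e / 2 by rewrite divr_gt0.
have [d d0 fd] := yA _ e20; have [t t0 yt] := sub_ball xy.
apply/nbhs_ballP; exists (Num.min d t) => [|z yz]; first by rewrite /= lt_min d0.
have yzd : ball y d z by apply: le_ball yz; rewrite ge_min lexx.
have yzt : ball y t z by apply: le_ball yz; rewrite ge_min lexx orbT.
have [B zB] := xs z (yt _ yzt); have [dfz jB] := strict_diff_differential zB.
have [d2 d20 fd2] := zB _ e20; have [d3 d30 yd3] := sub_ball yzd.
rewrite -[leLHS]/(mx_norm (dmx f y - dmx f z)) mx_normrE.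
apply/bigmax_leP; split=> [|[j i] _ /=]; first exact: ltW.
rewrite /dmx jA jB !mxE.
have m0 : 0 < Num.min d2 d3 by rewrite lt_min d20.
pose u := Num.min d2 d3 / 2; have u0 : 0 < u by rewrite divr_gt0.
pose h : 'rV[R]_n := u *: delta_mx 0 i.
have h0 : h 0 i = u by rewrite !mxE !eqxx mulr1.
have hle : `|h| <= u.
  apply: rV_norm_le => [|k]; first exact: ltW.
  rewrite !mxE eqxx/=; case: (k == i); rewrite ?mulr1 ?mulr0 ?normr0; last exact: ltW.
  by rewrite gtr0_norm.
have zh d' : Num.min d2 d3 <= d' -> ball z d' (h + z).
  move=> d'd; rewrite -ball_normE /ball_/= opprD addrCA subrr addr0 normrN.
  by rewrite (le_lt_trans hle)// (lt_le_trans _ d'd)// /u ltr_pdivrMr// ltr_pMr// ltr1n.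
have eh : e / 2 * `|h| <= e / 2 * u by exact: (ler_wpM2l (ltW e20) hle).
have H1 : `|f (h + z) - f z - h *m A| <= e / 2 * u.
  apply: le_trans eh; have := fd (h + z) z; rewrite addrK; apply; last exact: yzd.
  by apply: yd3; apply: zh; rewrite ge_min lexx orbT.
have H2 : `|f (h + z) - f z - h *m B| <= e / 2 * u.
  apply: le_trans eh; have := fd2 (h + z) z; rewrite addrK; apply; last exact: ballxx.
  by apply: zh; rewrite ge_min lexx.
have H3 : `|h *m (A - B)| <= e * u.
  rewrite mulmxBr -(subrKA (f (h + z) - f z)) -[h *m A - _]opprB addrC.
  by rewrite (le_trans (ler_normB _ _))//; lra.
have := le_trans (rV_norm_coord _ j) H3.
rewrite -scalemxAl -rowE !mxE normrM gtr0_norm// mulrC ler_pM2r//.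
Qed.

(** The singular matrix [dmx f x] belongs to the convex hull for every radius and kills a unit
    vector, so all the infima under the limit are 0. *)
Lemma det0_critical n (f : 'rV[R]_n.+1 -> 'rV[R]_n.+1) x :
  C1_at f x -> \det (dmx f x) = 0 -> critical f x.
Proof.
move=> C1x det0; rewrite /critical /nu /=.
apply: lim_near_cst; first exact: ereal_hausdorff.
near=> r; have r0 : 0 < r by near: r; exact: nbhs_right_gt.
apply/eqP; rewrite eq_le; apply/andP; split; last first.
  apply/ereal_infP => _ [A _ <-]; apply/ereal_infP => _ [v _ <-].
  by rewrite lee_fin sqrtr_ge0.
apply: (@le_trans _ _ (sigma (dmx f x))).
  apply: ereal_inf_lbound; exists (dmx f x) => //; apply: sub_gen_smallest.
  exists x => //; split; last by move=> /(_ C1x).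
  rewrite /eball /= subrr /enorm.
  by rewrite big1 ?sqrtr0// => i _; rewrite big1// => j _; rewrite mxE expr0n.
(* [det0P] gives a row in the left kernel, whereas [sigma] acts on columns, hence the
   transposition. *)
have := det0; rewrite -det_tr => /eqP/det0P[v v0 vA].
pose N := enorm v^T.
have N0 : 0 < N.
  rewrite sqrtr_gt0.
  have [i vi] : exists i, v 0 i != 0.
    apply/existsP; apply: contraNT v0 => /existsPn vi; apply/eqP/rowP => i.
    by have := vi i; rewrite negbK mxE => /eqP.
  have sq0 k : 0 <= \sum_j v^T k j ^+ 2 by apply: sumr_ge0 => j _; exact: sqr_ge0.
  rewrite (bigD1 i)//= big_ord1 mxE ltr_pwDl//; last by rewrite sumr_ge0.
  by rewrite exprn_even_gt0.
apply: ereal_inf_lbound; exists (N^-1 *: v^T) => /=.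
  rewrite /enorm; under eq_bigr do under eq_bigr do rewrite mxE exprMn.
  under eq_bigr do rewrite -mulr_sumr.
  rewrite -mulr_sumr sqrtrM ?sqr_ge0// sqrtr_sqr gtr0_norm ?invr_gt0//.
  by rewrite -/(enorm v^T) mulVf// gt_eqF.
rewrite -scalemxAr -[dmx f x]trmxK -trmx_mul vA trmx0 scaler0 /enorm.
by rewrite big1 ?sqrtr0// => i _; rewrite big1// => j _; rewrite mxE expr0n.
Unshelve. all: by end_near. Qed.

End C1.

(** * Boxes are not null sets *)

Section box_cover.
Variable R : realType.
Local Open Scope ereal_scope.

(* Integrate over the first coordinate the inequality for the slices. *)
Lemma box_cover n (l u : 'I_n -> R) (K : set nat) (a b : nat -> 'I_n -> R) :
  (forall i, l i <= u i)%R -> (forall k i, a k i <= b k i)%R ->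
  [set x : 'I_n -> R | forall i, (l i <= x i <= u i)%R] `<=`
    \bigcup_(k in K) [set x | forall i, (a k i <= x i <= b k i)%R] ->
  (\prod_i (u i - l i))%R%:E <= \esum_(k in K) (\prod_i (b k i - a k i))%R%:E.
Proof.
elim: n l u K a b => [|n IH] l u K a b lu ab sub.
  (* In dimension 0 every box has volume 1, and a cover of the single point has at least one
     member. *)
  have [|k Kk _] := sub (fun=> 0%R); first by case.
  rewrite big_ord0; apply: esum_ge; exists [set k].
    by split=> [|_ ->//]; exact: finite_set1.
  by rewrite fsbig_set1 big_ord0.
rewrite big_ord_recl /=.
pose P := (\prod_i (u (lift ord0 i) - l (lift ord0 i)))%R.
have P0 : (0 <= P)%R by apply: prodr_ge0 => i _; rewrite subr_ge0.
pose v k := (\prod_i (b k (lift ord0 i) - a k (lift ord0 i)))%R.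
have v0 k : (0 <= v k)%R by apply: prodr_ge0 => i _; rewrite subr_ge0.
(* Extension by 0 outside of [K] replaces the sum over [K] by a series, which can be integrated term
   by term. *)
pose w k := if k \in K then v k else 0%R.
have w0 k : (0 <= w k)%R by rewrite /w; case: ifP.
pose F k (t : R) := (w k * \1_(`[a k ord0, b k ord0]) t)%R.
have F0 k t : 0 <= (F k t)%:E by rewrite lee_fin mulr_ge0.
have PF t : (P * \1_(`[l ord0, u ord0]) t)%:E <= \sum_(k <oo) (F k t)%:E.
  rewrite indicE; case: (boolP (t \in _)) => [|_]; last first.
    by rewrite mulr0 nneseries_ge0.
  rewrite inE /= in_itv /= => lt; rewrite mulr1 nneseries_esumT//.
  pose St := [set k | (a k ord0 <= t <= b k ord0)%R].
  apply: (@le_trans _ _ (\esum_(k in K `&` St) (v k)%:E)).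
    apply: IH => // x lx.
    pose y i := if unlift ord0 i is Some j then x j else t.
    have [i|k Kk ky] := sub y.
      by rewrite /y; case: unliftP => [j ->|->]; [exact: lx|exact: lt].
    exists k; first by split=> //; have := ky ord0; rewrite /y unlift_none.
    by move=> i; have := ky (lift ord0 i); rewrite /y liftK.
  rewrite esum_mkcond; apply: le_esum => k _; rewrite in_setI /F /w indicE.
  case: (boolP (k \in K)) => //= kK.
  case: (boolP (k \in St)) => [|_]; last by rewrite lee_fin mulr_ge0.
  by rewrite inE /St /= => akt; rewrite (_ : t \in _) ?mulr1// inE/= in_itv.
pose mu := @lebesgue_measure R.
have muI (c d : R) : (c <= d)%R -> mu [set` `[c, d]%R] = (d - c)%:E.
  move=> cd; rewrite /mu lebesgue_measure_itv /= lte_fin.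
  by case: ltgtP cd => // -> _; rewrite subrr.
have intI (c d q : R) : (0 <= q)%R -> (c <= d)%R ->
    \int[mu]_t (q * \1_(`[c, d]) t)%:E = (q * (d - c))%:E.
  move=> q0 cd; under eq_integral do rewrite EFinM.
  rewrite ge0_integralZl_EFin//; last first.
    by apply/measurable_EFinP; exact: measurable_indic.
  by rewrite integral_indic// setIT [X in _ * X]muI.
have mI (c d q : R) : measurable_fun setT (fun t => (q * \1_(`[c, d]) t)%:E).
  by apply/measurable_EFinP; apply: measurable_funM => //; exact: measurable_indic.
apply: (@le_trans _ _ (\int[mu]_t (P * \1_(`[l ord0, u ord0]) t)%:E)).
  by rewrite intI// mulrC.
apply: (@le_trans _ _ (\int[mu]_t \sum_(k <oo) (F k t)%:E)).
  apply: ge0_le_integral => //.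
  - by move=> t _; rewrite lee_fin mulr_ge0.
  - exact: mI.
  - apply: (@ge0_emeasurable_sum _ _ _ setT (fun k t => (F k t)%:E) xpredT) => // k _.
    exact: mI.
rewrite integral_nneseries//; last by move=> k; exact: mI.
rewrite (eq_eseriesr (g := fun k => (w k * (b k ord0 - a k ord0))%:E)); last first.
  by move=> k _; exact: intI.
rewrite nneseries_esumT; last by move=> k; rewrite lee_fin mulr_ge0// subr_ge0.
rewrite [leRHS]esum_mkcond; apply: le_esum => k _; rewrite /w.
by case: ifP => _; rewrite ?mul0r// big_ord_recl mulrC.
Qed.

End box_cover.

Lemma ball_not_measure_zero (R : realType) n (E : set 'rV[R]_n) x r : 0 < r ->
  ball x r `<=` E -> ~ measure_zero E.
Proof.
move=> r0 xE; rewrite /measure_zero => E0.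
pose l i := x 0 i - r / 2; pose u i := x 0 i + r / 2.
have P0 : 0 < \prod_i (u i - l i).
  by apply: prodr_gt0 => i _; rewrite /u /l; lra.
have : (lebesgue_outer E < (\prod_i (u i - l i))%:E)%E by rewrite E0 lte_fin.
move=> /ereal_inf_lt[_ [K [a [b [ab EK ->]]]]].
apply/negP; rewrite -leNgt; apply: box_cover => [i|k i|y ly].
- by rewrite /u /l; lra.
- exact: ab.
have [|k Kk yk] := EK (\row_i y i).
  apply: xE; apply/rV_ballE => // i; rewrite mxE ltr_norml.
  by have := ly i; rewrite /u /l => /andP[? ?]; apply/andP; split; lra.
by exists k => // i; have := yk i; rewrite mxE.
Qed.

(** * A discrete degree *)

Section discrete_degree.
Variables (R : numFieldType) (G : finZmodType).

(* [vertex e p s] walks from [p] along the edges of the simplex of Kuhn's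
   triangulation of the unit cube at [p] that is indexed by [s]. *)
Definition vertex n (e : 'I_n -> G) (p : G) (s : 'S_n) (k : nat) : G :=
  p + \sum_(i < n | (i < k)%N) e (s i).

Definition simplex_mx n (e : 'I_n -> G) (H : G -> 'rV[R]_n.+1) p s : 'M[R]_n.+1 :=
  \matrix_(j < n.+1) H (vertex e p s j).

(** Exchanging two consecutive steps of the walk moves only the vertex between them: the opposite
    facet is shared by two simplices of the same cube, with permutations of opposite sign. *)
Lemma vertex_tperm n (e : 'I_n.+1 -> G) p s (j : 'I_n) (k : nat) : k != j.+1 ->
  vertex e p (tperm (widen_ord (leqnSn n) j) (lift ord0 j) * s)%g k = vertex e p s k.
Proof.
move=> kj; rewrite /vertex; congr (_ + _).
rewrite [RHS](reindex_inj (@perm_inj _ (tperm (widen_ord (leqnSn n) j) (lift ord0 j)))) /=.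
apply: eq_big => [i|i _]; last by rewrite permM.
have jk : (j < k)%N = (j.+1 < k)%N by rewrite leq_eqVlt eq_sym (negbTE kj).
by case: tpermP => [->|->|//]; rewrite /= /bump add1n jk.
Qed.

(** Dropping the first vertex leaves a walk that starts at [p + e (s ord0)]; appending the omitted
    step at its end gives the simplex on the other side of that facet. *)
Lemma vertex_rot n (e : 'I_n.+1 -> G) p (s : 'S_n.+1) (k : 'I_n.+1) :
  vertex e (p + e (s ord0)) (lift_perm ord_max ord0 1 * s)%g k = vertex e p s k.+1.
Proof.
rewrite /vertex !(big_mkcond (fun i => (_ < _)%N)) big_ord_recr /= ltnNge -ltnS ltn_ord /= addr0.
rewrite [in RHS]big_ord_recl /= addrA; congr (_ + _).
apply: eq_bigr => i _; rewrite /bump add1n ltnS.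
rewrite permM (_ : widen_ord _ i = lift ord_max i) ?lift_perm_lift ?perm1//.
by apply/val_inj; rewrite /= /bump leqNgt ltn_ord.
Qed.

(* Expanding along the constant column turns the sum into a sum over facets,
   in which every facet occurs twice with opposite signs. *)
Theorem torus_degree0 n (e : 'I_n.+1 -> G) (H : G -> 'rV[R]_n.+2) :
  (forall g, H g 0 0 = 1) ->
  \sum_p \sum_(s : 'S_n.+1) (-1) ^+ s * \det (simplex_mx e H p s) = 0.
Proof.
move=> H1.
pose F p s j := \det (row' j (col' ord0 (simplex_mx e H p s))).
pose T j : R := (-1) ^+ (j : 'I_n.+2) * \sum_(s : 'S_n.+1) \sum_p (-1) ^+ s * F p s j.
transitivity (\sum_j T j).
  rewrite exchange_big /=; under [RHS]eq_bigr do rewrite /T mulr_sumr.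
  rewrite [RHS]exchange_big /=; apply: eq_bigr => s _.
  under [RHS]eq_bigr do rewrite mulr_sumr.
  rewrite [RHS]exchange_big /=; apply: eq_bigr => p _.
  rewrite (expand_det_col _ ord0) mulr_sumr; apply: eq_bigr => j _.
  by rewrite mxE H1 mul1r /cofactor addn0 mulrCA.
(* Facets opposite to an inner vertex cancel within each cube; those opposite to the first and the
   last vertex cancel between cubes. *)
rewrite big_ord_recl big_ord_recr /= big1 => [|j _]; last first.
  set J := lift ord0 _; rewrite /T.
  suff -> : \sum_(s : 'S_n.+1) \sum_p (-1) ^+ s * F p s J = 0 by rewrite mulr0.
  set S := \sum_s _; apply/eqP; rewrite -eqNr eq_sym; apply/eqP.
  pose t := tperm (widen_ord (leqnSn n) j) (lift ord0 j).
  rewrite {1}/S (reindex_inj (mulgI t)) /= -sumrN; apply: eq_bigr => s _.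
  rewrite -sumrN; apply: eq_bigr => p _.
  rewrite odd_permM odd_tperm (_ : _ != _); last by rewrite -val_eqE /= /bump add1n neq_ltn ltnSn.
  rewrite signr_addb expr1 mulN1r mulNr; congr (- (_ * _)).
  congr (\det _); apply/matrixP => a b; rewrite !mxE vertex_tperm//.
  by rewrite eq_sym; exact: neq_bump.
rewrite add0r /T expr0 mul1r.
(* This cyclic shift has sign (-1)^n and the last facet carries (-1)^(n+1), so it cancels the first
   facet after a translation of [p]. *)
pose c : 'S_n.+1 := lift_perm ord_max ord0 1.
rewrite [X in _ + _ * X](reindex_inj (mulgI c)) /= mulr_sumr -big_split /=.
apply: big1 => s _; rewrite [X in _ + _ * X](reindex_inj (addIr (e (s ord0)))) /=.
rewrite mulr_sumr -big_split /=; apply: big1 => p _.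
rewrite (_ : F _ _ (lift ord0 ord_max) = F p s ord0); last first.
  congr (\det _); apply/matrixP => a b; rewrite !mxE -vertex_rot; congr (H (vertex _ _ _ _) _ _).
  by rewrite /= /bump !add1n ltnNge -ltnS ltn_ord.
rewrite odd_permM odd_lift_perm odd_perm1 signr_addb !addbF /= /bump add1n.
by rewrite signr_odd exprS !mulrA mulN1r !mulNr -expr2 sqrr_sign mul1r subrr.
Qed.

(** Subtracting from each row its predecessor is multiplication by the unitriangular [L]; the
    constant column becomes the first basis vector, and the edges of the simplex remain. *)
Lemma det_simplex_mx n (M : 'M[R]_n.+1) : (forall j, M j 0 = 1) ->
  \det M = \det (\matrix_(i < n, j < n) (M (lift ord0 i) (lift ord0 j) -
                                        M (widen_ord (leqnSn n) i) (lift ord0 j))).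
Proof.
move=> M1; pose L : 'M[R]_n.+1 := \matrix_(i, j) ((i == j)%:R - (i == j.+1 :> nat)%:R).
have LM i j : (L *m M) i j = M i j - (if unlift ord0 i is Some k then M (widen_ord (leqnSn n) k) j else 0).
  rewrite mxE; under eq_bigr do rewrite mxE mulrBl.
  rewrite sumrB (bigD1 i)//= eqxx mul1r big1 ?addr0 => [|k ki]; last first.
    by rewrite eq_sym (negbTE ki) mul0r.
  congr (_ - _); case: unliftP => [k ->|->]; last first.
    by apply: big1 => k _; rewrite /= mul0r.
  rewrite (bigD1 (widen_ord (leqnSn n) k))//= /bump add1n eqxx mul1r big1 ?addr0// => l lk.
  by rewrite eqSS eq_sym -[k : nat]/(widen_ord (leqnSn n) k : nat) val_eqE (negbTE lk) mul0r.
have Ltrig : is_trig_mx L.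
  apply/is_trig_mxP => i j ij; rewrite mxE -val_eqE /= (ltn_eqF ij).
  by rewrite (ltn_eqF (ltn_trans ij (ltnSn j))) subrr.
have Ldet : \det L = 1.
  rewrite det_trig//; apply: big1 => i _; rewrite mxE eqxx.
  by rewrite (ltn_eqF (ltnSn i)) subr0.
rewrite -[LHS]mul1r -Ldet -det_mulmx (expand_det_col _ ord0) big_ord_recl big1 ?addr0 => [|i _].
  rewrite LM unlift_none subr0 M1 mul1r /cofactor /= expr0 mul1r; congr (\det _).
  by apply/matrixP => i j; rewrite 2!mxE LM liftK mxE.
by rewrite LM liftK !M1 subrr mul0r.
Qed.

End discrete_degree.

(** * Infinitesimal degree *)

Section compact_uniform.
Variable R : realType.

(** Uniform continuity, gaps and isolating distances below are all instances of this one covering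
    argument. *)
Lemma compact_uniform n (K : set 'rV[R]_n) (P : 'rV[R]_n -> R -> Prop) : compact K ->
  (forall z, K z -> exists2 r, 0 < r & forall x h, ball z r x -> 0 < h < r -> P x h) ->
  exists2 r, 0 < r & forall x h, K x -> 0 < h < r -> P x h.
Proof.
move=> /compact_near_coveringP cK KP.
have [z Kz|r /= r0 H] := cK R (0^'+) (fun h x => P x h) _.
  have [r r0 rP] := KP z Kz.
  exists (ball z r, [set h | 0 < h < r]) => /=; last first.
    by move=> [x h] [/= zx hr]; exact: rP.
  split; first exact: nbhsx_ballx.
  exists r => //= h; rewrite /= sub0r normrN => hr h0.
  by rewrite h0 (le_lt_trans (ler_norm h)).
exists r => // x h Kx /andP[h0 hr]; apply: (H h) => //=.
by rewrite sub0r normrN gtr0_norm.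
Qed.

Lemma compact_open_uniform n (K V : set 'rV[R]_n) : compact K ->
  (forall z, K z -> exists2 r, 0 < r & ball z r `<=` V) ->
  exists2 r, 0 < r & forall z, K z -> ball z r `<=` V.
Proof.
move=> cK KV; have [z Kz|r r0 rV] := @compact_uniform n K (fun x h => ball x h `<=` V) cK.
  have [r r0 zV] := KV z Kz; exists (r / 2); first by rewrite divr_gt0.
  move=> x h zx /andP[h0 hr] y xy; apply: zV.
  apply: (@le_ball _ _ z (r / 2 + h)); first by lra.
  exact: ball_triangle zx xy.
have r20 : 0 < r / 2 by rewrite divr_gt0.
by exists (r / 2) => // z Kz; apply: rV => //; apply/andP; split => //; lra.
Qed.

Lemma compact_uniform_continuous n N (f : 'rV[R]_n -> 'rV[R]_N) K e : compact K ->
  continuous f -> 0 < e -> exists2 r, 0 < r & forall x y, K x -> ball x r y ->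
    `|f x - f y| < e.
Proof.
move=> cK fc e0; have e20 : 0 < e / 2 by rewrite divr_gt0.
have [z Kz|r r0 rP] := @compact_uniform n K
    (fun x h => forall y, ball x h y -> `|f x - f y| < e) cK.
  have /cvgrPdist_lt/(_ _ e20)/nbhs_ballP[r /= r0 zr] := fc z.
  exists (r / 2); first by rewrite divr_gt0.
  move=> x h zx /andP[h0 hr] y xy.
  have zy : ball z r y.
    apply: (@le_ball _ _ z (r / 2 + h)); first by lra.
    exact: ball_triangle zx xy.
  have zx' : ball z r x by apply: le_ball zx; lra.
  have := zr _ zy; have := zr _ zx'; rewrite /= => H1 H2.
  rewrite -(subrKA (f z)) (le_lt_trans (ler_normD _ _))//.
  by rewrite [X in X + _]distrC; lra.
have r20 : 0 < r / 2 by rewrite divr_gt0.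
exists (r / 2) => // x y Kx xy; apply: (rP x (r / 2)) => //.
by apply/andP; split=> //; lra.
Qed.

Lemma compact_gap n N (f : 'rV[R]_n -> 'rV[R]_N) K y : compact K ->
  continuous f -> (forall x, K x -> f x <> y) ->
  exists2 c, 0 < c & forall x, K x -> c <= `|f x - y|.
Proof.
move=> cK fc nfy; have [z Kz|r r0 rP] := @compact_uniform n K
    (fun x h => h <= `|f x - y|) cK.
  have d0 : 0 < `|f z - y| / 2.
    by rewrite divr_gt0// normr_gt0 subr_eq0; apply/eqP; exact: nfy.
  have /cvgrPdist_lt/(_ _ d0)/nbhs_ballP[r /= r0 zr] := fc z.
  exists (Num.min r (`|f z - y| / 2)); first by rewrite lt_min r0.
  move=> x h zx; rewrite lt_min => /andP[h0 /andP[_ hd]].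
  have := zr x (le_ball _ zx); rewrite ge_min lexx => /(_ isT) /= H.
  have := ler_normD (f z - f x) (f x - y); rewrite subrKA; lra.
exists (r / 2); first by rewrite divr_gt0.
by move=> x Kx; apply: rP => //; apply/andP; split; lra.
Qed.

End compact_uniform.

Section smooth_step.
Variable R : realType.
Implicit Types t a b : R.

(** A function of class C^1 with Lipschitz derivative; [step] is its second difference. *)
Definition qplus t : R := Num.max 0 t ^+ 2.

(* A C^1 step, constant outside of ]-1, 1[, which turns f - y into the labels
   of the discrete degree. *)
Definition step t : R := qplus (t + 1) - 2 * qplus t + qplus (t - 1).
Definition dstep t : R := 2 * (Num.max 0 (t + 1) - 2 * Num.max 0 t + Num.max 0 (t - 1)).

Lemma qplus_diff a b : `|qplus a - qplus b - 2 * Num.max 0 b * (a - b)| <= (a - b) ^+ 2.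
Proof.
have a2 := sqr_ge0 a; have b2 := sqr_ge0 b; have ab2 := sqr_ge0 (a - b).
rewrite /qplus ler_norml; case: (leP 0 a) => a0; case: (leP 0 b) => b0.
- by apply/andP; split; lra.
- have : a * b <= 0 by apply: mulr_ge0_le0 => //; exact: ltW.
  by move=> ab; apply/andP; split; lra.
- have : a * b <= 0 by apply: mulr_le0_ge0 => //; exact: ltW.
  by move=> ab; apply/andP; split; lra.
- by apply/andP; split; lra.
Qed.

(** The constant is 1 + 2 + 1, the sum of the absolute weights of the second difference. *)
Lemma step_diff a b : `|step a - step b - dstep b * (a - b)| <= 4 * (a - b) ^+ 2.
Proof.
have := qplus_diff (a + 1) (b + 1); have := qplus_diff a b.
have := qplus_diff (a - 1) (b - 1).
rewrite (_ : a + 1 - (b + 1) = a - b); last by ring.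
rewrite (_ : a - 1 - (b - 1) = a - b); last by ring.
rewrite !ler_norml /step /dstep => /andP[? ?] /andP[? ?] /andP[? ?].
by apply/andP; split; lra.
Qed.

Lemma dstep_lipschitz a b : `|dstep a - dstep b| <= 8 * `|a - b|.
Proof.
have H (c d : R) : `|Num.max 0 c - Num.max 0 d| <= `|c - d|.
  have c1 := ler_norm (c - d); have c2 := ler_norm (- (c - d)).
  have c3 : 0 <= `|c - d| by []; rewrite normrN in c2.
  rewrite ler_norml; case: (leP 0 c) => c0; case: (leP 0 d) => d0; apply/andP; split; lra.
have := H (a + 1) (b + 1); have := H a b; have := H (a - 1) (b - 1).
rewrite (_ : a + 1 - (b + 1) = a - b); last by ring.
rewrite (_ : a - 1 - (b - 1) = a - b); last by ring.
rewrite !ler_norml /dstep => /andP[? ?] /andP[? ?] /andP[? ?].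
by apply/andP; split; lra.
Qed.

Lemma dstep_ge0 t : 0 <= dstep t.
Proof.
rewrite /dstep; case: (leP 0 t) => t0; case: (leP 0 (t + 1)) => t1;
  by case: (leP 0 (t - 1)) => t2; lra.
Qed.

Lemma dstep0 : dstep 0 = 2.
Proof. by rewrite /dstep add0r sub0r !maxxx (max_r ler01) max_l ?lerN10//; lra. Qed.

Lemma step_le t : t <= -1 -> step t = 0.
Proof.
by move=> t1; rewrite /step /qplus !max_l; lra.
Qed.

Lemma step_ge t : 1 <= t -> step t = 2.
Proof. by move=> t1; rewrite /step /qplus !max_r; try lra; ring. Qed.

End smooth_step.


Section infinitesimal.
Variable R : realType.

Lemma det_continuous n (A : 'M[R]_n) e : 0 < e ->
  exists2 d, 0 < d & forall B : 'M[R]_n, (forall i j, `|A i j - B i j| < d) -> `|\det A - \det B| < e.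
Proof.
move=> e0; have cdet : continuous (fun B : 'M[R]_n => \det B).
  have cprod (s : 'S_n) : continuous (fun B : 'M[R]_n => \prod_i B i (s i)).
    apply: (@continuous_big (R : topologicalType) 'I_n (@GRing.mul R) 1 xpredT
      (@mul_continuous R) 'M[R]_n (index_enum _) (fun i B => B i (s i))) => i _.
    exact: coord_continuous.
  have -> : (fun B : 'M[R]_n => \det B) =
    (fun B => \sum_(s : 'S_n) (-1) ^+ s * \prod_i B i (s i)) by [].
  have cs (s : 'S_n) : continuous (fun B : 'M[R]_n => (-1) ^+ s * \prod_i B i (s i)).
    by move=> B; exact: (cvgM (cvg_cst ((-1) ^+ s : R)) (cprod s B)).
  have H := @continuous_big (R : topologicalType) 'S_n (@GRing.add R) 0 xpredT
    (@add_continuous R) 'M[R]_n (index_enum _)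
    (fun s B => (-1) ^+ s * \prod_i B i (s i)) (fun s _ => cs s).
  exact: H.
have /cvgrPdist_lt/(_ _ e0)/nbhs_ballP[d /= d0 Ad] := cdet A.
by exists d => // B AB; apply: Ad; split.
Qed.

Lemma strict_diff_affine m n (f : 'rV[R]_m -> 'rV[R]_n) x A b w :
  strict_diff f x A -> strict_diff (fun z => w *: (f z - b)) x (w *: A).
Proof.
move=> fA e e0; have w10 : 0 < `|w| + 1 by rewrite ltr_wpDl.
have [|d d0 fd] := fA (e / (`|w| + 1)); first by rewrite divr_gt0.
exists d => // y z xy xz; rewrite -scalerBr opprB addrA subrK -scalemxAr -scalerBr normrZ.
apply: (@le_trans _ _ (`|w| * (e / (`|w| + 1) * `|y - z|))).
  by apply: ler_wpM2l => //; exact: fd.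
rewrite mulrA; apply: ler_wpM2r => //.
by rewrite mulrA ler_pdivrMr// mulrC; apply: ler_wpM2l; [exact: ltW|rewrite lerDl].
Qed.

Lemma strict_diff_step m n (f : 'rV[R]_m -> 'rV[R]_n) x A : strict_diff f x A ->
  strict_diff (fun z => map_mx (@step R) (f z)) x
    (A *m diag_mx (map_mx (@dstep R) (f x))).
Proof.
move=> fA e e0; have [d1 [C [d10 C0 fC]]] := strict_diff_lipschitz fA.
pose p := `|map_mx (@dstep R) (f x)| + 1.
have p0 : 0 < p by rewrite ltr_wpDl.
have [|d2 d20 fd] := fA (e / 2 / p); first by rewrite !divr_gt0.
(* Of the 16, 8 come from the quadratic error of [step] and 8 from the Lipschitz constant of
   [dstep]; together they use half of [e], and the error of [f] the other half. *)
pose d3 := e / 2 / (16 * C ^+ 2).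
have d30 : 0 < d3 by rewrite !divr_gt0// mulr_gt0// exprn_gt0.
pose d := Num.min d1 (Num.min d2 d3); have d0 : 0 < d by rewrite !lt_min d10 d20.
have dd1 : d <= d1 by rewrite ge_min lexx.
have dd2 : d <= d2 by rewrite !ge_min lexx orbT.
have dd3 : d <= d3 by rewrite !ge_min lexx !orbT.
exists d => // y z xy xz; apply: rV_norm_le => [|j]; first by rewrite mulr_ge0// ltW.
rewrite mulmxA mul_mx_diag !mxE.
set a := f y 0 j; set b := f z 0 j; set c := f x 0 j.
set l := \sum_(k < m) _.
have N0 : 0 <= `|y - z| by [].
have Hyz : `|a - b| <= C * `|y - z|.
  have := fC y z (le_ball dd1 xy) (le_ball dd1 xz); apply: le_trans.
  by have := rV_norm_coord (f y - f z) j; rewrite !mxE.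
have Hyx : `|a - c| <= C * d.
  apply: (@le_trans _ _ (C * `|y - x|)).
    have := fC y x (le_ball dd1 xy) (ballxx _ d10); apply: le_trans.
    by have := rV_norm_coord (f y - f x) j; rewrite !mxE.
  apply: ler_wpM2l; first exact: ltW.
  by move: xy; rewrite -ball_normE /ball_/= distrC => /ltW.
have Hzx : `|b - c| <= C * d.
  apply: (@le_trans _ _ (C * `|z - x|)).
    have := fC z x (le_ball dd1 xz) (ballxx _ d10); apply: le_trans.
    by have := rV_norm_coord (f z - f x) j; rewrite !mxE.
  apply: ler_wpM2l; first exact: ltW.
  by move: xz; rewrite -ball_normE /ball_/= distrC => /ltW.
have Hl : `|a - b - l| <= e / 2 / p * `|y - z|.
  have := fd y z (le_ball dd2 xy) (le_ball dd2 xz); apply: le_trans.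
  have := rV_norm_coord (f y - f z - (y - z) *m A) j; rewrite !mxE; apply: le_trans.
  by rewrite le_eqVlt; apply/orP; left; apply/eqP; congr `| _ - _ |; apply: eq_bigr => k _; rewrite !mxE.
have Hp : `|dstep c| <= p.
  have := rV_norm_coord (map_mx (@dstep R) (f x)) j; rewrite !mxE => /le_trans; apply.
  by rewrite /p lerDl.
have H1 := step_diff a b.
have H2 : `|(dstep b - dstep c) * (a - b)| <= 8 * (C * d) * (C * `|y - z|).
  rewrite normrM; apply: ler_pM => //.
  by apply: (le_trans (dstep_lipschitz b c)); apply: ler_wpM2l.
have H3 : `|dstep c * (a - b - l)| <= e / 2 * `|y - z|.
  rewrite normrM; apply: (@le_trans _ _ (p * (e / 2 / p * `|y - z|))).
    by apply: ler_pM.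
  by rewrite mulrA mulrCA divff ?gt_eqF// mulr1.
have H4 : (a - b) ^+ 2 <= 2 * (C * d) * (C * `|y - z|).
  rewrite -normr_id -(ger0_norm (sqr_ge0 _)) normr_id normrX expr2.
  apply: ler_pM => //; rewrite -(subrKA c) (le_trans (ler_normD _ _))//.
  by rewrite [`|c - b|]distrC; lra.
have H5 : 16 * (C * d) * (C * `|y - z|) <= e / 2 * `|y - z|.
  rewrite [leLHS](_ : _ = d * (16 * C ^+ 2) * `|y - z|); last by ring.
  by apply: ler_wpM2r => //; rewrite -ler_pdivlMr// mulr_gt0// exprn_gt0.
have -> : step a - step b - l * dstep c =
    (step a - step b - dstep b * (a - b)) + (dstep b - dstep c) * (a - b)
      + dstep c * (a - b - l) by ring.
move: H1 H2 H3; rewrite !ler_norml => /andP[? ?] /andP[? ?] /andP[? ?].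
by apply/andP; split; lra.
Qed.

(** The counterpart of [vertex] in R^n, with edges of length [h] along the axes. *)
Definition simplex_point n (q : 'rV[R]_n) h (s : 'S_n) (k : nat) : 'rV[R]_n :=
  q + h *: \sum_(i < n | (i < k)%N) delta_mx 0 (s i).

Lemma simplex_pointE n (q : 'rV[R]_n) h (s : 'S_n) k c :
  simplex_point q h s k 0 c = q 0 c + h * ((s^-1)%g c < k)%N%:R.
Proof.
rewrite !mxE summxE; congr (_ + _ * _).
have [ck|ck] := ltnP ((s^-1)%g c) k.
  rewrite (bigD1 ((s^-1)%g c))//= mxE permKV !eqxx big1 ?addr0// => i /andP[_ ic].
  by rewrite mxE eqxx /=; case: eqP => // ci; rewrite ci permK eqxx in ic.
apply: big1 => i ik; rewrite mxE eqxx /=; case: eqP => // ci.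
by move: ck; rewrite ci permK leqNgt ik.
Qed.

(** The matrix of increments is [h] times a row permutation, by [s], of a matrix of difference
    quotients close to [A]; the sign of [s] undoes the permutation. *)
Lemma det_strict_diff n (f : 'rV[R]_n -> 'rV[R]_n) z A e : strict_diff f z A -> 0 < e ->
  exists2 r, 0 < r & forall q h (s : 'S_n), ball z r q -> 0 < h < r ->
    `|(-1) ^+ s * \det (\matrix_(i < n, j < n) (f (simplex_point q h s i.+1) 0 j -
        f (simplex_point q h s i) 0 j)) - h ^+ n * \det A| <= e * h ^+ n.
Proof.
move=> fA e0; have [d d0 Ad] := det_continuous A e0.
have d20 : 0 < d / 2 by rewrite divr_gt0.
have [r r0 fr] := fA _ d20; exists (r / 2); first by rewrite divr_gt0.
move=> q h s zq /andP[h0 hr].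
have zp k : ball z r (simplex_point q h s k).
  apply: (@le_ball _ _ z (r / 2 + r / 2)); first by lra.
  have r20 : 0 < r / 2 by rewrite divr_gt0.
  apply: (ball_triangle zq); apply/(rV_ballE _ _ r20) => i; rewrite simplex_pointE opprD addrA subrr sub0r normrN normrM.
  rewrite gtr0_norm// (le_lt_trans _ hr)//; apply: ler_piMr; first exact: ltW.
  by case: (_ < _)%N; rewrite ?normr1 ?normr0.
(* Rows are indexed by the axis [c] rather than by the step that walks along it, which is step
   [(s^-1)%g c]. *)
pose B : 'M[R]_n := \matrix_(c, j) (h^-1 * (f (simplex_point q h s ((s^-1)%g c).+1) 0 j -
        f (simplex_point q h s ((s^-1)%g c)) 0 j)).
set M := (X in \det X).
have ME : M = h *: row_perm s B.
  by apply/matrixP => i j; rewrite !mxE permK mulrA divff ?gt_eqF// mul1r.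
rewrite ME detZ row_permE det_mulmx det_perm mulrCA [_ * (_ * \det B)]mulrA -expr2 sqrr_sign mul1r.
rewrite -mulrBr normrM (ger0_norm (exprn_ge0 n (ltW h0))) [leLHS]mulrC ler_pM2r ?exprn_gt0//.
rewrite distrC ltW//; apply: Ad => c j.
pose k := (s^-1)%g c.
have pE : simplex_point q h s k.+1 - simplex_point q h s k = h *: delta_mx 0 c.
  apply/rowP => i; rewrite mxE [X in _ + X]mxE !simplex_pointE !mxE eqxx /=.
  rewrite opprD addrACA subrr add0r -mulrBr ltnS leq_eqVlt; congr (_ * _).
  rewrite val_eqE /k (inj_eq perm_inj).
  by case: (eqVneq i c) => [->|_]; rewrite ?ltnn ?subr0//= subrr.
have hle : `|simplex_point q h s k.+1 - simplex_point q h s k| <= h.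
  rewrite pE; apply: rV_norm_le => [|i]; first exact: ltW.
  rewrite !mxE eqxx/=; case: (i == c); rewrite ?mulr1 ?mulr0 ?normr0; last exact: ltW.
  by rewrite gtr0_norm.
have H := le_trans (rV_norm_coord _ j) (fr _ _ (zp k.+1) (zp k)).
have {}H := le_trans H (ler_wpM2l (ltW d20) hle).
move: H; rewrite pE -scalemxAl -rowE 5!mxE [row c A 0 j]mxE -/k.
set X := f _ 0 j - f _ 0 j => H.
rewrite (_ : A c j - B c j = - (h^-1 * (X - h * A c j))); last first.
  by rewrite mxE -/k /X; field; exact: lt0r_neq0.
rewrite normrN normrM gtr0_norm ?invr_gt0// mulrC ltr_pdivrMr//.
apply: le_lt_trans H _; rewrite ltr_pM2r//; lra.
Qed.

End infinitesimal.

(** * A cubical grid closed up to a torus *)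

Section grid.
Variables (R : realType) (m N : nat) (M : R).
Hypothesis M0 : 0 < M.

Local Notation G := 'rV['I_N.+2]_m.+1.

(** The [N.+2] residues on each axis are the ends of [N.+1] intervals that divide [-M, M]; adding 1
    to the last residue leads from M back to -M. *)
Definition mesh : R := 2 * M / N.+1%:R.

Definition grid_point (g : G) : 'rV[R]_m.+1 := \row_i (- M + (g 0 i : nat)%:R * mesh).

Definition grid_vertex (g : G) (s : 'S_m.+1) (k : nat) : G :=
  vertex (fun i => delta_mx 0 i) g s k.

Lemma mesh_gt0 : 0 < mesh.
Proof. by rewrite divr_gt0// mulr_gt0. Qed.

Lemma grid_vertexE g s k c :
  grid_vertex g s k 0 c = g 0 c + ((s^-1)%g c < k)%N%:R.
Proof.
rewrite !mxE summxE; congr (_ + _).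
have [ck|ck] := ltnP ((s^-1)%g c) k.
  rewrite (bigD1 ((s^-1)%g c))//= mxE permKV !eqxx big1 ?addr0// => i /andP[_ ic].
  by rewrite mxE eqxx /=; case: eqP => // ci; rewrite ci permK eqxx in ic.
apply: big1 => i ik; rewrite mxE eqxx /=; case: eqP => // ci.
by move: ck; rewrite ci permK leqNgt ik.
Qed.

(* A simplex either wraps around the torus, and then lies on the boundary of
   the cube, or is a simplex of the cube. *)
Lemma grid_vertexP g s :
  (forall k, M <= `|grid_point (grid_vertex g s k)|) \/
  (forall k, grid_point (grid_vertex g s k) = simplex_point (grid_point g) mesh s k).
Proof.
have [gN|/existsPn gN] := boolP [exists i, g 0 i == ord_max].
  left=> k; have /existsP[i /eqP gi] := gN.
  apply: le_trans (rV_norm_coord _ i); rewrite mxE grid_vertexE gi.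
  case: (_ < _)%N; last first.
    have E : N.+1%:R * mesh = 2 * M by rewrite mulrC divfK ?pnatr_eq0.
    rewrite addr0 /= E (_ : - M + 2 * M = M); last by ring.
    by rewrite gtr0_norm.
  have -> : (ord_max + 1%:R : 'I_N.+2) = 0.
    by apply/val_inj; rewrite /= modnDmr addn1 modnn.
  by rewrite mul0r addr0 normrN gtr0_norm.
right=> k; apply/rowP => i; rewrite simplex_pointE [LHS]mxE [X in _ = X + _]mxE grid_vertexE -addrA; congr (_ + _).
rewrite mulrC [X in _ = X + _]mulrC -mulrDr; congr (_ * _).
case: (_ < _)%N; last by rewrite !addr0.
rewrite -natrD; congr (_%:R).
have giN : (g 0%R i < N.+1)%N.
  rewrite ltn_neqAle -ltnS ltn_ord andbT; apply: contra (gN i) => /eqP giN.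
  by apply/eqP/val_inj.
by rewrite /= modn_small ?modn_small// ?addn1 ltnS.
Qed.

Lemma simplex_point_dist (q : 'rV[R]_m.+1) s k l :
  `|simplex_point q mesh s k - simplex_point q mesh s l| <= mesh.
Proof.
have h0 := mesh_gt0; apply: rV_norm_le => [|i]; first exact: ltW.
rewrite [X in `|X|]mxE [X in _ + X]mxE !simplex_pointE opprD addrACA subrr add0r -mulrBr normrM.
rewrite gtr0_norm//; apply: ler_piMr; first exact: ltW.
by case: (_ < k)%N; case: (_ < l)%N; rewrite ?subrr ?subr0 ?sub0r ?normrN ?normr1 ?normr0.
Qed.

Definition simplex_det (tau : G -> 'rV[R]_m.+1) g s : R :=
  \det (\matrix_(i < m.+1, j < m.+1) (tau (grid_vertex g s i.+1) 0 j -
                                      tau (grid_vertex g s i) 0 j)).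

Lemma sum_simplex_det (tau : G -> 'rV[R]_m.+1) :
  \sum_g \sum_(s : 'S_m.+1) (-1) ^+ s * simplex_det tau g s = 0.
Proof.
pose H (g : G) : 'rV[R]_m.+2 :=
  \row_j (if unlift ord0 j is Some i then tau g 0 i else 1).
have H1 g : H g 0 0 = 1 by rewrite mxE unlift_none.
rewrite -[RHS](torus_degree0 (fun i => delta_mx 0 i) H1).
apply: eq_bigr => g _; apply: eq_bigr => s _; congr (_ * _).
rewrite det_simplex_mx => [|j]; last by rewrite mxE H1.
by congr (\det _); apply/matrixP => i j; rewrite !mxE !liftK.
Qed.

Lemma simplex_det_const (tau : G -> 'rV[R]_m.+1) g s j c :
  (forall k, tau (grid_vertex g s k) 0 j = c) -> simplex_det tau g s = 0.
Proof.
move=> tc; rewrite /simplex_det (expand_det_col _ j) big1// => i _.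
by rewrite mxE !tc subrr mul0r.
Qed.

Lemma eq_simplex_det (tau tau' : G -> 'rV[R]_m.+1) g s :
  (forall k, tau (grid_vertex g s k) = tau' (grid_vertex g s k)) ->
  simplex_det tau g s = simplex_det tau' g s.
Proof.
by move=> tt'; congr (\det _); apply/matrixP => i j; rewrite !mxE !tt'.
Qed.

End grid.

(** * The degree of a labelling and its invariance *)

Section degree_of_labels.
Variable R : realType.

(** A coordinate of the label is 0 or 2 as soon as [f x] differs from [b] by at least [w] in it. *)
Definition label m (f : 'rV[R]_m -> 'rV[R]_m) b w x : 'rV[R]_m :=
  map_mx (@step R) (w^-1 *: (f x - b)).

(** A distance of 2w at [u] leaves at least [w] at [v], on the same side of [b]. *)
Lemma label_far m (f : 'rV[R]_m -> 'rV[R]_m) (b : 'rV[R]_m) w u v i :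
  0 < w -> 2 * w <= `|f u 0 i - b 0 i| -> `|f u - f v| <= w ->
  label f b w v 0 i = if 0 < f u 0 i - b 0 i then 2 else 0.
Proof.
move=> w0 wu uv; have := le_trans (rV_norm_coord _ i) uv; rewrite !mxE ler_norml => /andP[H1 H2].
case: ifPn => [p0|]; rewrite -?leNgt.
  apply: step_ge; rewrite mulrC ler_pdivlMr// mul1r; move: wu; rewrite gtr0_norm//; lra.
move=> n0; apply: step_le; rewrite mulrC ler_pdivrMr//; move: wu; rewrite ler0_norm//; lra.
Qed.

Lemma lt_rV_norm m (x : 'rV[R]_m) r : 0 <= r -> r < `|x| -> exists i, r < `|x 0 i|.
Proof.
move=> r0 rx; apply: contrapT => nx; move: rx; rewrite ltNge => /negP; apply.
by apply: rV_norm_le => // i; rewrite leNgt; apply/negP => xi; apply: nx; exists i.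
Qed.

Lemma grid_vertex0 m N (g : 'rV['I_N.+2]_m.+1) s : grid_vertex g s 0 = g.
Proof. by rewrite /grid_vertex /vertex big_pred0 ?addr0. Qed.

(** Each term is (m+1)! times the signed volume of the simplex spanned by the labels; a simplex is
    counted when its base vertex lies in [V]. The sum is an unnormalized degree of [f] over [V] at
    [b]. *)
Definition degree_sum m N M (V : set 'rV[R]_m.+1) (f : 'rV[R]_m.+1 -> 'rV[R]_m.+1) b w : R :=
  \sum_(g : 'rV['I_N.+2]_m.+1 | `[< V (grid_point M g) >])
    \sum_(s : 'S_m.+1) (-1) ^+ s * simplex_det (fun g => label f b w (grid_point M g)) g s.

Section degree_sum.
Variables (m N : nat) (M w : R) (V : set 'rV[R]_m.+1) (f : 'rV[R]_m.+1 -> 'rV[R]_m.+1).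
Hypotheses (M0 : 0 < M) (w0 : 0 < w) (VM : forall u, V u -> `|u| < M).
Hypothesis fw : forall u v, V u -> `|u - v| <= mesh N M -> `|f u - f v| <= w.

Local Notation pt := (grid_point M).

(** A simplex that wraps around the torus lies on the boundary of the cube, which [V] does not
    reach. *)
Lemma grid_simplex (g : 'rV['I_N.+2]_m.+1) s k : V (pt (grid_vertex g s k)) ->
  forall l, pt (grid_vertex g s l) = simplex_point (pt g) (mesh N M) s l.
Proof.
move=> Vk; case: (grid_vertexP M0 g s) => // wrap.
by have := VM Vk; rewrite ltNge wrap.
Qed.

Lemma label_const (g : 'rV['I_N.+2]_m.+1) s k (b : 'rV[R]_m.+1) i : V (pt (grid_vertex g s k)) ->
  2 * w <= `|f (pt (grid_vertex g s k)) 0 i - b 0 i| ->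
  forall l, label f b w (pt (grid_vertex g s l)) 0 i =
    if 0 < f (pt (grid_vertex g s k)) 0 i - b 0 i then 2 else 0.
Proof.
move=> Vk wk l; apply: label_far => //; apply: fw => //.
by rewrite !(grid_simplex Vk); exact: simplex_point_dist.
Qed.

(** Each simplex based in [V] has a coordinate in which its labels are constant, so its determinant
    vanishes. *)
Lemma degree_sum0 b : (forall u, V u -> 2 * w <= `|f u - b|) ->
  degree_sum N M V f b w = 0.
Proof.
move=> fb; apply: big1 => g /asboolP Vg; apply: big1 => s _.
have [i wi] : exists i, 2 * w <= `|f (pt g) 0 i - b 0 i|.
  apply: contrapT => ni; have := fb _ Vg; rewrite leNgt => /negP; apply.
  apply: rV_norm_lt => [|i]; first by rewrite mulr_gt0.
  by rewrite ltNge; apply/negP => wi; apply: ni; exists i; move: wi; rewrite !mxE.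
have H := @label_const g s 0%N b i; rewrite grid_vertex0 in H.
by rewrite (simplex_det_const (H Vg wi)) mulr0.
Qed.

(* Relabelling only the grid points of [V] changes no determinant outside of
   [V], because every simplex that meets both [V] and its complement has a
   constant coordinate; and the sum over the whole torus vanishes. *)
Lemma degree_sum_invariant y d rho b b' : 0 < d -> mesh N M < rho ->
  (forall u, V u -> `|f u - y| <= 2 * d -> ball u rho `<=` V) ->
  2 * w <= d -> `|b - y| <= d -> `|b' - y| <= d ->
  degree_sum N M V f b w = degree_sum N M V f b' w.
Proof.
move=> d0 hrho HV wd by_ b'y.
pose tau b (g : 'rV['I_N.+2]_m.+1) := label f b w (pt g).
pose mix g := if `[< V (pt g) >] then tau b' g else tau b g.
have key g s : simplex_det mix g s - simplex_det (tau b) g s =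
    if `[< V (pt g) >] then simplex_det (tau b') g s - simplex_det (tau b) g s else 0.
  have [[k Vk]|nV] := pselect (exists k, V (pt (grid_vertex g s k))); last first.
    rewrite asboolF; last by move=> Vg; apply: nV; exists 0%N; rewrite grid_vertex0.
    apply/eqP; rewrite subr_eq0; apply/eqP/eq_simplex_det => k.
    by rewrite /mix asboolF// => Vk; apply: nV; exists k.
  have [[l nVl]|nnV] := pselect (exists l, ~ V (pt (grid_vertex g s l))); last first.
    have Vl l : V (pt (grid_vertex g s l)) by apply: contrapT => nVl; apply: nnV; exists l.
    rewrite asboolT; last by have := Vl 0%N; rewrite grid_vertex0.
    by congr (_ - _); apply: eq_simplex_det => l; rewrite /mix asboolT.
  (* A simplex that leaves [V] has no vertex of [V] with [f] close to [y]. Hence some coordinate of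
     f - y exceeds 2d there, and in it the labels are constant, with the same value, for all centres
     within [d] of [y]. *)
  have fk : 2 * d < `|f (pt (grid_vertex g s k)) - y|.
    rewrite ltNge; apply/negP => /(HV _ Vk)/(_ (pt (grid_vertex g s l))) H; apply: nVl.
    apply: H; rewrite -ball_normE /ball_/= !(grid_simplex Vk).
    by apply: le_lt_trans hrho; exact: simplex_point_dist.
  have [i] := lt_rV_norm (mulr_ge0 (ler0n _ 2) (ltW d0)) fk; rewrite !mxE => fi.
  have cst c : `|c - y| <= d -> forall j, tau c (grid_vertex g s j) 0 i =
      if 0 < f (pt (grid_vertex g s k)) 0 i - y 0 i then 2 else 0.
    move=> cy j; have cyi : `|c 0 i - y 0 i| <= d.
      by have := le_trans (rV_norm_coord _ i) cy; rewrite !mxE.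
    have /andP[c1 c2] : - d <= c 0 i - y 0 i <= d by rewrite -ler_norml.
    have cfar : 2 * w <= `|f (pt (grid_vertex g s k)) 0 i - c 0 i|.
      move: fi; set F := f _ 0 i => fi.
      have := ler_normD (F - c 0 i) (c 0 i - y 0 i); rewrite subrKA => H1.
      lra.
    apply: etrans (label_const Vk cfar j) _.
    congr (if _ then _ else _); move: fi; set F := f _ 0 i.
    case: (ltrP 0 (F - y 0 i)) => Fy.
      by rewrite gtr0_norm// => fi; apply/idP; lra.
    by rewrite ler0_norm// => fi; apply/negbTE; rewrite -leNgt; lra.
  have mixc j : mix (grid_vertex g s j) 0 i =
      if 0 < f (pt (grid_vertex g s k)) 0 i - y 0 i then 2 else 0.
    by rewrite /mix; case: ifP => _; exact: cst.
  rewrite (simplex_det_const mixc) (simplex_det_const (cst b by_)) (simplex_det_const (cst b' b'y)).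
  by rewrite subrr if_same.
have := sum_simplex_det (tau b); have := sum_simplex_det mix => Hmix Hb.
have : \sum_g \sum_(s : 'S_m.+1) (-1) ^+ s * (simplex_det mix g s - simplex_det (tau b) g s) = 0.
  under eq_bigr do (under eq_bigr do rewrite mulrBr; rewrite sumrB).
  by rewrite sumrB Hmix Hb subrr.
rewrite (bigID (fun g => `[< V (pt g) >])) /= [X in _ + X]big1 => [|g /negbTE gV]; last first.
  by apply: big1 => s _; rewrite key gV mulr0.
rewrite addr0 /degree_sum => H; apply/esym/eqP; rewrite -subr_eq0 -sumrB -[X in _ == X]H.
apply/eqP/eq_bigr => g gV; rewrite -sumrB; apply: eq_bigr => s _.
by rewrite key gV mulrBr.
Qed.

End degree_sum.
End degree_of_labels.

(** * Positivity of the degree at a regular value *)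

Section degree_core.
Variable R : realType.

(** The grid refines by [T] a coarse one of [Q] cells per axis, and the fine points of the coarse
    cell that contains [x] lie in the ball. With [Q] fixed, the guaranteed proportion of grid points
    does not deteriorate as [T] grows. *)
Lemma card_grid_ball m Q T N M (x : 'rV[R]_m.+1) r : N.+1 = (Q * T)%N -> 0 < M ->
  `|x| < M -> 2 * M / Q%:R <= r ->
  (T ^ m.+1 <= #|[pred g : 'rV['I_N.+2]_m.+1 | `[< ball x r (grid_point M g) >]]|)%N.
Proof.
move=> NQT M0 xM Qr.
have /andP[Q0 T0] : (0 < Q)%N && (0 < T)%N by rewrite -muln_gt0 -NQT.
have QR0 : 0 < Q%:R :> R by rewrite ltr0n.
have TR0 : 0 < T%:R :> R by rewrite ltr0n.
have r0 : 0 < r by apply: lt_le_trans Qr; rewrite divr_gt0// mulr_gt0.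
pose v i := (x 0 i + M) * Q%:R / (2 * M).
have xi i : - M < x 0 i < M by rewrite -ltr_norml (le_lt_trans (rV_norm_coord _ _)).
have v0 i : 0 <= v i.
  by have /andP[? ?] := xi i; rewrite divr_ge0 ?mulr_ge0 ?ler0n//; lra.
have vQ i : (Num.truncn (v i) < Q)%N.
  rewrite truncn_lt_nat// /v mulrAC gtr_pMl// ltr_pdivrMr ?mulr_gt0// mul1r.
  by have /andP[? ?] := xi i; lra.
pose k (a : {ffun 'I_m.+1 -> 'I_T}) i := (Num.truncn (v i) * T + a i)%N.
have kN a i : (k a i < N.+2)%N.
  rewrite ltnS NQT /k (@leq_trans ((Num.truncn (v i)).+1 * T)%N)//.
    by rewrite mulSn addnC leq_add2r ltnW.
  by rewrite leq_mul2r vQ orbT.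
pose phi a : 'rV['I_N.+2]_m.+1 := \row_i inord (k a i).
have phi_inj : injective phi.
  move=> a b /rowP ab; apply/ffunP => i; apply/val_inj/eqP.
  have := congr1 val (ab i); rewrite !mxE /= !inordK// /k.
  by move/eqP; rewrite eqn_add2l.
have <- : #|codom phi| = (T ^ m.+1)%N by rewrite card_codom// card_ffun !card_ord.
apply/subset_leq_card/fintype.subsetP => _ /codomP[a ->]; rewrite inE; do 2!apply/asboolP.
apply/(rV_ballE _ _ r0) => i; rewrite !mxE inordK//; apply: lt_le_trans Qr.
have -> : mesh N M = 2 * M / Q%:R * T%:R^-1.
  by rewrite /mesh NQT natrM invfM mulrA.
set e := 2 * M / Q%:R; have e0 : 0 < e by rewrite divr_gt0// mulr_gt0.
have -> : x 0 i = - M + v i * e.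
  by rewrite /v /e; field; rewrite !gt_eqF.
rewrite /k natrD natrM.
have -> : - M + v i * e - (- M + ((Num.truncn (v i))%:R * T%:R + (a i)%:R) * (e / T%:R)) =
    (v i - (Num.truncn (v i))%:R - (a i)%:R / T%:R) * e.
  by field; rewrite gt_eqF.
rewrite normrM (gtr0_norm e0) gtr_pMl//.
have /andP[] := truncn_itv (v0 i); rewrite -natr1 => H1 H2.
have a0 : 0 <= (a i)%:R / T%:R :> R by rewrite divr_ge0.
have a1 : (a i)%:R / T%:R < 1 :> R by rewrite ltr_pdivrMr// mul1r ltr_nat.
by rewrite ltr_norml; apply/andP; split; lra.
Qed.

(** Labelling multiplies the determinant by a power of 1/w and by values of [dstep], which are
    nonnegative, and equal to 2 where [f u] is [b]. *)
Lemma label_strict_diff m (f : 'rV[R]_m -> 'rV[R]_m) b w u A (sg : bool) : 0 < w ->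
  strict_diff f u A -> exists B, [/\ strict_diff (label f b w) u B,
    0 <= (-1) ^+ sg * \det A -> 0 <= (-1) ^+ sg * \det B &
    f u = b -> 0 < (-1) ^+ sg * \det A -> 0 < (-1) ^+ sg * \det B].
Proof.
move=> w0 fA; have := strict_diff_step (strict_diff_affine b w^-1 fA).
set B := _ *m _ => fB; exists B.
have BE : (-1) ^+ sg * \det B = ((-1) ^+ sg * \det A) * ((w^-1) ^+ m *
    \prod_i dstep (w^-1 * (f u 0 i - b 0 i))).
  rewrite /B det_mulmx detZ det_diag -!mulrA; congr (_ * _).
  rewrite mulrCA; congr (_ * (_ * _)).
  by apply: eq_bigr => i _; rewrite !mxE.
have w1 : 0 < w^-1 ^+ m by rewrite exprn_gt0// invr_gt0.
split=> [//|A0|fub A0]; rewrite BE.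
  apply: mulr_ge0 => //; apply: mulr_ge0; first exact: ltW.
  by apply: prodr_ge0 => i _; exact: dstep_ge0.
rewrite mulr_gt0// mulr_gt0// prodr_gt0// => i _.
by rewrite fub subrr mulr0 dstep0.
Qed.


Lemma archi_lt (x y : R) : 0 < y -> exists2 k : nat, (0 < k)%N & x / k%:R < y.
Proof.
move=> y0; exists (Num.truncn (x / y)).+1 => //.
by rewrite ltr_pdivrMr ?ltr0n// mulrC -ltr_pdivrMr// truncnS_gt.
Qed.

(* If [y2] were not a value of [f] on [V], its degree over [V] would vanish,
   whereas the degree of [f x1] is positive. *)
Theorem degree_surjective m (f : 'rV[R]_m.+1 -> 'rV[R]_m.+1) V y d rho x1 y2
    (sg : bool) w0 A1 :
  compact V -> continuous f -> 0 < d -> 0 < rho ->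
  (forall u, V u -> `|f u - y| <= 2 * d -> ball u rho `<=` V) ->
  V x1 -> `|f x1 - y| <= d -> `|y2 - y| <= d -> 0 < w0 ->
  (forall u, V u -> `|f u - f x1| <= w0 ->
    exists2 A, strict_diff f u A & 0 <= (-1) ^+ sg * \det A) ->
  strict_diff f x1 A1 -> 0 < (-1) ^+ sg * \det A1 ->
  exists2 u, V u & f u = y2.
Proof.
move=> cV fc d0 rho0 HV Vx1 fx1y y2y w00 Vdet fA1 A10.
apply: contrapT => nV.
have [gam gam0 Vgam] : exists2 c, 0 < c & forall u, V u -> c <= `|f u - y2|.
  by apply: compact_gap => // u Vu fu; apply: nV; exists u.
have [M M0 VM] : exists2 M, 0 < M & forall u, V u -> `|u| < M.
  have [M' [_ VM']] := compact_bounded cV; exists (Num.max 0 M' + 2).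
    by rewrite ltr_wpDl// le_max lexx.
  move=> u Vu; apply: (@le_lt_trans _ _ (Num.max 0 M' + 1)); last by rewrite ltrD2l ltr1n.
  apply: VM' => //; apply: (@le_lt_trans _ _ (Num.max 0 M')); first by rewrite le_max lexx orbT.
  by rewrite ltrDl.
(* The width is below a quarter of every margin: the range [w0] where the sign is known, the range
   [d] of invariance, and the gap [gam] around [y2]. *)
pose w := Num.min w0 (Num.min d gam) / 4.
have mn0 : 0 < Num.min w0 (Num.min d gam) by rewrite !lt_min w00 d0.
have w_gt0 : 0 < w by rewrite divr_gt0.
have w4 : 4 * w = Num.min w0 (Num.min d gam) by rewrite /w mulrC divfK.
have w4w0 : 4 * w <= w0 by rewrite w4 ge_min lexx.
have w4d : 4 * w <= d by rewrite w4 !ge_min lexx orbT.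
have w4gam : 4 * w <= gam by rewrite w4 !ge_min lexx !orbT.
have [r1 r10 fr1] := compact_uniform_continuous cV fc w_gt0.
pose tau := label f (f x1) w.
have [B1 [tauB1 _ B10]] := label_strict_diff (f x1) sg w_gt0 fA1.
have {}B10 := B10 erefl A10; set c1 := _ * _ in B10.
have c20 : 0 < c1 / 2 by rewrite divr_gt0.
have [r3 r30 fr3] := det_strict_diff tauB1 c20.
(* [Q] is fixed before the error [e] and the refinement [T], since [e] depends on it. *)
have [Q Q0 Qr] : exists2 Q : nat, (0 < Q)%N & 2 * M / Q%:R < Num.min r3 rho.
  by apply: archi_lt; rewrite lt_min r30.
(* At most (2 Q T)^n base points cost [e] each, in total c1/4 times T^n, less than the gain of c1/2
   at each of at least T^n points near [x1]. *)
pose n := m.+1; pose e := c1 / 4 / (2 * Q%:R) ^+ n.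
have QR0 : 0 < Q%:R :> R by rewrite ltr0n.
have e0 : 0 < e by rewrite !divr_gt0// exprn_gt0// mulr_gt0.
have signM (s : 'S_n) (x : R) : `|(-1) ^+ sg * x| = `|x| by rewrite normrMsign.
have [r2 r20 fr2] : exists2 r, 0 < r & forall q h, V q -> 0 < h < r ->
    `|f q - f x1| <= 2 * w -> forall s : 'S_n, - (e * h ^+ n) <= (-1) ^+ sg *
      ((-1) ^+ s * \det (\matrix_(i < n, j < n) (tau (simplex_point q h s i.+1) 0 j -
        tau (simplex_point q h s i) 0 j))).
  apply: (compact_uniform (P := fun q h => `|f q - f x1| <= 2 * w -> forall s : 'S_n,
    - (e * h ^+ n) <= _) cV) => u Vu.
  have [fuw|fuw] := leP (`|f u - f x1|) w0; last first.
    have /cvgrPdist_lt/(_ _ w_gt0)/nbhs_ballP[r /= r0 ur] := fc u.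
    exists r => // q h uq _ fq; exfalso.
    have := ur q uq; have := ler_normD (f u - f q) (f q - f x1); rewrite subrKA; lra.
  have [A fA Age0] := Vdet u Vu fuw.
  have [B [tauB Bge0 _]] := label_strict_diff (f x1) sg w_gt0 fA.
  have [r r0 fr] := det_strict_diff tauB e0; exists r => // q h uq hr _ s.
  have h0 : 0 < h by case/andP: hr.
  have := fr q h s uq hr; rewrite -(signM s) mulrBr ler_norml => /andP[H _].
  have := mulr_ge0 (exprn_ge0 n (ltW h0)) (Bge0 Age0); rewrite mulrCA.
  by move: H; rewrite /tau; set a := _ * (_ * \det _); set b := _ * (_ * \det B); lra.
have [T T0 Tr] : exists2 T : nat, (0 < T)%N &
    2 * M / T%:R < Num.min (Num.min r1 r2) (Num.min r3 rho).
  by apply: archi_lt; rewrite !lt_min r10 r20 r30.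
have TR0 : 0 < T%:R :> R by rewrite ltr0n.
pose N := (Q * T).-1; have NQT : N.+1 = (Q * T)%N by rewrite prednK// muln_gt0 Q0.
have h0 : 0 < mesh N M by exact: mesh_gt0.
have : mesh N M < Num.min (Num.min r1 r2) (Num.min r3 rho).
  apply: le_lt_trans Tr; rewrite /mesh NQT; apply: ler_wpM2l; first by rewrite mulr_ge0// ltW.
  by rewrite lef_pV2 ?posrE ?ltr0n ?muln_gt0 ?Q0// ler_nat leq_pmull.
rewrite !lt_min => /andP[/andP[hr1 hr2] /andP[hr3 hrho]].
have fw u v : V u -> `|u - v| <= mesh N M -> `|f u - f v| <= w.
  move=> Vu uv; apply/ltW/fr1 => //; rewrite -ball_normE /ball_/=.
  exact: le_lt_trans uv hr1.
have S2 : degree_sum N M V f y2 w = 0.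
  apply: degree_sum0 => // u Vu; apply: le_trans (Vgam u Vu); lra.
have : degree_sum N M V f (f x1) w = degree_sum N M V f y2 w.
  by apply: (degree_sum_invariant M0 w_gt0 VM fw d0 hrho HV _ fx1y y2y); lra.
rewrite S2 => S1.
pose G := 'rV['I_N.+2]_m.+1; pose pt : G -> _ := grid_point M.
pose near (g : G) := `[< ball x1 (Num.min r3 rho) (pt g) >].
have near_le g : near g -> V (pt g).
  move=> /asboolP xg; apply: (HV x1 Vx1); first by lra.
  by apply: le_ball xg; rewrite ge_min lexx orbT.
pose lab (g : G) := label f (f x1) w (pt g).
(* Near [x1] the determinant is positive by a fixed amount; elsewhere it is at least [-e], in units
   of h^n, if [f] is within 2w of [f x1], and it is 0 otherwise. *)
have low (g : G) (s : 'S_n) : V (pt g) -> mesh N M ^+ n * ((near g)%:R * (c1 / 2) - e) <=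
    (-1) ^+ sg * ((-1) ^+ s * simplex_det lab g s).
  move=> Vg; have Vg0 : V (pt (grid_vertex g s 0)) by rewrite grid_vertex0.
  have sE : simplex_det lab g s =
      \det (\matrix_(i < n, j < n) (tau (simplex_point (pt g) (mesh N M) s i.+1) 0 j -
        tau (simplex_point (pt g) (mesh N M) s i) 0 j)).
    by congr (\det _); apply/matrixP => i j; rewrite !mxE /pt !(grid_simplex M0 VM Vg0).
  have hn0 : 0 < mesh N M ^+ n by rewrite exprn_gt0.
  case: (boolP (near g)) => [/asboolP xg|_].
    have := fr3 (pt g) (mesh N M) s; rewrite h0 hr3 => /(_ _ isT) H.
    have {}H : `|(-1) ^+ s * simplex_det lab g s -
        mesh N M ^+ n * \det B1| <= c1 / 2 * mesh N M ^+ n.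
      by rewrite sE; apply: H; apply: le_ball xg; rewrite ge_min lexx.
    move: H; rewrite -(signM s) mulrBr ler_norml => /andP[H _].
    rewrite mul1r mulrBr; have : 0 <= mesh N M ^+ n * e by rewrite mulr_ge0// ltW.
    move: H; rewrite [_ * (_ * \det B1)]mulrCA -/c1.
    set a := _ * (_ * simplex_det _ _ _); set b := mesh _ _ ^+ _; lra.
  rewrite mul0r sub0r mulrN mulrC.
  have [fg|fg] := leP (`|f (pt g) - f x1|) (2 * w).
    by rewrite sE; apply: fr2 => //; rewrite h0.
  have [i] := lt_rV_norm (mulr_ge0 (ler0n _ 2) (ltW w_gt0)) fg; rewrite !mxE => fi.
  have H := @label_const R m N M w V f M0 w_gt0 VM fw g s 0%N (f x1) i Vg0.
  rewrite grid_vertex0 in H.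
  rewrite (simplex_det_const (H (ltW fi))) !mulr0 oppr_le0 mulr_ge0// ltW//.
have hn0 : 0 < mesh N M ^+ n by rewrite exprn_gt0.
have : \sum_(g : G | `[< V (pt g) >]) \sum_(s : 'S_n)
    mesh N M ^+ n * ((near g)%:R * (c1 / 2) - e) <= 0.
  apply: (@le_trans _ _ ((-1) ^+ sg * degree_sum N M V f (f x1) w)); last by rewrite S1 mulr0.
  rewrite /degree_sum mulr_sumr.
  apply: ler_sum => g /asboolP Vg; rewrite mulr_sumr; apply: ler_sum => s _.
  exact: low.
under eq_bigr do rewrite sumr_const.
rewrite sumrMnl pmulrn_lle0; last by apply/card_gt0P; exists 1%g.
rewrite -mulr_sumr pmulr_rle0// sumrB -mulr_suml -natr_sum sumr_const subr_le0.
have nearT : (T ^ n <= \sum_(g : G | `[< V (pt g) >]) near g)%N.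
  apply: leq_trans (card_grid_ball NQT M0 (VM _ Vx1) (ltW Qr)) _.
  rewrite -sum1_card big_mkcond [leqRHS]big_mkcond; apply: leq_sum => g _.
  rewrite inE -/(near g); case: (boolP (near g)) => // /near_le Vg.
  by rewrite asboolT.
have VT : (#|[pred g : G | `[< V (pt g) >]]| <= (2 * Q * T) ^ n)%N.
  apply: leq_trans (max_card _) _; rewrite card_mx card_ord mul1n leq_exp2r//.
  by rewrite NQT -mulnA mul2n -addnn -addn1 leq_add2l muln_gt0 Q0.
apply/negP; rewrite -ltNge -(mulr_natr e).
apply: (@le_lt_trans _ _ (e * (2 * Q * T)%:R ^+ n)).
  by apply: ler_wpM2l; [exact: ltW|rewrite -natrX ler_nat].
apply: (@lt_le_trans _ _ ((T ^ n)%:R * (c1 / 2))).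
  rewrite natrX !natrM exprMn [e * _]mulrA /e divfK ?expf_neq0 ?mulf_neq0 ?pnatr_eq0 -?lt0n//.
  by rewrite mulrC ltr_pM2l ?exprn_gt0//; lra.
by apply: ler_wpM2r; [exact: ltW|rewrite ler_nat].
Qed.

End degree_core.

(** * Isolating a component of a fibre *)

Section component.
Variables (R : realType) (n : nat).
Implicit Types (X K : set 'rV[R]_n) (x y z : 'rV[R]_n).

(* The points of [X] that a chain of points of [X] with steps shorter than
   [h] joins to [x]. *)
Definition chain_component X x h : set 'rV[R]_n :=
  [set y | forall S : set 'rV[R]_n, S x ->
    (forall u v, S u -> X v -> ball u h v -> S v) -> S y].

Lemma chain_component_refl X x h : chain_component X x h x.
Proof. by move=> S. Qed.

Lemma chain_component_sub X x h : X x -> chain_component X x h `<=` X.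
Proof. by move=> Xx y; apply. Qed.

Lemma chain_component_step X x h u v :
  chain_component X x h u -> X v -> ball u h v -> chain_component X x h v.
Proof. by move=> xu Xv uv S Sx Sstep; apply: (Sstep u) => //; exact: xu. Qed.

Lemma chain_componentW X x h k : h <= k ->
  chain_component X x h `<=` chain_component X x k.
Proof.
move=> hk y xy S Sx Sstep; apply: xy => // u v Su Xv uv.
by apply: (Sstep u) => //; exact: le_ball uv.
Qed.

(** A chain that ends close to a point of [L] can be prolonged to it, so being out of reach is an
    open condition on [L], and compactness makes the step uniform. *)
Lemma chain_component_avoid X x L : compact L -> L `<=` X ->
  (forall z, L z -> exists2 h, 0 < h & ~ chain_component X x h z) ->
  exists2 h, 0 < h & forall z k, 0 < k < h -> L z -> ~ chain_component X x k z.
Proof.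
move=> cL LX Lh.
have [z Lz|r r0 rP] := @compact_uniform R n L (fun z h => ~ chain_component X x h z) cL.
  have [h h0 nxz] := Lh z Lz; exists h => // u k zu /andP[k0 kh] xu; apply: nxz.
  apply: (chain_component_step (u := u)); [|exact: LX|exact: ball_sym].
  exact: chain_componentW (ltW kh) _ xu.
by exists r => // z k kr Lz; exact: rP.
Qed.

Definition thicken (B : set 'rV[R]_n) r : set 'rV[R]_n := \bigcup_(z in B) ball z r.

Lemma open_thicken B r : open (thicken B r).
Proof. by apply: bigcup_open => z _; exact: ball_open. Qed.

Lemma subset_thicken B r : 0 < r -> B `<=` thicken B r.
Proof. by move=> r0 z Bz; exists z => //; exact: ballxx. Qed.

(** Disjoint compact pieces have disjoint thickenings. Chains with small steps avoid the part of [X]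
    outside of both and cannot jump across, so those from [x] never come near [B2]. *)
Lemma quasi_component_split X x B1 B2 : compact X -> X x -> closed B1 -> closed B2 ->
  B1 x -> (forall z, B1 z -> B2 z -> False) ->
  [set z | forall h, 0 < h -> chain_component X x h z] = B1 `|` B2 -> B2 = set0.
Proof.
move=> cX Xx clB1 clB2 B1x B12 QE.
have QX z : (B1 `|` B2) z -> X z.
  by rewrite -QE => /(_ _ ltr01); exact: chain_component_sub.
have cB1 : compact B1 by apply: (subclosed_compact clB1 cX) => z ?; apply: QX; left.
have [z B1z|r r0 B1r] := @compact_open_uniform R n B1 (~` B2) cB1.
  have /nbhs_ballP[r /= r0 zr] : nbhs z (~` B2).
    by apply: open_nbhs_nbhs; split; [exact: closed_openC|exact: B12].
  by exists r.
(* The pieces are at least [r] apart; two thickenings and one step of a chain take a third each. *)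
have r30 : 0 < r / 3 by rewrite divr_gt0.
pose U1 := thicken B1 (r / 3); pose U2 := thicken B2 (r / 3).
pose L := X `&` ~` (U1 `|` U2).
have cL : compact L.
  apply: (subclosed_compact _ cX); last by move=> z [].
  apply: closedI; first exact: compact_closed cX.
  by apply: open_closedC; apply: openU; exact: open_thicken.
have [z [Xz nUz]|h h0 Lh] := chain_component_avoid (x := x) cL (fun z => @proj1 _ _).
  apply: contrapT => nh; apply: nUz.
  suff [Bz|Bz] : (B1 `|` B2) z by [left; exact: subset_thicken|right; exact: subset_thicken].
  by rewrite -QE => k k0; apply: contrapT => nk; apply: nh; exists k.
pose k := Num.min h (r / 3) / 2.
have mn0 : 0 < Num.min h (r / 3) by rewrite lt_min h0.
have k0 : 0 < k by rewrite divr_gt0.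
have kmn : k < Num.min h (r / 3) by rewrite ltr_pdivrMr// ltr_pMr// ltr1n.
move: kmn; rewrite lt_min => /andP[kh kr].
have kU1 z : chain_component X x k z -> U1 z.
  move=> /(_ (U1 `&` chain_component X x k)); case.
  - by split; [exact: subset_thicken|exact: chain_component_refl].
  - move=> u v [U1u xu] Xv uv; have xv := chain_component_step xu Xv uv.
    split=> //; apply: contrapT => nU1v; apply: (Lh v k) => //; first by rewrite k0.
    split=> // -[//|[z2 B2z2 z2v]]; have [z1 B1z1 z1u] := U1u.
    apply: (B1r z1 B1z1 z2) => //; apply: (@le_ball _ _ z1 (r / 3 + r / 3 + r / 3)); first by lra.
    apply: ball_triangle (ball_sym z2v); apply: ball_triangle z1u _.
    by apply: le_ball uv; exact: ltW.
  - by [].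
apply/seteqP; split=> // z B2z.
have : chain_component X x k z.
  have : (B1 `|` B2) z by right.
  by rewrite -QE; exact.
move=> /kU1[z1 B1z1 z1z]; apply: (B1r z1 B1z1 z) => //.
by apply: le_ball z1z; lra.
Qed.

(** The intersection [Q] of all chain components of [x] is connected, hence inside [O]. The compact
    rest of [X] is then out of reach of chains with small steps, and [K] is the chain component for
    such a step. *)
Lemma component_isolation X x (O : set 'rV[R]_n) : compact X -> X x -> open O ->
  connected_component X x `<=` O ->
  exists K h, [/\ 0 < h, K x, K `<=` X, K `<=` O &
    forall y z, K y -> X z -> ball y h z -> K z].
Proof.
move=> cX Xx oO CO; pose Q := [set z | forall h, 0 < h -> chain_component X x h z].
have clX : closed X by exact: compact_closed cX.
have QX : Q `<=` X by move=> z /(_ _ ltr01); exact: chain_component_sub.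
have Qx : Q x by move=> h _; exact: chain_component_refl.
have clQ : closed Q.
  move=> z clz h h0; have [y [Qy zy]] := clz _ (nbhsx_ballx z _ h0).
  apply: (chain_component_step (Qy h h0)); last exact: ball_sym.
  by apply: clX; apply: closureS clz.
have coQ : connected Q.
  move=> B [b Bb] [U oU BU] [F cF BF].
  have clB : closed B by rewrite BF; exact: closedI.
  have clB' : closed (Q `&` ~` U) by apply: closedI => //; exact: open_closedC.
  have BB' z : B z -> (Q `&` ~` U) z -> False by rewrite BU => -[_ Uz] [_].
  have QE : Q = B `|` (Q `&` ~` U).
    rewrite BU; apply/seteqP; split=> z; last by case=> -[].
    by move=> Qz; have [Uz|nUz] := pselect (U z); [left|right].
  have [Bx|nBx] := pselect (B x).
    by rewrite QE (quasi_component_split cX Xx clB clB' Bx BB' QE) setU0.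
  have B'x : (Q `&` ~` U) x by move: Qx; rewrite {1}QE => -[].
  have QE' : Q = (Q `&` ~` U) `|` B by rewrite setUC.
  have B0 := quasi_component_split cX Xx clB' clB B'x (fun z b' b => BB' z b b') QE'.
  by move: Bb; rewrite B0.
have QO : Q `<=` O by apply: subset_trans CO; exact: connected_component_max.
have cL : compact (X `&` ~` O).
  apply: (subclosed_compact _ cX); last by move=> z [].
  by apply: closedI => //; exact: open_closedC.
have [z [Xz nOz]|h h0 Lh] := chain_component_avoid (x := x) cL (fun z => @proj1 _ _).
  apply: contrapT => nh; apply/nOz/QO => k k0.
  by apply: contrapT => nk; apply: nh; exists k.
have h20 : 0 < h / 2 by rewrite divr_gt0.
exists (chain_component X x (h / 2)), (h / 2); split=> //.
- exact: chain_component_sub.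
- move=> z xz; apply: contrapT => nOz; apply: (Lh z (h / 2)) => //.
    by apply/andP; split=> //; lra.
  by split=> //; exact: chain_component_sub xz.
- by move=> y z xy Xz yz; exact: chain_component_step yz.
Qed.

(** [V] is a closed thickening of [K] by [q]: 2q <= h keeps the other points of [X] out, and 2q <= r
    keeps [V] inside [O]. *)
Lemma isolating_set X K h (O : set 'rV[R]_n) : 0 < h -> compact X -> K `<=` X ->
  open O -> K `<=` O -> (forall y z, K y -> X z -> ball y h z -> K z) ->
  exists V r, [/\ 0 < r, compact V, V `<=` O, V `&` X `<=` K &
    forall z, K z -> ball z r `<=` V].
Proof.
move=> h0 cX KX oO KO Kh.
have clK : closed K.
  move=> z clz; have [y [Ky zy]] := clz _ (nbhsx_ballx z _ h0).
  apply: (Kh y) => //; last exact: ball_sym.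
  by apply: (compact_closed _ cX) => //; apply: closureS clz.
have cK : compact K by exact: subclosed_compact clK cX KX.
have [z Kz|r r0 Kr] := @compact_open_uniform R n K O cK.
  by have /nbhs_ballP[r /= r0 zr] := open_nbhs_nbhs (conj oO (KO z Kz)); exists r.
pose q := Num.min h r / 2.
have mn0 : 0 < Num.min h r by rewrite lt_min h0.
have q0 : 0 < q by rewrite divr_gt0.
have q2 : q + q = Num.min h r by rewrite /q -splitr.
have qh : q + q <= h by rewrite q2 ge_min lexx.
have qr : q + q <= r by rewrite q2 ge_min lexx orbT.
have Vq v : closure (thicken K q) v -> exists2 z, K z & ball z (q + q) v.
  move=> /(_ _ (nbhsx_ballx v _ q0))[u [[z Kz zu] vu]]; exists z => //.
  exact: ball_triangle zu (ball_sym vu).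
exists (closure (thicken K q)), q; split=> //.
- apply: bounded_closed_compact; last exact: closed_closure.
  have [M [Mreal KM]] := compact_bounded cK.
  exists (M + 1 + h); split; first exact: num_real.
  move=> t Mt v /Vq[z Kz zv].
  have := KM (M + 1); rewrite ltrDl ltr01 => /(_ isT z Kz) /= zM.
  move: zv; rewrite -ball_normE /ball_/= => zv.
  by have := ler_normD z (v - z); rewrite subrKC distrC in zv *; lra.
- by move=> v /Vq[z Kz zv]; apply: (Kr z Kz); exact: le_ball zv.
- by move=> v [/Vq[z Kz zv] Xv]; apply: (Kh z) => //; exact: le_ball zv.
- by move=> z Kz v zv; apply: subset_closure; exists z.
Qed.

End component.

(** * From the degree to interior points and surjectivity *)

Section assembly.
Variables (R : realType) (D : forall n : nat, set (set 'rV[R]_n)).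
Hypothesis D_ominimal : ominimal D.

Lemma definable_map_dfun m n (f : 'rV[R]_m -> 'rV[R]_n) :
  definable_map D f -> dfun D f.
Proof.
rewrite /definable_map; congr (D _); apply/seteqP; split=> v /=.
  by move=> [x _ <-]; rewrite row_mxKl row_mxKr.
by move=> vE; exists (lsubmx v) => //; rewrite -vE hsubmxK.
Qed.

Lemma thin_image_no_ball m N : forall (F : 'rV[R]_m.+1 -> 'rV[R]_N) S,
  dfun D F -> dset D S -> no_ball S -> thin m (F @` S).
Proof. rewrite -[m.+1]addn1; exact: thin_dfun_no_ball. Qed.

End assembly.

Section expansion.
Variable R : realType.

(** The linear part expands by at least 1/C, and the strict error 1/(2C) consumes half of that. *)
Lemma strict_diff_expanding n (f : 'rV[R]_n -> 'rV[R]_n) x A :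
  strict_diff f x A -> \det A != 0 -> exists r c, [/\ 0 < r, 0 < c &
    forall y z, ball x r y -> ball x r z -> c * `|y - z| <= `|f y - f z|].
Proof.
move=> fA A0; have [C C0 AC] := rV_mulmx_bound (invmx A).
have C20 : 0 < (2 * C)^-1 by rewrite invr_gt0 mulr_gt0.
have [r r0 fr] := fA _ C20; exists r, (2 * C)^-1; split=> // y z xy xz.
have vA : `|y - z| <= C * `|(y - z) *m A|.
  apply: le_trans (AC _); rewrite -mulmxA mulmxV ?mulmx1//.
  by rewrite unitmxE unitfE.
have H1 : 2 * (2 * C)^-1 * `|y - z| <= `|(y - z) *m A|.
  by rewrite invfM mulrA mulfV// mul1r mulrC ler_pdivrMr// mulrC.
have := ler_normD (f y - f z) ((y - z) *m A - (f y - f z)); rewrite subrKC.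
have := fr y z xy xz; rewrite distrC; lra.
Qed.

(** Along a kernel vector [f] would move by less than [c] times the increment. This carries
    regularity from one point to its neighbours. *)
Lemma expanding_det n (f : 'rV[R]_n -> 'rV[R]_n) x A r c : strict_diff f x A ->
  0 < r -> 0 < c ->
  (forall y z, ball x r y -> ball x r z -> c * `|y - z| <= `|f y - f z|) ->
  \det A != 0.
Proof.
move=> fA r0 c0 fc; apply/det0P => -[v v0 vA].
have [|d d0 fd] := fA (c / 2); first by rewrite divr_gt0.
have nv0 : 0 < `|v| by rewrite normr_gt0.
pose t := Num.min d r / 2 / `|v|.
have mn0 : 0 < Num.min d r by rewrite lt_min d0.
have t0 : 0 < t by rewrite !divr_gt0.
have tv : `|t *: v| = Num.min d r / 2.
  by rewrite normrZ gtr0_norm// /t divfK// gt_eqF.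
have xt s : Num.min d r <= s -> ball x s (x + t *: v).
  move=> ms; rewrite -ball_normE /ball_/= opprD addrA subrr sub0r normrN tv.
  by apply: lt_le_trans ms; rewrite ltr_pdivrMr// ltr_pMr// ltr1n.
have H1 := fd _ _ (xt d _) (ballxx x d0); have H2 := fc _ _ (xt r _) (ballxx x r0).
move: H1 H2; rewrite !ge_min !lexx orbT => /(_ isT) + /(_ isT).
have -> : x + t *: v - x = t *: v by rewrite addrAC subrr add0r.
rewrite -scalemxAl vA scaler0 subr0 => H1 H2.
have : 0 < `|t *: v| by rewrite tv divr_gt0.
have := le_trans H2 H1; set q := `|t *: v|; nra.
Qed.

End expansion.

Section main.
Variables (R : realType) (D : forall n : nat, set (set 'rV[R]_n)).
Hypothesis D_ominimal : ominimal D.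

Lemma quasi_interior_succ m (f : 'rV[R]_m.+1 -> 'rV[R]_m.+1) (sg : bool) :
  proper_map f -> continuous f -> dfun D f ->
  (forall x, ~ nonC1 f x -> 0 <= (-1) ^+ sg * \det (dmx f x)) ->
  measure_zero (critical f) -> quasi_interior f.
Proof.
move=> fp fc df fdet fcrit y x O fxy _ oO CO.
have cX : compact (f @^-1` [set y]) by apply: fp; exact: compact_set1.
have [K [h [h0 Kx KX KO Kh]]] := component_isolation cX fxy oO CO.
have [V [r [r0 cV VO VX Kr]]] := isolating_set h0 cX KX oO KO Kh.
(* Points of [V] where [f] is close to [y] lie well inside [V]: near [K] because [V] contains
   uniform balls around [K], and elsewhere because [f] stays away from [y]. *)
have [z Vz|h1 h10 Vh1] := @compact_uniform R _ V
    (fun u k => `|f u - y| <= k -> ball u k `<=` V) cV.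
  have [fzy|fzy] := eqVneq (f z) y.
    have Kz : K z by apply: VX; split.
    exists (r / 2); first by rewrite divr_gt0.
    move=> u k zu /andP[k0 kr] _ v uv; apply: (Kr z Kz).
    by apply: (@le_ball _ _ z (r / 2 + k)); [lra|exact: ball_triangle zu uv].
  have e0 : 0 < `|f z - y| / 2 by rewrite divr_gt0// normr_gt0 subr_eq0.
  have /cvgrPdist_lt/(_ _ e0)/nbhs_ballP[s /= s0 zs] := fc z.
  exists (Num.min s (`|f z - y| / 2)); first by rewrite lt_min s0.
  move=> u k zu; rewrite lt_min => /andP[k0 /andP[_ kz]] fuy; exfalso.
  have := zs u (le_ball _ zu); rewrite ge_min lexx => /(_ isT) H.
  have := ler_normD (f z - f u) (f u - y); rewrite subrKA; lra.
pose h2 := h1 / 2; have h20 : 0 < h2 by rewrite divr_gt0.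
have Vh2 u : V u -> `|f u - y| <= h2 -> ball u h2 `<=` V.
  by move=> Vu; apply: Vh1 => //; rewrite h20 /h2; lra.
pose d := h2 / 2; have d0 : 0 < d by rewrite divr_gt0.
have d2 : 2 * d = h2 by rewrite /d mulrC divfK.
pose G : set 'rV[R]_m.+1 := [set u | exists2 s, 0 < s & forall v, ball u s v ->
    forall j, exists L, strict_grad (fun z => f z 0 j) v L].
have dG : dset D G by exact: dset_strict_grad_near.
have nG : no_ball (~` G).
  move=> u s s0 us; have [v uv Gv] := dfun_generic_strict_near D_ominimal u s0 df.
  exact: (us v uv).
have GA u : G u -> exists2 A, strict_diff f u A &
    [/\ dmx f u = A^T, C1_at f u & 0 <= (-1) ^+ sg * \det A].
  move=> [s s0 us].
  have [A uA] := strict_diff_grad (us u (ballxx _ s0)); exists A => //.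
  have dA : dmx f u = A^T by rewrite /dmx (strict_diff_differential uA).2.
  have C1u : C1_at f u.
    apply: (strict_diff_C1 s0) => v uv; exact: strict_diff_grad (us v uv).
  by split=> //; rewrite -det_tr -dA; apply: fdet; move=> /(_ C1u).
have oG : open G.
  rewrite openE => u [s s0 us]; apply/nbhs_ballP; exists (s / 2) => /=.
    by rewrite divr_gt0.
  move=> v uv; exists (s / 2); first by rewrite divr_gt0.
  move=> w vw; apply: us; apply: (@le_ball _ _ u (s / 2 + s / 2)); first by lra.
  exact: ball_triangle uv vw.
have thS := thin_image_no_ball D_ominimal df (dset_not D_ominimal dG) nG.
have [r1 r10 xr1] : exists2 r1, 0 < r1 & ball x r1 `<=` V `&` [set u | `|f u - y| <= d].
  have /cvgrPdist_lt/(_ _ d0)/nbhs_ballP[s /= s0 xs] := fc x.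
  exists (Num.min r s); first by rewrite lt_min r0.
  move=> u xu; split; first by apply: (Kr x Kx); apply: le_ball xu; rewrite ge_min lexx.
  rewrite /= distrC -fxy ltW//; apply: xs; apply: le_ball xu.
  by rewrite ge_min lexx orbT.
have [x' xx' Gx'] : exists2 x', ball x r1 x' & G x'.
  apply: contrapT => nx; apply: (nG x r1 r10) => u xu Gu; apply: nx; by exists u.
have [r2 r20 xr2] := sub_ball xx'.
have /nbhs_ballP[r3 /= r30 xr3] := open_nbhs_nbhs (conj oG Gx').
pose r4 := Num.min r2 r3; have r40 : 0 < r4 by rewrite lt_min r20.
have x4V u : ball x' r4 u -> V u /\ `|f u - y| <= d.
  by move=> xu; apply/xr1/xr2; apply: le_ball xu; rewrite ge_min lexx.
have x4G u : ball x' r4 u -> G u.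
  by move=> xu; apply: xr3; apply: le_ball xu; rewrite ge_min lexx orbT.
(* A regular point whose value may still lie in the image of the exceptional set; it serves to make
   [f] expanding nearby. *)
have [x0 xx0 ncx0] : exists2 x0, ball x' r4 x0 & ~ critical f x0.
  apply: contrapT => nx; apply: (@ball_not_measure_zero R m.+1 (critical f) x' r4 r40 _ fcrit) => u xu.
  by apply: contrapT => ncu; apply: nx; exact: (ex_intro2 _ _ u xu ncu).
have [A0 fA0 [dA0 C1x0 _]] := GA x0 (x4G _ xx0).
have detA0 : \det A0 != 0.
  apply/eqP => det0; apply: ncx0; apply: det0_critical => //.
  by rewrite dA0 det_tr.
have [r5 [c [r50 c0 fexp]]] := strict_diff_expanding fA0 detA0.
have [r6 r60 xr6] := sub_ball xx0.
pose r7 := Num.min r5 r6; have r70 : 0 < r7 by rewrite lt_min r50.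
have x57 u : ball x0 r7 u -> ball x0 r5 u by apply: le_ball; rewrite ge_min lexx.
have x67 u : ball x0 r7 u -> ball x' r4 u.
  by move=> xu; apply: xr6; apply: le_ball xu; rewrite ge_min lexx orbT.
have [x1 xx1 nSx1] := expanding_not_thin (ltnSn m) r70 c0 fc
  (fun u v xu xv => fexp u v (x57 u xu) (x57 v xv)) thS.
have [Vx1 fx1y] := x4V _ (x67 _ xx1); have Gx1 := x4G _ (x67 _ xx1).
have [A1 fA1 [_ _ A1ge0]] := GA x1 Gx1.
have [r8 r80 xr8] := sub_ball xx1.
have A1gt0 : 0 < (-1) ^+ sg * \det A1.
  rewrite lt_neqAle A1ge0 andbT eq_sym mulf_neq0// ?signr_eq0//.
  apply: (expanding_det fA1 r80 c0) => u v xu xv.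
  by apply: fexp; apply: x57; exact: xr8.
(* [G] is open, so its complement in [V] is compact, and [f x1] has positive distance to the image
   of that complement. *)
have [c2 c20 Vc2] : exists2 c2, 0 < c2 & forall u, (V `&` ~` G) u -> c2 <= `|f u - f x1|.
  apply: compact_gap => //.
    apply: (subclosed_compact _ cV); last by move=> u [].
    by apply: closedI; [exact: compact_closed cV|exact: open_closedC].
  by move=> u [_ nGu] fu; apply: nSx1; exists u.
have Vdet u : V u -> `|f u - f x1| <= c2 / 2 ->
    exists2 A, strict_diff f u A & 0 <= (-1) ^+ sg * \det A.
  move=> Vu fu; have [A fA [_ _ A0ge0]] : exists2 A, strict_diff f u A &
      [/\ dmx f u = A^T, C1_at f u & 0 <= (-1) ^+ sg * \det A].
    apply: GA; apply: contrapT => nGu.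
    by have := Vc2 u (conj Vu nGu); lra.
  by exists A.
apply/nbhs_ballP; exists d => // y2; rewrite -ball_normE /ball_/= distrC => yy2.
have HV u : V u -> `|f u - y| <= 2 * d -> ball u h2 `<=` V by rewrite d2; exact: Vh2.
have c220 : 0 < c2 / 2 by rewrite divr_gt0.
have [u Vu fu] := degree_surjective cV fc d0 h20 HV Vx1 fx1y (ltW yy2) c220 Vdet fA1 A1gt0.
by exists u => //; exact: VO.
Qed.

Lemma quasi_interior_surjective n (f : 'rV[R]_n -> 'rV[R]_n) :
  proper_map f -> continuous f -> quasi_interior f -> range f = setT.
Proof.
move=> fp fc fq; apply/seteqP; split=> // z _.
have openf u : interior (range f) (f u).
  (* With the whole space as the open set, every value is interior to the range; components of the
     compact fibres are compact. *)
  apply: (fq (f u) u) => //; last exact: openT.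
  have cX : compact (f @^-1` [set f u]) by apply: fp; exact: compact_set1.
  apply: (subclosed_compact _ cX); last exact: connected_component_sub.
  by apply: component_closed; exact: compact_closed cX.
have nc : continuous (fun y : 'rV[R]_n => `|y - z|).
  move=> y; apply/(@cvgrPdist_lt _ _ _ (nbhs y)) => e e0; apply/nbhs_ballP.
  exists e => //= w.
  rewrite -ball_normE /ball_/=; apply: le_lt_trans.
  have := ler_dist_dist (y - z) (w - z).
  by rewrite opprB addrA subrK.
(* The radius lets the ball contain the value [f 0], so its compact preimage is nonempty and the
   distance to [z] has a minimum on it. *)
pose r := `|f 0 - z|; pose B := [set y : 'rV[R]_n | `|y - z| <= r].
have cB : compact B.
  apply: bounded_closed_compact.
    exists (r + `|z|); split; first exact: num_real.
    move=> t rt y yr; have := ler_normD (y - z) z; rewrite subrK.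
    by move: yr; rewrite /B /=; lra.
  apply: (@closed_comp _ _ (fun y => `|y - z|) [set t | t <= r]); last exact: closed_le.
  by move=> y _; exact: nc.
have cfB := fp _ cB.
have gc : continuous (fun x => `|f x - z|).
  by move=> x; exact: (continuous_comp (fc x) (nc (f x))).
have [||x xB xmin] := @compact_EVT_min _ R (fun x => `|f x - z|) (f @^-1` B) _ cfB.
- by exists 0; rewrite /B /=.
- exact: continuous_subspaceT.
have [->|fxz] := eqVneq z (f x); first by exists x.
exfalso.
have dz : 0 < `|f x - z| by rewrite normr_gt0 subr_eq0 eq_sym.
have /nbhs_ballP[e /= e0 xe] := openf x.
(* Moving from [f x] towards [z] by the fraction [t] stays within the range and comes closer to
   [z]. *)
pose t := Num.min 1 (e / 2 / `|f x - z|).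
have t0 : 0 < t by rewrite lt_min ltr01 !divr_gt0.
have t1 : t <= 1 by rewrite ge_min lexx.
have te : t * `|f x - z| <= e / 2 by rewrite -ler_pdivlMr// ge_min lexx orbT.
have [|u _ fu] := xe (f x + t *: (z - f x)).
  rewrite -ball_normE /ball_/= opprD addrA subrr sub0r normrN normrZ gtr0_norm// distrC.
  by apply: le_lt_trans te _; lra.
have fuz : `|f u - z| = (1 - t) * `|f x - z|.
  have -> : f u - z = (1 - t) *: (f x - z).
    by rewrite fu scalerBl scale1r addrAC; congr (_ + _); rewrite -scalerN opprB.
  by rewrite normrZ ger0_norm// subr_ge0.
have fuz_lt : `|f u - z| < `|f x - z| by rewrite fuz gtr_pMl// ltrBlDr ltrDl.
have : u \in f @^-1` B.
  rewrite inE; apply: le_trans (ltW fuz_lt) _; by rewrite inE in xB.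
by move=> /xmin; rewrite leNgt fuz_lt.
Qed.

End main.

Theorem theorem6p1 (R : realType) (D : forall n : nat, set (set 'rV[R]_n))
    (D_ominimal : ominimal D) (n : nat) (f : 'rV[R]_n -> 'rV[R]_n)
    (f_proper : proper_map f) (f_continuous : continuous f)
    (f_definable : definable_map D f)
    (f_det : (forall x, ~ nonC1 f x -> 0 <= \det (dmx f x)) \/
             (forall x, ~ nonC1 f x -> \det (dmx f x) <= 0))
    (f_critical : measure_zero (critical f)) :
  range f = [set: 'rV[R]_n] /\ quasi_interior f.
Proof.
suff fq : quasi_interior f by split=> //; exact: quasi_interior_surjective.
have df := definable_map_dfun f_definable.
case: n => [|m] in f f_proper f_continuous f_definable f_det f_critical df *.
  (* R^0 is a single point, so the image of a nonempty set is everything; the degree is used in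
     positive dimension. *)
  have eq0 (u v : 'rV[R]_0) : u = v by apply/rowP => -[].
  move=> y x O fxy _ _ CO; rewrite (_ : f @` O = setT) ?interiorT//.
  apply/seteqP; split=> // z _; exists x; last exact: eq0.
  by apply: CO; exact: connected_component_refl.
have [sg fdet] : exists sg : bool,
    forall x, ~ nonC1 f x -> 0 <= (-1) ^+ sg * \det (dmx f x).
  case: f_det => fdet.
    by exists false => x fx; rewrite expr0 mul1r; exact: fdet.
  by exists true => x fx; rewrite expr1 mulN1r oppr_ge0; exact: fdet.
exact: (quasi_interior_succ D_ominimal f_proper f_continuous df fdet f_critical).
Qed.
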